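(* Let $c_0>0$, $\delta\ge c_0$ and $s<1/2$. Then the solution map of $$\partial_tu-\mathcal G_\delta(\partial_x^2u)-u^2u_x=0,\qquad u(x,0)=u_0(x)$$ is not $C^3$ in $H^s$: for no $T>0$ is the solution map $u_0\mapsto u$, viewed as a map from (a neighbourhood of $0$ in) $H^s(\mathbb R)$ to $C([0,T];H^s(\mathbb R))$, of class $C^3$ at the origin.
   Context: For $\delta>0$, $\mathcal{G}_\delta f=-i\,\mathcal{F}^{-1}\big[\coth(2\pi\delta\xi)-\frac{1}{2\pi\delta\xi}\big]\mathcal{F}f$, where $\mathcal F$ is the Fourier transform in $x$. The unknown $u$ is a real-valued function of $(x,t)\in\mathbb R\times\mathbb R$. The solution map is the flow map sending an initial datum $u_0$ to the corresponding solution $u$ (for smooth data, the classical solution). *)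

(* Defs.v *)
From HB Require Import structures.
From mathcomp Require Import all_boot all_order all_algebra.
From mathcomp Require Import all_classical all_reals all_analysis.
From mathcomp Require Import complex.
Set Implicit Arguments.
Unset Strict Implicit.
Unset Printing Implicit Defensive.
Import Order.TTheory GRing.Theory Num.Theory.
Import numFieldNormedType.Exports.
Local Open Scope classical_set_scope.
Local Open Scope ring_scope.
Local Open Scope complex_scope.

(** * Fréchet smoothness

  A normed space is presented by a real vector space [X] together with an
  extended seminorm [NX : X -> \bar R]: the space meant is
  [{x | NX x < +oo}], two points [x], [y] being identified when
  [NX (x - y) = 0].  In particular linearity is only required on
  [{x | NX x < +oo}] and up to vectors of norm [0]. *)

Section frechet.
Variable R : realType.
Implicit Types X Y : lmodType R.

Definition linear_on X Y (NX : X -> \bar R) (NY : Y -> \bar R) (L : X -> Y) :=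
  forall (a : R) (h k : X), (NX h < +oo)%E -> (NX k < +oo)%E ->
    NY (L (a *: h + k) - (a *: L h + L k)) = 0%E.

(* It is +oo when L is not linear or not bounded, so that the normed space
   presented by [opnorm NX NY] is the space of bounded linear operators. *)
Definition opnorm X Y (NX : X -> \bar R) (NY : Y -> \bar R) (L : X -> Y) :
    \bar R :=
  ereal_inf [set M%:E | M in [set M : R |
    [/\ 0 <= M, linear_on NX NY L &
        forall h, (NX h < +oo)%E -> (NY (L h) <= M%:E * NX h)%E]]].

Definition frechet_derivative X Y (NX : X -> \bar R) (NY : Y -> \bar R)
    (F : X -> Y) (x : X) (L : X -> Y) : Prop :=
  (opnorm NX NY L < +oo)%E /\
  forall e : R, 0 < e -> exists2 d : R, 0 < d &
    forall k : X, (NX k < d%:E)%E ->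
      (NY (F (x + k) - F x - L k)%R <= e%:E * NX k)%E.

Definition continuous_at_origin X Y (NX : X -> \bar R) (NY : Y -> \bar R)
    (F : X -> Y) : Prop :=
  forall e : R, 0 < e -> exists2 d : R, 0 < d &
    forall x : X, (NX x < d%:E)%E -> (NY (F x - F 0)%R < e%:E)%E.

(* C^0 at the origin is continuity at the origin; C^(n+1) at the origin is
   Fréchet differentiability on a ball around the origin, with a derivative
   (a map into the space of bounded operators) that is C^n at the origin. *)
Fixpoint Cn_at_origin (n : nat) X (NX : X -> \bar R) :
    forall Y, (Y -> \bar R) -> (X -> Y) -> Prop :=
  match n with
  | 0%N => fun Y NY F => continuous_at_origin NX NY F
  | m.+1 => fun Y NY F => exists D : X -> (X -> Y),
      (exists2 r : R, 0 < r & forall x : X, (NX x < r%:E)%E ->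
         frechet_derivative NX NY F x (D x)) /\
      @Cn_at_origin m X NX (X -> Y) (opnorm NX NY) D
  end.

End frechet.

(** * Real tempered distributions, Fourier transform and Sobolev spaces *)

Section sobolev.
Variable R : realType.
Notation mu := (@lebesgue_measure R).

Definition smooth (f : R -> R) : Prop :=
  forall (n : nat) (x : R), derivable (f^`(n))%classic x 1.

Record schwartz := Schwartz {
  schwartz_fun :> R -> R;
  schwartz_smooth : smooth schwartz_fun;
  schwartz_decay : forall m n : nat, exists M : R, forall x : R,
    `|x| ^+ m * `|(schwartz_fun^`(n))%classic x| <= M }.

(* Functionals on real Schwartz functions, extended C-linearly to complex
   ones.  Linearity and continuity are not part of the type: they hold for
   every functional satisfying [has_fourier] below. *)
Definition rdistribution : Type := schwartz -> R.

HB.instance Definition _ := GRing.Lmodule.on rdistribution.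

Definition dist_of (f : R -> R) : rdistribution :=
  fun psi => (\int[mu]_x (f x * psi x))%R.

Definition cintegral (f : R -> R[i]) : R[i] :=
  (\int[mu]_x complex.Re (f x))%R +i* (\int[mu]_x complex.Im (f x))%R.

(* The convention is  (F f)(xi) = \int f(x) e^(-2 i pi x xi) dx. *)
Definition inverse_fourier (psi : R -> R) (xi : R) : R[i] :=
  cintegral (fun x =>
    (psi x)%:C * (cos (2 * pi * x * xi) +i* sin (2 * pi * x * xi))).

(* || <xi>^s g ||_(L^2), with <xi> = (1 + xi^2)^(1/2) *)
Definition weighted_norm (s : R) (g : R -> R[i]) : \bar R :=
  'N[mu]_2%:E[(fun xi : R => ((1 + xi ^+ 2) `^ (s / 2) * Normc.normc (g xi))%:E)]%E.

(* [u] belongs to H^s and its Fourier transform is the function [g]; the last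
   clause reads  <u, psi> = <F u, F^-1 psi>. *)
Definition has_fourier (s : R) (u : rdistribution) (g : R -> R[i]) : Prop :=
  [/\ measurable_fun setT (fun xi : R => complex.Re (g xi)),
      measurable_fun setT (fun xi : R => complex.Im (g xi)),
      (weighted_norm s g < +oo)%E &
      forall psi : schwartz,
        (u psi)%:C = cintegral (fun xi => g xi * inverse_fourier psi xi)].

(* All the [g] are equal almost everywhere; the infimum only serves to give
   the value +oo to the distributions that are not in H^s. *)
Definition Hs_norm (s : R) (u : rdistribution) : \bar R :=
  ereal_inf [set weighted_norm s g | g in has_fourier s u].

(* v : R -> rdistribution belongs to C([0,T]; H^s); values outside [0,T] are
   ignored *)
Definition continuous_curve (T s : R) (v : R -> rdistribution) : Prop :=
  (forall t : R, t \in `[0, T] -> (Hs_norm s (v t) < +oo)%E) /\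
  forall t : R, t \in `[0, T] -> forall e : R, 0 < e ->
    exists2 d : R, 0 < d & forall t' : R, t' \in `[0, T] -> `|t' - t| < d ->
      (Hs_norm s (v t' - v t)%R < e%:E)%E.

(* The sup norm on C([0,T]; H^s), and +oo outside this space. *)
Definition CHs_norm (T s : R) (v : R -> rdistribution) : \bar R :=
  ereal_inf [set M%:E | M in [set M : R |
    [/\ 0 <= M, continuous_curve T s v &
        forall t : R, t \in `[0, T] -> (Hs_norm s (v t) <= M%:E)%E]]].

(** * The equation *)

Definition coth (z : R) : R :=
  (expR z + expR (- z)) / (expR z - expR (- z)).

Definition symbol_G (delta xi : R) : R[i] :=
  0 -i* (coth (2 * pi * delta * xi) - (2 * pi * delta * xi)^-1).

(* The graph of G_delta as an operator on L^2 = H^0; its symbol is bounded. *)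
Definition is_G (delta : R) (f v : R -> R) : Prop :=
  exists g : R -> R[i], has_fourier 0 (dist_of f) g /\
    has_fourier 0 (dist_of v) (fun xi => symbol_G delta xi * g xi).

Definition Hinfty (f : R -> R) : Prop :=
  smooth f /\ forall sigma : R, (Hs_norm sigma (dist_of f) < +oo)%E.

(* [u t x] stands for u(x,t).  Classical solution on [0,T], of class
   C([0,T]; H^oo), of  u_t - G_delta u_xx - u^2 u_x = 0,  u(.,0) = u0;
   [v] is the continuous representative of G_delta u_xx. *)
Definition classical_solution (delta T : R) (u0 : R -> R) (u : R -> R -> R) :
    Prop :=
  [/\ forall x, u 0 x = u0 x,
      forall t : R, t \in `[0, T] -> Hinfty (u t),
      forall sigma, continuous_curve T sigma (fun t => dist_of (u t)) &
      forall t : R, t \in `]0, T[ -> exists v : R -> R,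
        [/\ continuous v, is_G delta ((u t)^`(2))%classic v &
            forall x, is_derive t 1 (fun tau => u tau x)
                        (v x + (u t x) ^+ 2 * ((u t)^`())%classic x)]].

(* [Phi], on U, is the solution map from U, inside H^s, to C([0,T]; H^s). *)
Definition solution_map (delta T s : R) (U : set rdistribution)
    (Phi : rdistribution -> (R -> rdistribution)) : Prop :=
  (forall u0, U u0 -> (CHs_norm T s (Phi u0) < +oo)%E) /\
  forall u0 : R -> R, Hinfty u0 -> U (dist_of u0) ->
    exists2 u : R -> R -> R, classical_solution delta T u0 u &
      forall t : R, t \in `[0, T] -> Phi (dist_of u0) t = dist_of (u t).

Definition Hs_neighborhood_of_0 (s : R) (U : set rdistribution) : Prop :=
  (forall u0, U u0 -> (Hs_norm s u0 < +oo)%E) /\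
  exists2 r : R, 0 < r & forall u0, (Hs_norm s u0 < r%:E)%E -> U u0.

End sobolev.

(* Main.v *)
Require Import Defs.
From mathcomp Require Import all_boot all_order all_algebra.
From mathcomp Require Import all_classical all_reals all_analysis.
From mathcomp Require Import complex ring lra measurable_realfun.
Set Implicit Arguments.
Unset Strict Implicit.
Unset Printing Implicit Defensive.
Import Order.TTheory GRing.Theory Num.Theory.
Import numFieldNormedType.Exports.
Local Open Scope classical_set_scope.
Local Open Scope ring_scope.

(** The symbol of the linear part is [om xi = (2 pi xi)^2 c(xi)] with [c] odd and
  [0 <= c <= 1] on the positive axis, so the linear flow is unitary and the
  kinetic energy [\int u Ku], [K = -i c(D) d/dx >= 0], is controlled.  Conservation
  of mass and energy gives, for the solution [u] with datum [eps phi] and the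
  linear solution [v] with datum [phi], the bounds [\int u^4 = O(eps^4)] and
  [\int (u - eps v)^2 = O(eps^4)]; hence, against any linear solution [Psi],
    [d/dt \int u Psi = - 1/3 \int u^3 Psi_x = - eps^3/3 \int v^3 Psi_x + O(eps^4)].
  If the flow is C^3 at 0, the cubic coefficient is a third Frechet derivative and
  is bounded by a constant times [|phi|_{H^s}^3 |psi|_{H^{-s}}], [psi = Psi(t0)].
  For wave packets of frequency [N], focused so that [psi] is Schwartz, the norms
  are [O(N^s)] and [O(N^{-s})] whereas [- 1/3 \int v^3 Psi_x >= N/36] on a time
  interval [[0, t0]] independent of [N]; hence [N <= C N^{2s}], i.e. [s >= 1/2].

  Fourier analysis is carried out with the real Hartley transform
  [ht h x = \int h(xi) (cos + sin)(2 pi x xi) dxi], which is an involutive isometry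
  of real L^2. *)

(** * Integrals over the real line *)

(** The solution map is merely given, with no well-posedness theory behind it, so [u - eps v] cannot
    be estimated by iterating Duhamel's formula: all bounds come from conserved quantities. They
    work because the kinetic and quartic parts of the energy have the same sign. The resulting bound
    [u - eps v = O(eps^2)] in L^2 is weaker than the cubic order Duhamel would suggest, but it
    suffices: in [u^3 - eps^3 v^3] this difference multiplies a quadratic expression that is itself
    [O(eps^2)] in L^2. Integration in time is replaced by the mean value theorem. The cubic
    coefficient is then taken at an intermediate time that depends on [eps], so it is only bounded
    below, and the third derivative has to be extracted from an expansion with a variable
    coefficient. The time [t0] can be independent of [N] because the dispersion relation is
    quadratic up to linear and bounded terms: a packet of unit frequency width leaves its
    affine-phase model at a rate uniform in [N]. The Hartley transform keeps every pairing real; the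
    price is that an odd imaginary symbol acts with a reflection [xi -> -xi]. *)

Section integration.
Variable R : realType.
Notation mu := (@lebesgue_measure R).

Definition Int (f : R -> R) := mu.-integrable setT (EFin \o f).
Definition I (f : R -> R) : R := (\int[mu]_x f x)%R.
Definition meas (f : R -> R) := measurable_fun setT f.

Implicit Types f g h : R -> R.

Lemma Int_meas f : Int f -> meas f.
Proof. by move=> /(measurable_int mu) /measurable_EFinP. Qed.

Lemma cont_meas f : continuous f -> meas f.
Proof. exact: continuous_measurable_fun. Qed.

Lemma measD f g : meas f -> meas g -> meas (fun x => f x + g x).
Proof. by move=> *; apply: measurable_funD. Qed.
Lemma measB f g : meas f -> meas g -> meas (fun x => f x - g x).
Proof. by move=> *; apply: measurable_funB. Qed.
Lemma measM f g : meas f -> meas g -> meas (fun x => f x * g x).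
Proof. by move=> *; apply: measurable_funM. Qed.
Lemma measN f : meas f -> meas (fun x => - f x).
Proof. by move=> *; apply: measurableT_comp. Qed.
Lemma measX f n : meas f -> meas (fun x => f x ^+ n).
Proof. by move=> *; apply: measurable_funX. Qed.
Lemma meas_norm f : meas f -> meas (fun x => `|f x|).
Proof. by move=> *; apply: measurableT_comp. Qed.
Lemma meas_cst (c : R) : meas (fun=> c).
Proof. exact: measurable_cst. Qed.
Lemma meas_id : meas id.
Proof. exact: measurable_id. Qed.
Lemma meas_comp f g : meas f -> meas g -> meas (fun x => f (g x)).
Proof. by move=> mf mg; apply: measurableT_comp. Qed.

Lemma eq_Int f g : f =1 g -> Int f -> Int g.
Proof. by move=> /funext ->. Qed.
Lemma eq_I f g : f =1 g -> I f = I g.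
Proof. by move=> /funext ->. Qed.

Lemma IntD f g : Int f -> Int g -> Int (fun x => f x + g x).
Proof. by move=> If Ig; apply: eq_integrable (integrableD measurableT If Ig). Qed.
Lemma IntB f g : Int f -> Int g -> Int (fun x => f x - g x).
Proof. by move=> If Ig; apply: eq_integrable (integrableB measurableT If Ig). Qed.
Lemma IntZ c f : Int f -> Int (fun x => c * f x).
Proof. by move=> If; apply: eq_integrable (integrableZl measurableT c If). Qed.
Lemma IntN f : Int f -> Int (fun x => - f x).
Proof. by move=> /(IntZ (-1)); apply: eq_Int => x; rewrite mulN1r. Qed.
Lemma Int_norm f : Int f -> Int (fun x => `|f x|).
Proof. exact: integrable_norm. Qed.
Lemma Int0 : Int (fun=> 0).
Proof. exact: integrable0. Qed.

Lemma le_Int f g : meas f -> (forall x, `|f x| <= g x) -> Int g -> Int f.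
Proof.
move=> mf fg; apply: le_integrable => //; first exact/measurable_EFinP.
by move=> x _; rewrite lee_fin (le_trans (fg x))// ler_norm.
Qed.

Lemma IntMb f g (M : R) : meas g -> (forall x, `|g x| <= M) -> Int f ->
  Int (fun x => f x * g x).
Proof.
move=> mg gM If; apply: (le_Int (g := fun x => M * `|f x|)).
- exact: measM (Int_meas If) mg.
- by move=> x; rewrite normrM mulrC ler_wpM2r.
- exact/IntZ/Int_norm.
Qed.

Lemma ID f g : Int f -> Int g -> I (fun x => f x + g x) = I f + I g.
Proof. by move=> *; apply: RintegralD. Qed.
Lemma IB f g : Int f -> Int g -> I (fun x => f x - g x) = I f - I g.
Proof. by move=> *; apply: RintegralB. Qed.
Lemma IZ c f : Int f -> I (fun x => c * f x) = c * I f.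
Proof. by move=> *; apply: RintegralZl. Qed.
Lemma IZr c f : Int f -> I (fun x => f x * c) = I f * c.
Proof. by move=> *; apply: RintegralZr. Qed.
Lemma I_N f : Int f -> I (fun x => - f x) = - I f.
Proof. by move=> /(IZ (-1)); rewrite mulN1r => <-; apply: eq_I => x; rewrite mulN1r. Qed.
Lemma I0 : I (fun=> 0) = 0.
Proof. by rewrite /I Rintegral_cst// mul0r. Qed.
Lemma I_ge0 f : (forall x, 0 <= f x) -> 0 <= I f.
Proof. by move=> *; apply: Rintegral_ge0. Qed.
Lemma le_I f g : Int f -> Int g -> (forall x, f x <= g x) -> I f <= I g.
Proof. by move=> *; apply: le_Rintegral. Qed.
Lemma norm_I f : Int f -> `|I f| <= I (fun x => `|f x|).
Proof. by move=> *; apply: le_normr_Rintegral. Qed.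
Lemma norm_I_le f g : meas f -> Int g -> (forall x, `|f x| <= g x) ->
  `|I f| <= I g.
Proof.
move=> mf Ig fg; have If := le_Int mf fg Ig.
by apply: le_trans (norm_I If) _; apply: le_I => //; exact: Int_norm.
Qed.

Lemma EFin_I f : Int f -> (I f)%:E = (\int[mu]_x (f x)%:E)%E.
Proof. by move=> If; rewrite /I /Rintegral fineK//; exact: integrable_fin_num. Qed.

Lemma ge0_Int f : meas f -> (forall x, 0 <= f x) ->
  (\int[mu]_x (f x)%:E < +oo)%E -> Int f.
Proof.
move=> mf f0 foo; apply/integrableP; split; first exact/measurable_EFinP.
by under eq_integral do rewrite /= ger0_norm//.
Qed.

Lemma aeS (P Q : R -> Prop) : (forall x, P x -> Q x) ->
  {ae mu, forall x, P x} -> {ae mu, forall x, Q x}.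
Proof. by move=> PQ; apply: (@filterS _ _ (ae_filter_ringOfSetsType mu)). Qed.

Lemma ae_eq_I f g : Int f -> meas g -> {ae mu, forall x, f x = g x} ->
  Int g /\ I f = I g.
Proof.
move=> If mg fg.
have E : (\int[mu]_x `|(f x)%:E| = \int[mu]_x `|(g x)%:E|)%E.
  apply: ae_eq_integral => //.
  - by apply/measurable_EFinP; apply: meas_norm; exact: Int_meas.
  - by apply/measurable_EFinP; apply: meas_norm.
  - by apply: aeS fg => x /= -> _.
split.
  apply/integrableP; split; first exact/measurable_EFinP.
  by rewrite /= -E; move/integrableP : If => [].
rewrite /I /Rintegral; congr fine; apply: ae_eq_integral => //.
- by apply/measurable_EFinP; exact: Int_meas.
- exact/measurable_EFinP.
- by apply: aeS fg => x /= -> _.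
Qed.

Lemma I_eq0_ae f : Int f -> (forall x, 0 <= f x) -> I f = 0 ->
  {ae mu, forall x, f x = 0}.
Proof.
move=> If f0 If0.
have E : (\int[mu]_x `|(EFin \o f) x| = 0)%E.
  transitivity (\int[mu]_x (f x)%:E)%E; last by rewrite -(EFin_I If) If0.
  by apply: eq_integral => x _ /=; rewrite ger0_norm.
have [H _] := ae_eq_integral_abs mu measurableT (measurable_int mu If).
by move: (H E); apply: aeS => x /= /(_ Logic.I) [].
Qed.

Lemma cvg_dominated (F : nat -> R -> R) f g : (forall n, meas (F n)) -> meas f ->
  (forall x, F ^~ x @ \oo --> f x) -> Int g -> (forall n x, `|F n x| <= g x) ->
  (fun n => I (F n)) @ \oo --> I f.
Proof.
move=> mF mf Ff Ig Fg.
have [If _ H] : [/\ mu.-integrable setT (EFin \o f),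
    [sequence \int[mu]_x `|(F n x)%:E - (f x)%:E|]_n @ \oo --> 0%E &
    [sequence \int[mu]_x (F n x)%:E]_n @ \oo --> \int[mu]_x (f x)%:E]%E.
  apply: (@dominated_convergence _ _ _ mu setT measurableT
    (fun n x => (F n x)%:E) (EFin \o f) (EFin \o g)).
  - by move=> n; apply/measurable_EFinP; exact: mF.
  - exact/measurable_EFinP.
  - by apply: aeW => x _; apply: cvg_EFin; [exact: nearW|exact: Ff].
  - exact: Ig.
  - by apply: aeW => x n _; rewrite lee_fin; exact: Fg.
rewrite -(EFin_I If) in H.
exact: (fine_cvg H).
Qed.

(** The push-forward of Lebesgue measure under the affine map, multiplied by [|a|], agrees with
    Lebesgue measure on half-open intervals, hence everywhere. For [a < 0] the preimage is closed on
    the other side, which does not change its length. *)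
Lemma ge0_integral_affine (a b : R) (g : R -> \bar R) : a != 0 ->
  measurable_fun setT g -> (forall x, (0 <= g x)%E) ->
  (\int[mu]_x g x = `|a|%:E * \int[mu]_x g (a * x + b)%R)%E.
Proof.
move=> a0 mg g0.
have a0' : 0 < `|a| by rewrite normr_gt0.
pose aff := fun x : R => a * x + b.
have maff : measurable_fun setT (aff : R -> measurableTypeR R).
  by apply: measD; [apply: measM; [exact: meas_cst|exact: meas_id]|exact: meas_cst].
pose nu := mscale (NngNum (ltW a0'))
  (measure_function_pushforward__canonical__measure_function_Measure mu maff).
have E A : measurable A -> mu A = nu A.
  apply: lebesgue_measure_unique => X /ocitvP[->|[[x y] /= xy ->]].
    by rewrite !measure0.
  rewrite /nu /mscale /= /pushforward.
  have [an|ap] := ltP a 0.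
    have -> : aff @^-1` `]x, y] = `[(y - b) / a, (x - b) / a[%classic.
      apply/seteqP; split => z /=; rewrite !in_itv/= /aff.
        by rewrite ler_ndivrMr// ltr_ndivlMr// => /andP[? ?]; apply/andP; split; lra.
      by rewrite ler_ndivrMr// ltr_ndivlMr// => /andP[? ?]; apply/andP; split; lra.
    rewrite !lebesgue_measure_itv/= !lte_fin xy.
    rewrite ltr_ndivlMr// divfK ?lt_eqF// ltrD2r xy -!EFinD -EFinM ltr0_norm//.
    by congr EFin; field; lra.
  have {}ap : 0 < a by rewrite lt_neqAle eq_sym a0.
  have -> : aff @^-1` `]x, y] = `](x - b) / a, (y - b) / a]%classic.
    apply/seteqP; split => z /=; rewrite !in_itv/= /aff.
      by rewrite ler_pdivlMr// ltr_pdivrMr// => /andP[? ?]; apply/andP; split; lra.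
    by rewrite ler_pdivlMr// ltr_pdivrMr// => /andP[? ?]; apply/andP; split; lra.
  rewrite !lebesgue_measure_itv/= !lte_fin xy.
  rewrite ltr_pdivrMr// divfK ?gt_eqF// ltrD2r xy -!EFinD -EFinM gtr0_norm//.
  by congr EFin; field; lra.
transitivity (\int[nu]_x g x)%E; first by apply: eq_measure_integral => A mA _; exact: E.
by rewrite ge0_integral_mscale// ge0_integral_pushforward.
Qed.

Lemma Int_affine (a b : R) f : a != 0 -> Int f -> Int (fun x => f (a * x + b)).
Proof.
move=> a0 If; have mf := Int_meas If.
have maff : meas (fun x => a * x + b).
  by apply: measD; [apply: measM; [exact: meas_cst|exact: meas_id]|exact: meas_cst].
apply/integrableP; split.
  by apply/measurable_EFinP; exact: (meas_comp mf maff).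
move/integrableP : If => [_].
have -> : (\int[mu]_x `|(EFin \o f) x| = \int[mu]_x (`|f x|)%:E)%E by [].
rewrite (@ge0_integral_affine a b (fun x => (`|f x|)%:E) a0); first last.
- by move=> x; rewrite lee_fin.
- by apply/measurable_EFinP; exact: meas_norm.
rewrite muleC => H.
have : (`|a|%:E != 0)%E by rewrite eqe normr_eq0.
move: H; set J := (\int[mu]_x _)%E.
have J0 : (0 <= J)%E by apply: integral_ge0.
move=> H a0e; rewrite ltNge leye_eq; apply/negP => /eqP Joo.
by move: H; rewrite Joo mulyr gtr0_sg ?normr_gt0// mul1e ltxx.
Qed.

Lemma ge0_I_affine (a b : R) f : a != 0 -> Int f -> (forall x, 0 <= f x) ->
  I (fun x => f (a * x + b)) = `|a|^-1 * I f.
Proof.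
move=> a0 If f0.
have Ia := Int_affine b a0 If.
have : (I f)%:E = (`|a| * I (fun x => f (a * x + b)))%:E.
  rewrite EFinM (EFin_I If) (EFin_I Ia).
  apply: (@ge0_integral_affine a b (EFin \o f) a0); first exact: measurable_int If.
  by move=> x; rewrite lee_fin.
by case=> ->; rewrite mulrA mulVf ?mul1r// normr_eq0.
Qed.

Lemma I_affine (a b : R) f : a != 0 -> Int f ->
  I (fun x => f (a * x + b)) = `|a|^-1 * I f.
Proof.
move=> a0 If.
have Ip := IntD (Int_norm If) If; have In := Int_norm If.
(* Difference of two nonnegative integrable functions, to each of which [ge0_I_affine] applies. *)
have -> : I f = I (fun x => `|f x| + f x) - I (fun x => `|f x|).
  by rewrite -IB//; apply: eq_I => x; ring.
rewrite mulrBr -!(@ge0_I_affine a b)//.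
- rewrite -IB//; first by apply: eq_I => x; ring.
  + exact: (Int_affine b a0 Ip).
  + exact: (Int_affine b a0 In).
- by move=> x; have := ler_norm (- f x); rewrite normrN; lra.
Qed.

Lemma N1neq0 : (-1 : R) != 0.
Proof. by rewrite oppr_eq0 oner_neq0. Qed.

Lemma Int_opp f : Int f -> Int (fun x => f (- x)).
Proof.
move=> /(Int_affine 0 N1neq0).
by apply: eq_Int => x; rewrite addr0 mulN1r.
Qed.

Lemma I_opp f : Int f -> I (fun x => f (- x)) = I f.
Proof.
move=> If; have := I_affine 0 N1neq0 If.
by rewrite normrN1 invr1 mul1r => <-; apply: eq_I => x; rewrite addr0 mulN1r.
Qed.

Lemma I_odd f : Int f -> (forall x, f (- x) = - f x) -> I f = 0.
Proof.
move=> If fo; have := I_opp If; rewrite (eq_I fo) (I_N If); lra.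
Qed.

Lemma Int_shift (b : R) f : Int f -> Int (fun x => f (x + b)).
Proof.
by move=> /(Int_affine b (oner_neq0 R)); apply: eq_Int => x; rewrite mul1r.
Qed.

Lemma I_shift (b : R) f : Int f -> I (fun x => f (x + b)) = I f.
Proof.
move=> If; have := I_affine b (oner_neq0 R) If.
by rewrite normr1 invr1 mul1r => <-; apply: eq_I => x; rewrite mul1r.
Qed.

Definition L2 f := meas f /\ Int (fun x => f x ^+ 2).

Lemma L2_intro f g : meas f -> (forall x, f x ^+ 2 <= g x) -> Int g -> L2 f.
Proof.
move=> mf fg Ig; split => //; apply: le_Int Ig; first exact: measX.
by move=> x; rewrite ger0_norm ?sqr_ge0.
Qed.

Lemma L2D f g : L2 f -> L2 g -> L2 (fun x => f x + g x).
Proof.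
move=> [mf If] [mg Ig].
apply: (L2_intro (g := fun x => 2 * f x ^+ 2 + 2 * g x ^+ 2)); first exact: measD.
  by move=> x; have := sqr_ge0 (f x - g x); nra.
by apply: IntD; apply: IntZ.
Qed.

Lemma L2Z c f : L2 f -> L2 (fun x => c * f x).
Proof.
move=> [mf If]; split; first by apply: measM => //; exact: meas_cst.
by apply: eq_Int (IntZ (c ^+ 2) If) => x; rewrite exprMn.
Qed.

Lemma L2N f : L2 f -> L2 (fun x => - f x).
Proof.
by move=> /(L2Z (-1)); rewrite (_ : (fun x => -1 * f x) = (fun x => - f x))//;
  apply/funext => x; rewrite mulN1r.
Qed.

Lemma L2B f g : L2 f -> L2 g -> L2 (fun x => f x - g x).
Proof. by move=> ? ?; apply: L2D => //; exact: L2N. Qed.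

Lemma L2M f g : L2 f -> L2 g -> Int (fun x => f x * g x).
Proof.
move=> [mf If] [mg Ig].
apply: (le_Int (g := fun x => f x ^+ 2 + g x ^+ 2)); first exact: measM.
  move=> x; have h1 := sqr_ge0 (f x - g x); have h2 := sqr_ge0 (f x + g x).
  by rewrite ler_norml; apply/andP; split; nra.
exact: IntD.
Qed.

Lemma L2Mb f g (M : R) : meas g -> (forall x, `|g x| <= M) -> L2 f ->
  L2 (fun x => f x * g x).
Proof.
move=> mg gM [mf If]; split; first exact: measM.
have M0 : 0 <= M by exact: le_trans (gM 0).
apply: eq_Int (IntMb (f := fun x => f x ^+ 2) (measX 2 mg) (M := M ^+ 2) _ If).
  by move=> x; rewrite exprMn.
by move=> x; rewrite normrX lerXn2r ?nnegrE.
Qed.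

Lemma L2_opp f : L2 f -> L2 (fun x => f (- x)).
Proof.
move=> [mf If]; split; last exact: (Int_opp If).
by apply: meas_comp => //; apply: measN; exact: meas_id.
Qed.

(** The polynomial [t -> I ((t f + g)^2)] is nonnegative; it is evaluated at its minimiser
    [- B / A]. *)
Lemma CS f g : L2 f -> L2 g ->
  I (fun x => f x * g x) ^+ 2 <= I (fun x => f x ^+ 2) * I (fun x => g x ^+ 2).
Proof.
move=> Lf Lg; have Ifg := L2M Lf Lg; case: (Lf) (Lg) => [_ If] [_ Ig].
set A := I (fun x => f x ^+ 2); set B := I (fun x => f x * g x).
set C := I (fun x => g x ^+ 2).
have A0 : 0 <= A by apply: I_ge0 => x; exact: sqr_ge0.
have Q t : 0 <= A * t ^+ 2 + 2 * t * B + C.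
  have -> : A * t ^+ 2 + 2 * t * B + C = I (fun x => (t * f x + g x) ^+ 2).
    rewrite mulrC -(IZ (t ^+ 2) If) -(IZ (2 * t) Ifg) -ID; [|exact: IntZ..].
    rewrite -ID//; last by apply: IntD; exact: IntZ.
    by apply: eq_I => x; ring.
  by apply: I_ge0 => x; exact: sqr_ge0.
have [A00|An] := eqVneq A 0.
  have [->|B0] := eqVneq B 0; first by rewrite expr0n/= A00 mul0r.
  (* For [A = 0] the polynomial is affine in [t], and at this point its value would be [-1]. *)
  have := Q (- (C + 1) / (2 * B)); rewrite A00 mul0r add0r.
  have -> : 2 * (- (C + 1) / (2 * B)) * B = - (C + 1) by field.
  by lra.
have A0' : 0 < A by rewrite lt_neqAle eq_sym An.
have := Q (- B / A).
have -> : A * (- B / A) ^+ 2 + 2 * (- B / A) * B + C = (A * C - B ^+ 2) / A.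
  by field.
by rewrite pmulr_lge0 ?invr_gt0// subr_ge0.
Qed.

End integration.

(** * Rules of differentiation with explicit derivatives *)

Section calculus.
Variable R : realType.
Implicit Types (f g : R -> R) (x d df dg : R).

Lemma isD_eq f x d (d' : R) : is_derive x 1 f d -> d = d' -> is_derive x 1 f d'.
Proof. by move=> ? <-. Qed.
Lemma isD_cst (c x : R) : is_derive x 1 (fun=> c) 0.
Proof. exact: is_derive_cst. Qed.
Lemma isD_id (x : R) : is_derive x 1 (fun y : R => y) 1.
Proof. exact: is_derive_id. Qed.
Lemma isD_add f g x df dg : is_derive x 1 f df -> is_derive x 1 g dg ->
  is_derive x 1 (fun y => f y + g y) (df + dg).
Proof. by move=> ? ?; exact: is_deriveD. Qed.
Lemma isD_opp f x df : is_derive x 1 f df -> is_derive x 1 (fun y => - f y) (- df).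
Proof. by move=> ?; exact: is_deriveN. Qed.
Lemma isD_mul f g x df dg : is_derive x 1 f df -> is_derive x 1 g dg ->
  is_derive x 1 (fun y => f y * g y) (df * g x + f x * dg).
Proof.
move=> ? ?; apply: (isD_eq (is_deriveM _ _)).
by rewrite /GRing.scale/= addrC (mulrC (g x)).
Qed.
Lemma isD_exp f x df n : is_derive x 1 f df ->
  is_derive x 1 (fun y => f y ^+ n) (n%:R * f x ^+ n.-1 * df).
Proof.
move=> hf; elim: n => [|n IH]; first by rewrite !mul0r; exact: isD_cst.
under eq_fun do rewrite exprS; apply: isD_eq (isD_mul hf IH) _.
case: n {IH} => [|n] /=; first by rewrite !expr0; ring.
by rewrite [f x ^+ n.+1]exprS -[n.+2]addn1 natrD; ring.
Qed.
Lemma isD_comp f g x df dg : is_derive (g x) 1 f df -> is_derive x 1 g dg ->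
  is_derive x 1 (fun y => f (g y)) (df * dg).
Proof.
move=> hf hg; apply: (isD_eq (@is_derive1_comp _ f g x df dg hf hg)).
by [].
Qed.
Lemma isD_expR f x df : is_derive x 1 f df ->
  is_derive x 1 (fun y => expR (f y)) (expR (f x) * df).
Proof. by move=> ?; apply: isD_comp; exact: is_derive_expR. Qed.
Lemma isD_sin f x df : is_derive x 1 f df ->
  is_derive x 1 (fun y => sin (f y)) (cos (f x) * df).
Proof. by move=> ?; apply: isD_comp; exact: is_derive_sin. Qed.
Lemma isD_cos f x df : is_derive x 1 f df ->
  is_derive x 1 (fun y => cos (f y)) (- sin (f x) * df).
Proof. by move=> ?; apply: isD_comp; exact: is_derive_cos. Qed.
Lemma isD_inv f x df : f x != 0 -> is_derive x 1 f df ->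
  is_derive x 1 (fun y => (f y)^-1) (- (f x) ^- 2 * df).
Proof. by move=> fx0 hf; exact: (is_deriveV fx0 hf). Qed.

Lemma isD_cont f x df : is_derive x 1 f df -> {for x, continuous f}.
Proof. by move=> [? _]; exact/differentiable_continuous/derivable1_diffP. Qed.

Lemma isD_continuous f (df : R -> R) : (forall x, is_derive x 1 f (df x)) -> continuous f.
Proof. by move=> H x; exact: (isD_cont (H x)). Qed.

Lemma isD_derive1 f (df : R -> R) : (forall x, is_derive x 1 f (df x)) -> f^`()%classic = df.
Proof. by move=> H; apply/funext => x; rewrite derive1E; exact: (@derive_val _ _ _ _ _ _ _ (H x)). Qed.

End calculus.

(** The derivative is assembled by unification, hypotheses of the context being tried before the
    structural rules; what remains is an algebraic identity between the computed and the announced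
    derivative. *)
Ltac isD_step :=
  first [ exact: isD_id | apply: isD_cst | eassumption | eapply isD_add | eapply isD_opp | eapply isD_mul
        | eapply isD_exp | eapply isD_expR | eapply isD_sin | eapply isD_cos
        | eapply isD_inv ].
Ltac isD_tac := eapply isD_eq; [ repeat isD_step | ].

(** * Differentiation under the integral sign and Fubini's theorem *)

Section calculus2.
Variable R : realType.
Notation mu := (@lebesgue_measure R).
Implicit Types f g : R -> R.

Lemma cont_cst (c : R) : continuous (fun _ : R => c).
Proof. by move=> x; exact: cvg_cst. Qed.
Lemma cont_id : continuous (fun x : R => x).
Proof. by move=> x; exact: cvg_id. Qed.
Lemma contD f g : continuous f -> continuous g -> continuous (fun x => f x + g x).
Proof. by move=> cf cg x; apply: cvgD; [exact: cf|exact: cg]. Qed.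
Lemma contN f : continuous f -> continuous (fun x => - f x).
Proof. by move=> cf x; apply: cvgN; exact: cf. Qed.
Lemma contM f g : continuous f -> continuous g -> continuous (fun x => f x * g x).
Proof. by move=> cf cg x; apply: cvgM; [exact: cf|exact: cg]. Qed.
Lemma contX f n : continuous f -> continuous (fun x => f x ^+ n).
Proof.
move=> cf; elim: n => [|n IH]; first exact: cont_cst.
by under eq_fun do rewrite exprS; exact: contM.
Qed.
Lemma cont_comp f g : continuous f -> continuous g -> continuous (fun x => f (g x)).
Proof. by move=> cf cg x; apply: continuous_comp; [exact: cg|exact: cf]. Qed.

Lemma isD_I_loc (F F' : R -> R -> R) (a r : R) (G : R -> R) : 0 < r ->
  (forall x, Int (F x)) ->
  (forall x y : R, `|x - a| < r -> is_derive x 1 (F ^~ y) (F' x y)) ->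
  Int G -> (forall x y, `|x - a| < r -> `|F' x y| <= G y) ->
  is_derive a 1 (fun x => I (F x)) (I (F' a)).
Proof.
move=> r0 IF dF IG FG.
have xI x : `](a - r), (a + r)[%classic x -> `|x - a| < r.
  by rewrite /= in_itv/= => /andP[? ?]; rewrite ltr_norml; apply/andP; split; lra.
have d1 x y : `|x - a| < r -> partial1of2 F x y = F' x y.
  by move=> xr; rewrite partial1of2E; exact: (@derive_val _ _ _ _ _ _ _ (dF x y xr)).
have aa : `|a - a| < r by rewrite subrr normr0.
have Ia : `](a - r), (a + r)[%classic a by rewrite /= in_itv/=; apply/andP; split; lra.
have G0 y : 0 <= G y by apply: le_trans (FG a y aa); rewrite normr_ge0.
have der x y : `](a - r), (a + r)[%classic x -> [set: R] y -> derivable (F ^~ y) x 1.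
  by move=> /xI xr _; exact: (@ex_derive _ _ _ _ _ _ _ (dF x y xr)).
have dfb x y : `](a - r), (a + r)[%classic x -> [set: R] y -> `|partial1of2 F x y| <= G y.
  by move=> /xI xr _; rewrite d1//; exact: FG.
have H1 := @derivable_under_integral R _ _ mu F setT measurableT a _ _ Ia
  (fun x _ => IF x) der G G0 IG dfb.
have H2 := @differentiation_under_integral R _ _ mu F setT measurableT a _ _ Ia
  (fun x _ => IF x) der G G0 IG dfb.
apply: DeriveDef => //; rewrite -derive1E H2.
by apply: eq_I => y; rewrite d1.
Qed.

Lemma isD_I (F F' : R -> R -> R) (a : R) (G : R -> R) :
  (forall x, Int (F x)) -> (forall x y : R, is_derive x 1 (F ^~ y) (F' x y)) ->
  Int G -> (forall x y, `|x - a| < 1 -> `|F' x y| <= G y) ->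
  is_derive a 1 (fun x => I (F x)) (I (F' a)).
Proof.
by move=> IF dF IG FG; apply: (isD_I_loc (ltr01 : 0 < 1 :> R) IF _ IG FG) => x y _; exact: dF.
Qed.

Lemma cont_I (F : R -> R -> R) (G : R -> R) :
  (forall x, Int (F x)) -> (forall y, continuous (F ^~ y)) ->
  Int G -> (forall x y, `|F x y| <= G y) -> continuous (fun x => I (F x)).
Proof.
move=> IF cF IG FG a.
have Ia : a \in `](a - 1), (a + 1)[%classic.
  by rewrite inE /= in_itv/=; apply/andP; split; lra.
have c1 : {ae mu, forall y, [set: R] y ->
    {in `](a - 1), (a + 1)[%classic, continuous (F ^~ y)}}.
  by apply: aeW => y _ x _; exact: cF.
have c2 (x : R) : `](a - 1), (a + 1)[%classic x ->
    {ae mu, forall y, [set: R] y -> `|F x y| <= G y}.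
  by move=> _; apply: aeW => y _; exact: FG.
have H := @continuity_under_integral R _ _ mu F setT measurableT (a - 1) (a + 1)
  (fun x _ => IF x) c1 G IG c2.
exact: (H a Ia).
Qed.

Definition Int2 (F : R * R -> R) := (mu \x mu)%E.-integrable setT (EFin \o F).

Lemma Int2_dom (F : R * R -> R) (g : R -> R) :
  measurable_fun setT F -> (forall y, Int (fun x => F (x, y))) ->
  (forall y, I (fun x => `|F (x, y)|) <= g y) -> Int g -> Int2 F.
Proof.
move=> mF iF Fg Ig.
have mF' : measurable_fun setT (EFin \o F) by exact/measurable_EFinP.
apply: (proj2 (integrable21ltyP mu mu mF')).
apply: (@le_lt_trans _ _ (\int[mu]_y (g y)%:E)%E).
  apply: ge0_le_integral => //.
  - by move=> y _; apply: integral_ge0.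
  - have mF2 : measurable_fun setT (fun z : R * R => `|(EFin \o F) z|%E).
      exact: measurableT_comp.
    exact: (@measurable_fun_fubini_tonelli_G _ _ _ _ _ mu _ mF2).
  - exact: measurable_int Ig.
  - move=> y _ /=.
    by rewrite -(EFin_I (Int_norm (iF y))) lee_fin.
by rewrite -EFin_I// ltry.
Qed.

Lemma fubini (F : R * R -> R) : Int2 F ->
  (forall x, Int (fun y => F (x, y))) -> (forall y, Int (fun x => F (x, y))) ->
  [/\ Int (fun x => I (fun y => F (x, y))),
      Int (fun y => I (fun x => F (x, y))) &
      I (fun x => I (fun y => F (x, y))) = I (fun y => I (fun x => F (x, y)))].
Proof.
move=> I2 I1 I1'.
have E1 : fubini_F mu (EFin \o F) = EFin \o (fun x => I (fun y => F (x, y))).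
  by apply/funext => x /=; rewrite EFin_I.
have E2 : fubini_G mu (EFin \o F) = EFin \o (fun y => I (fun x => F (x, y))).
  by apply/funext => x /=; rewrite EFin_I.
have J1 : Int (fun x => I (fun y => F (x, y))).
  by rewrite /Int -E1; exact: integrable_fubini_F.
have J2 : Int (fun y => I (fun x => F (x, y))).
  have mF := measurable_int _ I2.
  have mG : measurable_fun setT (fubini_G mu (EFin \o F)) by exact: measurable_fubini_G I2.
  have mF2 : measurable_fun setT (fun z : R * R => `|(EFin \o F) z|%E).
    exact: measurableT_comp.
  have m0 := @measurable_fun_fubini_tonelli_G _ _ _ _ _ mu _ mF2 (fun=> abse_ge0 _).
  rewrite /Int -E2; apply/integrableP; split => //.
  apply: le_lt_trans (proj1 (integrable21ltyP mu mu mF) I2).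
  apply: ge0_le_integral => //; first exact: measurableT_comp.
  move=> y _; apply: le_abse_integral => //.
  exact: (measurable_int _ (I1' y)).
split => //; apply: EFin_inj; rewrite (EFin_I J1) (EFin_I J2).
have H1 : (\int[mu]_x (I (fun y => F (x, y)))%:E =
    \int[mu]_x \int[mu]_y (EFin \o F) (x, y))%E.
  by apply: eq_integral => x _; rewrite EFin_I.
have H2 : (\int[mu]_y (I (fun x => F (x, y)))%:E =
    \int[mu]_y \int[mu]_x (EFin \o F) (x, y))%E.
  by apply: eq_integral => x _; rewrite EFin_I.
by rewrite H1 H2; exact: (Fubini I2).
Qed.

Lemma fubini_prod (f g : R -> R) (k : R * R -> R) (M : R) :
  Int f -> Int g -> measurable_fun setT k -> (forall p, `|k p| <= M) ->
  [/\ Int (fun x => f x * I (fun y => g y * k (x, y))),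
      Int (fun y => g y * I (fun x => f x * k (x, y))) &
      I (fun x => f x * I (fun y => g y * k (x, y))) =
      I (fun y => g y * I (fun x => f x * k (x, y)))].
Proof.
move=> If Ig mk kM.
have mk1 x : meas (fun y => k (x, y)) by apply: measurableT_comp.
have mk2 y : meas (fun x => k (x, y)) by apply: measurableT_comp.
have I1 x : Int (fun y => g y * k (x, y)) by exact: IntMb (mk1 x) _ Ig.
have I2 y : Int (fun x => f x * k (x, y)) by exact: IntMb (mk2 y) _ If.
pose F (p : R * R) := f p.1 * g p.2 * k p.
have I1' x : Int (fun y => F (x, y)).
  by apply: eq_Int (IntZ (f x) (I1 x)) => y; rewrite /F/= mulrA.
have I2' y : Int (fun x => F (x, y)).
  by apply: eq_Int (IntZ (g y) (I2 y)) => x; rewrite /F/=; ring.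
have M0 : 0 <= M by exact: le_trans (kM (0, 0)).
have IF : Int2 F.
  apply: (@Int2_dom _ (fun y => (M * I (fun x => `|f x|)) * `|g y|)).
  - apply: measurable_funM => //; apply: measurable_funM.
      by apply: measurableT_comp; [exact: Int_meas|exact: measurable_fst].
    by apply: measurableT_comp; [exact: Int_meas|exact: measurable_snd].
  - exact: I2'.
  - move=> y; rewrite mulrAC -(IZ (M * `|g y|) (Int_norm If)).
    apply: le_I; [exact: Int_norm|by apply: IntZ; exact: Int_norm|] => x.
    rewrite /F/= !normrM.
    rewrite (_ : M * `|g y| * `|f x| = `|f x| * `|g y| * M); last by ring.
    by apply: ler_wpM2l => //; exact: mulr_ge0.
  - by apply: IntZ; exact: Int_norm.
have [J1 J2 E] := fubini IF I1' I2'.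
have E1 x : I (fun y => F (x, y)) = f x * I (fun y => g y * k (x, y)).
  by rewrite -(IZ _ (I1 x)); apply: eq_I => y; rewrite /F/= mulrA.
have E2 y : I (fun x => F (x, y)) = g y * I (fun x => f x * k (x, y)).
  by rewrite -(IZ _ (I2 y)); apply: eq_I => x; rewrite /F/=; ring.
by rewrite -(eq_I E1) -(eq_I E2); split => //; [exact: eq_Int J1|exact: eq_Int J2].
Qed.

End calculus2.

(** * Gaussians *)

Section gaussian.
Variable R : realType.
Notation mu := (@lebesgue_measure R).
Implicit Types (f g : R -> R) (a x y xi b c : R).

(** No limit of [F] at infinity is computed. The integral over [x] of [F (x + 1) - F x] vanishes by
    translation invariance; by the fundamental theorem and Fubini it is also the integral over [s]
    in [[0, 1]] of the translates of [f], that is, [I f]. This is the integration by parts used for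
    all conservation laws. *)
Lemma I_derive_eq0 (F f : R -> R) : (forall x : R, is_derive x 1 F (f x)) ->
  continuous f -> Int F -> Int f -> I f = 0.
Proof.
move=> dF cf IF If.
pose chi : R -> R := \1_(`[0, 1]%classic : set R).
have mchi : meas chi by apply: measurable_indic.
have chi1 s : `|chi s| <= 1 by rewrite /chi indicE; case: (_ \in _); rewrite ?normr1 ?normr0.
have Ichi : Int chi by exact: (@integrable_indic_itv R 0 1 true false).
have FTC x : F (x + 1) - F x = I (fun s => chi s * f (x + s)).
  have cF y : {for y, continuous F} := isD_cont (dF y).
  have H := @continuous_FTC2 R f F x (x + 1).
  have : (\int[mu]_(y in `[x, (x + 1)%R]) (f y)%:E = (F (x + 1))%:E - (F x)%:E)%E.
    apply: H.
    - by rewrite ltrDl.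
    - exact: continuous_subspaceT.
    - split.
      + by move=> y _; exact: (@ex_derive _ _ _ _ _ _ _ (dF y)).
      + by apply: cvg_at_right_filter; exact: cF.
      + by apply: cvg_at_left_filter; exact: cF.
    - by move=> y _; rewrite (isD_derive1 dF).
  move=> E.
  have -> : F (x + 1) - F x = (\int[mu]_(y in `[x, (x + 1)%R]) f y)%R.
    by rewrite /Rintegral E.
  rewrite Rintegral_mkcond.
  pose k y := chi (y - x) * f y.
  have Ik : Int k.
    apply: (eq_Int (f := fun y => f y * chi (y - x))); first by move=> y; rewrite mulrC.
    apply: (IntMb (M := 1)) => //.
    by apply: (meas_comp mchi); apply: measB; [exact: meas_id|exact: meas_cst].
  transitivity (I k).
    apply: eq_I => y; rewrite /k /chi indicE patchE.
    rewrite (_ : (y - x \in `[0, 1]%classic) = (y \in `[x, x + 1]%classic)); last first.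
      apply/idP/idP; rewrite !inE /= !in_itv/= => /andP[? ?]; apply/andP; split; lra.
    by case: (_ \in _); rewrite ?mul1r ?mul0r.
  rewrite -(I_shift x Ik); apply: eq_I => y; rewrite /k.
  by rewrite addrK (addrC y).
have H0 : I (fun x => F (x + 1) - F x) = 0.
  by rewrite IB ?I_shift ?subrr//; exact: Int_shift.
pose H (p : R * R) := chi p.2 * f (p.1 + p.2).
have mH : measurable_fun setT H.
  apply: measurable_funM; first by apply: measurableT_comp => //; exact: measurable_snd.
  apply: measurableT_comp; first exact: Int_meas.
  by apply: measurable_funD; [exact: measurable_fst|exact: measurable_snd].
have Hs x : Int (fun s => H (x, s)).
  rewrite /H /=; apply: (eq_Int (f := fun s => f (x + s) * chi s)) => [s|].
    by rewrite mulrC.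
  apply: (IntMb (M := 1)) => //.
  by apply: (eq_Int _ (Int_shift x If)) => s; rewrite addrC.
have Hx s : Int (fun x => H (x, s)) by exact: (IntZ (chi s) (Int_shift s If)).
have H2 : Int2 H.
  apply: (@Int2_dom _ _ (fun s => `|chi s| * I (fun x => `|f x|))) => //.
    move=> s; rewrite -(I_shift s (Int_norm If)) -(IZ _ (Int_shift s (Int_norm If))).
    by rewrite le_eqVlt; apply/orP; left; apply/eqP/eq_I => x; rewrite /H/= normrM.
  by apply: eq_Int (IntZ (I (fun x => `|f x|)) (Int_norm Ichi)) => s; rewrite mulrC.
have [_ _ E] := fubini H2 Hs Hx.
move: E; rewrite [in RHS](eq_I (g := fun s => chi s * I f)); last first.
  by move=> s; rewrite /H/= (IZ _ (Int_shift s If)) I_shift.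
rewrite (IZr _ Ichi).
have -> : I (fun x => I (fun y => H (x, y))) = 0.
  by rewrite -H0; apply: eq_I => x; rewrite FTC; apply: eq_I => s; rewrite /H /=.
have -> : I chi = 1.
  rewrite /I /Rintegral integral_indic// setIT.
  have := lebesgue_measure_itv `[(0 : R), 1]; rewrite /= lte_fin ltr01 -EFinD subr0.
  by move=> ->.
by rewrite mul1r.
Qed.

Lemma expR_powN n (y : R) : 0 <= y -> y ^+ n * expR (- y) <= n`!%:R.
Proof.
move=> y0; rewrite expRN ler_pdivrMr ?expR_gt0//.
have f0 : (0 : R) < n`!%:R by rewrite ltr0n fact_gt0.
rewrite mulrC -ler_pdivrMr//.
case: n f0 => [|n] f0; first by rewrite fact0 expr0 divr1 -{1}expR0 ler_expR.
by apply: le_trans (expR_ge1Dxn n y0); rewrite lerDr.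
Qed.

Definition gauss (a x : R) : R := expR (- (pi * a * x ^+ 2)).

Lemma gauss_gt0 a x : 0 < gauss a x. Proof. exact: expR_gt0. Qed.
Lemma gauss_ge0 a x : 0 <= gauss a x. Proof. exact: expR_ge0. Qed.
Lemma gaussN a x : gauss a (- x) = gauss a x.
Proof. by rewrite /gauss sqrrN. Qed.
Lemma gauss_le1 a x : 0 <= a -> gauss a x <= 1.
Proof.
move=> a0; rewrite /gauss -expR0 ler_expR oppr_le0.
by rewrite mulr_ge0 ?sqr_ge0// mulr_ge0// pi_ge0.
Qed.
Lemma gauss_norm a x : `|gauss a x| = gauss a x.
Proof. by rewrite ger0_norm ?gauss_ge0. Qed.

Lemma cont_gauss a : continuous (gauss a).
Proof.
apply: (@isD_continuous _ _ (fun x => - (2 * pi * a * x) * gauss a x)) => x.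
by rewrite /gauss; isD_tac; rewrite /=; ring.
Qed.
Lemma meas_gauss a : meas (gauss a).
Proof. by apply: cont_meas; exact: cont_gauss. Qed.

Lemma isD_gauss (a x : R) : is_derive x 1 (gauss a) (- (2 * pi * a * x) * gauss a x).
Proof. by rewrite /gauss; isD_tac; rewrite /=; ring. Qed.

Lemma Int_gauss_I a : 0 < a -> Int (gauss a) /\ I (gauss a) = (Num.sqrt a)^-1.
Proof.
move=> a0; pose c := Num.sqrt (pi * a) : R.
have pa0 : 0 < (pi * a : R) by rewrite mulr_gt0 ?pi_gt0.
have c0 : c != 0 by rewrite gt_eqF// sqrtr_gt0.
have E x : gauss_fun (c * x + 0) = gauss a x.
  by rewrite /gauss_fun /gauss addr0 exprMn sqr_sqrtr// ltW.
have Ig : Int (@gauss_fun R) by exact: integrableT_gauss.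
have IgE : I (@gauss_fun R) = Num.sqrt pi.
  by rewrite /I /Rintegral integralT_gauss.
split; first exact: eq_Int E (Int_affine 0 c0 Ig).
rewrite -(eq_I E) (I_affine 0 c0 Ig) IgE /c gtr0_norm ?sqrtr_gt0//.
rewrite sqrtrM ?pi_ge0//.
by field; rewrite !gt_eqF// sqrtr_gt0// pi_gt0.
Qed.

Lemma Int_gauss a : 0 < a -> Int (gauss a).
Proof. by move=> /Int_gauss_I []. Qed.
Lemma I_gauss a : 0 < a -> I (gauss a) = (Num.sqrt a)^-1.
Proof. by move=> /Int_gauss_I []. Qed.

(** Half of the exponent pays for the power, through [expR_powN] at a multiple of [x^2]; for
    [|x| > 1] the power [|x|^n] is first raised to [x^(2n)]. *)
Lemma gauss_pow_le a n x : 0 < a ->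
  `|x| ^+ n * gauss a x <= (1 + n`!%:R * (2 / (pi * a)) ^+ n) * gauss (a / 2) x.
Proof.
move=> a0.
have p0 : 0 < (pi : R) := pi_gt0 R.
have -> : gauss a x = gauss (a / 2) x * gauss (a / 2) x.
  by rewrite /gauss -expRD; congr expR; field.
rewrite mulrA; apply: ler_wpM2r; first exact: gauss_ge0.
have g1 : gauss (a / 2) x <= 1 by apply: gauss_le1; lra.
have c0 : 0 <= n`!%:R * (2 / (pi * a)) ^+ n :> R.
  by rewrite mulr_ge0// exprn_ge0// divr_ge0// mulr_ge0// ltW.
have [x1|x1] := leP `|x| 1.
  apply: (@le_trans _ _ 1); last by lra.
  by rewrite -[leRHS]mulr1 ler_pM ?gauss_ge0// ?exprn_ile1// exprn_ge0.
apply: (@le_trans _ _ (n`!%:R * (2 / (pi * a)) ^+ n)); last by lra.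
have xx : `|x| ^+ n <= (x ^+ 2) ^+ n.
  by rewrite lerXn2r ?nnegrE ?sqr_ge0// -(real_normK (num_real x)) expr2 ler_peMl// ltW.
apply: le_trans (ler_wpM2r (gauss_ge0 _ _) xx) _.
have y0 : 0 <= pi * (a / 2) * x ^+ 2 by rewrite mulr_ge0 ?sqr_ge0// mulr_ge0 ?ltW// divr_gt0.
have := expR_powN n y0.
rewrite -/(gauss (a / 2) x) exprMn => H.
have -> : (x ^+ 2) ^+ n * gauss (a / 2) x =
  (2 / (pi * a)) ^+ n * ((pi * (a / 2)) ^+ n * (x ^+ 2) ^+ n * gauss (a / 2) x).
  have h1 : (2 / (pi * a)) ^+ n * (pi * (a / 2)) ^+ n = 1.
    rewrite -exprMn (_ : 2 / (pi * a) * (pi * (a / 2)) = 1) ?expr1n//.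
    have a1 := lt0r_neq0 a0; move: (pi : R) (lt0r_neq0 p0) => q q0.
    by field; rewrite a1 q0.
  move: h1; set A := (_ / (pi * a)) ^+ n; set B := (pi * (a / 2)) ^+ n => h1.
  by rewrite -[LHS]mul1r -h1; ring.
by rewrite mulrC; apply: ler_wpM2r => //; rewrite exprn_ge0// divr_ge0// mulr_ge0// ltW.
Qed.

Lemma Int_pow_gauss a n : 0 < a -> Int (fun x => `|x| ^+ n * gauss a x).
Proof.
move=> a0.
apply: (le_Int (g := fun x => (1 + n`!%:R * (2 / (pi * a)) ^+ n) * gauss (a / 2) x)).
- by apply: measM; [apply: measX; apply: meas_norm; exact: meas_id|exact: meas_gauss].
- move=> x; rewrite ger0_norm; first exact: gauss_pow_le.
  by rewrite mulr_ge0 ?gauss_ge0 ?exprn_ge0.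
- by apply: IntZ; apply: Int_gauss; rewrite divr_gt0.
Qed.

Lemma norm_cos_le1 (z : R) : `|cos z| <= 1.
Proof. by rewrite ler_norml cos_geN1 trigo.cos_le1. Qed.
Lemma norm_sin_le1 (z : R) : `|sin z| <= 1.
Proof. by rewrite ler_norml sin_geN1 trigo.sin_le1. Qed.

Lemma cont_cos_lin (b c : R) : continuous (fun x : R => cos (b * x + c)).
Proof.
apply: (@isD_continuous _ _ (fun x => - sin (b * x + c) * b)) => x.
by isD_tac; rewrite /=; ring.
Qed.
Lemma cont_sin_lin (b c : R) : continuous (fun x : R => sin (b * x + c)).
Proof.
apply: (@isD_continuous _ _ (fun x => cos (b * x + c) * b)) => x.
by isD_tac; rewrite /=; ring.
Qed.
Lemma meas_cos_lin (b c : R) : meas (fun x => cos (b * x + c)).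
Proof. by apply: cont_meas; exact: cont_cos_lin. Qed.
Lemma meas_sin_lin (b c : R) : meas (fun x => sin (b * x + c)).
Proof. by apply: cont_meas; exact: cont_sin_lin. Qed.

Lemma Int_gauss_cos a b c : 0 < a -> Int (fun x => gauss a x * cos (b * x + c)).
Proof.
move=> a0; apply: (IntMb (M := 1)); [exact: meas_cos_lin|by move=> x; exact: norm_cos_le1|].
exact: Int_gauss.
Qed.
Lemma Int_gauss_sin a b c : 0 < a -> Int (fun x => gauss a x * sin (b * x + c)).
Proof.
move=> a0; apply: (IntMb (M := 1)); [exact: meas_sin_lin|by move=> x; exact: norm_sin_le1|].
exact: Int_gauss.
Qed.

(** The transform [F] satisfies [F' x = - 2 pi x F x], obtained by integrating the [y]-derivative of
    [gauss 1 y * sin (2 pi x y)]. Hence [F x * expR (pi x^2)] is constant, and [F 0 = 1]. *)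
Lemma fourier_gauss1 xi : I (fun x => gauss 1 x * cos (2 * pi * xi * x)) = gauss 1 xi.
Proof.
have lt01 := @ltr01 R.
pose F x := I (fun y => gauss 1 y * cos (2 * pi * x * y)).
pose F' x := I (fun y => - (2 * pi * y) * gauss 1 y * sin (2 * pi * x * y)).
have Ic x : Int (fun y => gauss 1 y * cos (2 * pi * x * y)).
  by apply: eq_Int (Int_gauss_cos (2 * pi * x) 0 lt01) => y; rewrite addr0.
have dF x : is_derive x 1 F (F' x).
  apply: (@isD_I R (fun x y => gauss 1 y * cos (2 * pi * x * y))
   (fun x y => - (2 * pi * y) * gauss 1 y * sin (2 * pi * x * y)) x
   (fun y => 2 * pi * (`|y| ^+ 1 * gauss 1 y))) => //.
  - by move=> z y; isD_tac; rewrite /=; ring.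
  - by apply: IntZ; exact: Int_pow_gauss.
  - move=> z y _; rewrite expr1 !normrM normrN !normrM gauss_norm normr_nat.
    rewrite (ger0_norm (pi_ge0 R)) -!mulrA ler_wpM2l// ler_wpM2l ?pi_ge0//.
    rewrite ler_wpM2l//.
    by rewrite -[leRHS]mulr1 ler_wpM2l ?gauss_ge0// norm_sin_le1.
have Im x : Int (fun y => - (2 * pi * y) * gauss 1 y * sin (2 * pi * x * y)).
  apply: (le_Int (g := fun y => 2 * pi * (`|y| ^+ 1 * gauss 1 y))).
  - apply: measM.
      apply: measM; last exact: meas_gauss.
      by apply: measN; apply: measM; [exact: meas_cst|exact: meas_id].
    by apply: cont_meas; move: (@cont_sin_lin (2 * pi * x) 0); under eq_fun do rewrite addr0.
  - move=> y; rewrite expr1 !normrM normrN !normrM gauss_norm normr_nat.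
    rewrite (ger0_norm (pi_ge0 R)) -!mulrA ler_wpM2l// ler_wpM2l ?pi_ge0//.
    rewrite ler_wpM2l//.
    by rewrite -[leRHS]mulr1 ler_wpM2l ?gauss_ge0// norm_sin_le1.
  - by apply: IntZ; exact: Int_pow_gauss.
have F'E x : F' x = - (2 * pi * x) * F x.
  have Ic' := IntZ (2 * pi * x) (Ic x).
  have : I (fun y => - (2 * pi * y) * gauss 1 y * sin (2 * pi * x * y) +
    2 * pi * x * (gauss 1 y * cos (2 * pi * x * y))) = 0.
    apply: (@I_derive_eq0 (fun y => gauss 1 y * sin (2 * pi * x * y))).
    - move=> y; have Hg := isD_gauss 1 y; isD_tac; rewrite /=.
      by rewrite mulr1; ring.
    - apply: contD; apply: contM.
      + apply: contM; last exact: cont_gauss.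
        by apply: contN; apply: contM; [exact: cont_cst|exact: cont_id].
      + by move: (@cont_sin_lin (2 * pi * x) 0); under eq_fun do rewrite addr0.
      + exact: cont_cst.
      + apply: contM; first exact: cont_gauss.
        by move: (@cont_cos_lin (2 * pi * x) 0); under eq_fun do rewrite addr0.
    - by apply: eq_Int (Int_gauss_sin (2 * pi * x) 0 lt01) => y; rewrite addr0.
    - exact: IntD.
  rewrite (ID (Im x) Ic') (IZ _ (Ic x)) -/(F x) -/(F' x); lra.
pose Q x := F x * expR (pi * x ^+ 2).
have dQ x : is_derive x 1 Q 0.
  have dFx := dF x; rewrite /Q; isD_tac; rewrite /= F'E; ring.
have := is_derive_0_is_cst xi 0 dQ.
rewrite /Q expr0n/= mulr0 expR0 mulr1.
have -> : F 0 = 1.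
  rewrite /F (eq_I (g := gauss 1)) => [|y]; last by rewrite mulr0 mul0r cos0 mulr1.
  by rewrite I_gauss// sqrtr1 invr1.
rewrite -/(F xi) => H.
by rewrite /gauss mulr1 expRN -[RHS]mul1r -H mulfK// gt_eqF// expR_gt0.
Qed.

Lemma fourier_gauss a xi : 0 < a ->
  I (fun x => gauss a x * cos (2 * pi * xi * x)) = (Num.sqrt a)^-1 * gauss a^-1 xi.
Proof.
move=> a0; pose c := Num.sqrt a.
have c0 : 0 < c by rewrite sqrtr_gt0.
have cn : c != 0 by rewrite gt_eqF.
have lt01 := @ltr01 R.
have Ic : Int (fun y => gauss 1 y * cos (2 * pi * (xi / c) * y)).
  by apply: eq_Int (Int_gauss_cos (2 * pi * (xi / c)) 0 lt01) => y; rewrite addr0.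
have := I_affine 0 cn Ic; rewrite fourier_gauss1 gtr0_norm//.
have -> : gauss 1 (xi / c) = gauss a^-1 xi.
  rewrite /gauss mulr1 expr_div_n sqr_sqrtr; last exact: ltW.
  by rewrite -[in RHS]mulrA [a^-1 * _]mulrC.
move=> <-; apply: eq_I => x; rewrite addr0; congr (_ * cos _).
  rewrite /gauss mulr1 exprMn sqr_sqrtr; last exact: ltW.
  by rewrite (mulrA pi a).
by move: (pi : R) => q; field.
Qed.

Lemma fourier_gauss_sin a xi : 0 < a ->
  I (fun x => gauss a x * sin (2 * pi * xi * x)) = 0.
Proof.
move=> a0; apply: I_odd.
  by apply: eq_Int (Int_gauss_sin (2 * pi * xi) 0 a0) => y; rewrite addr0.
by move=> x; rewrite gaussN mulrN sinN mulrN.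
Qed.

End gaussian.

(** * Density of bounded continuous functions in L^2 *)

Section density.
Variable R : realType.
Notation mu := (@lebesgue_measure R).
Implicit Types (f g h : R -> R) (a x y xi b c e M : R).

Lemma fatou_I (F : nat -> R -> R) f M : (forall n, Int (F n)) -> meas f ->
  (forall n x, 0 <= F n x) -> (forall x, F ^~ x @ \oo --> f x) ->
  (forall n, I (F n) <= M) -> Int f /\ I f <= M.
Proof.
move=> IF mf F0 Ff FM.
have f0 x : 0 <= f x.
  by apply: (cvgr_to_ge (Ff x)); apply: nearW => n; exact: F0.
have mF n : measurable_fun setT (fun x => (F n x)%:E) := measurable_int _ (IF n).
have H := @fatou _ _ _ mu setT measurableT (fun n x => (F n x)%:E) mF
  (fun n x _ => F0 n x).
have E : (\int[mu]_x (f x)%:E <= M%:E)%E.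
  apply: le_trans; last apply: le_trans; last first.
  - instantiate (1 := limn_einf (fun n => \int[mu]_x (F n x)%:E)%E).
    rewrite limn_einf_lim; apply: lime_le; first exact: is_cvg_einfs.
    apply: nearW => n; apply: (@le_trans _ _ (\int[mu]_x (F n x)%:E)%E).
      by apply: ereal_inf_lbound; exists n => /=.
    by rewrite -(EFin_I (IF n)) lee_fin.
  - exact: H.
  - rewrite le_eqVlt; apply/orP; left; apply/eqP; apply: eq_integral => x _.
    have Fx : (fun n => (F n x)%:E) @ \oo --> (f x)%:E.
      by apply: cvg_EFin; [exact: nearW|exact: Ff].
    by rewrite (fst (cvg_limn_einf_sup Fx)).
have If : Int f by apply: ge0_Int => //; exact: le_lt_trans E (ltry _).
by split => //; rewrite -lee_fin EFin_I.
Qed.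

(** [clip] truncates the value to [[-n, n]]; [cut] is the trapezoid equal to 1 for [|x| <= n] and to
    0 for [|x| >= n + 1]. Written with absolute values, both are visibly continuous and their
    inequalities reduce to linear arithmetic by cases on signs. *)
Definition clip (n y : R) : R := (`|y + n| - `|y - n|) / 2.
Definition cut (n x : R) : R := (`|n + 1 - `|x| | - `|n - `|x| | + 1) / 2.

Lemma clip_bound (n y : R) : 0 <= n -> `|clip n y| <= n.
Proof.
move=> n0; rewrite /clip; case: (ger0P (y + n)) => ?; case: (ger0P (y - n)) => ?;
  rewrite ler_norml; apply/andP; split; lra.
Qed.
Lemma clip_lip (n y z : R) : 0 <= n -> `|clip n y - clip n z| <= `|y - z|.
Proof.
move=> n0; rewrite /clip; case: (ger0P (y + n)) => ?; case: (ger0P (y - n)) => ?;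
  case: (ger0P (z + n)) => ?; case: (ger0P (z - n)) => ?; case: (ger0P (y - z)) => ?;
  rewrite ler_norml; apply/andP; split; lra.
Qed.
Lemma clip_id (n y : R) : `|y| <= n -> clip n y = y.
Proof.
rewrite ler_norml => /andP[? ?]; rewrite /clip.
by case: (ger0P (y + n)) => ?; case: (ger0P (y - n)) => ?; lra.
Qed.
Lemma clip_le (n y : R) : 0 <= n -> `|clip n y| <= `|y|.
Proof.
by move=> n0; have := @clip_lip n y 0 n0; rewrite subr0 (@clip_id n 0) ?normr0// subr0.
Qed.
Lemma cut01 (n x : R) : 0 <= cut n x <= 1.
Proof.
rewrite /cut; case: (ger0P (n + 1 - `|x|)) => ?; case: (ger0P (n - `|x|)) => ?;
  apply/andP; split; lra.
Qed.
Lemma cut1 (n x : R) : `|x| <= n -> cut n x = 1.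
Proof.
move=> ?; rewrite /cut.
by case: (ger0P (n + 1 - `|x|)) => ?; case: (ger0P (n - `|x|)) => ?; lra.
Qed.
Lemma cut0 (n x : R) : n + 1 <= `|x| -> cut n x = 0.
Proof.
move=> ?; rewrite /cut.
by case: (ger0P (n + 1 - `|x|)) => ?; case: (ger0P (n - `|x|)) => ?; lra.
Qed.
Lemma cont_norm f : continuous f -> continuous (fun x => `|f x|).
Proof. by move=> cf x; apply: cvg_norm; exact: cf. Qed.
Lemma cont_clip (n : R) f : continuous f -> continuous (fun x => clip n (f x)).
Proof.
move=> cf; apply: contM; last exact: cont_cst.
apply: contD; last apply: contN; apply: cont_norm; apply: contD => //; exact: cont_cst.
Qed.
Lemma cont_cut (n : R) : continuous (cut n).
Proof.
have cn : continuous (fun x : R => - `|x|) by apply: contN; apply: cont_norm; exact: cont_id.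
apply: contM; last exact: cont_cst.
apply: contD; last exact: cont_cst.
by apply: contD; last apply: contN; apply: cont_norm; apply: contD => //; exact: cont_cst.
Qed.

Lemma clip_cvg y : (fun n : nat => clip n%:R y) @ \oo --> y.
Proof.
apply: cvg_near_cst.
near=> n; rewrite clip_id//.
by near: n; exact: nbhs_infty_ger.
Unshelve. all: by end_near. Qed.

Lemma cut_cvg x : (fun n : nat => cut n%:R x) @ \oo --> (1 : R).
Proof.
apply: cvg_near_cst.
near=> n; rewrite cut1//.
by near: n; exact: nbhs_infty_ger.
Unshelve. all: by end_near. Qed.

(** Truncation in size and in space gives a bounded, compactly supported [hn n], close to [h] by
    dominated convergence. Continuous functions approximate [hn n] in L^1 only; clipping them at the
    same height [n] bounds the squared error by [2 n] times the L^1 error. *)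
Lemma dense_continuous h e : L2 h -> 0 < e ->
  exists h0, [/\ continuous h0, (exists M, forall x, `|h0 x| <= M), Int h0, L2 h0 &
     I (fun x => (h x - h0 x) ^+ 2) <= e].
Proof.
move=> Lh e0; have [mh Ih2] := Lh.
pose hn (n : nat) x := cut n%:R x * clip n%:R (h x).
have mhn n : meas (hn n).
  apply: measM; first by apply: cont_meas; exact: cont_cut.
  by apply: meas_comp mh; apply: cont_meas; apply: cont_clip; exact: cont_id.
have hn_le n x : `|hn n x| <= `|h x|.
  rewrite normrM; have /andP[c0 c1] := cut01 n%:R x.
  by rewrite (ger0_norm c0); apply: le_trans (ler_piMl _ c1) _ => //; exact: clip_le.
have [n Hn] : exists n, I (fun x => (h x - hn n x) ^+ 2) < e / 4.
  have H : (fun n => I (fun x => (h x - hn n x) ^+ 2)) @ \oo --> I (fun=> 0 : R).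
    apply: (@cvg_dominated R (fun n x => (h x - hn n x) ^+ 2) (fun=> 0)
      (fun x => 4 * h x ^+ 2)).
    - by move=> n; apply: measX; exact: measB.
    - exact: meas_cst.
    - move=> x; rewrite (_ : 0 = (h x - 1 * h x) ^+ 2); last by rewrite mul1r subrr expr0n.
      have HB : (fun n => h x - hn n x) @ \oo --> h x - 1 * h x.
        apply: cvgB; first exact: cvg_cst.
        by apply: cvgM; [exact: cut_cvg|exact: clip_cvg].
      exact: (cvgM HB HB).
    - exact: IntZ.
    - move=> n x; rewrite normrX.
      apply: (@le_trans _ _ ((`|h x| + `|h x|) ^+ 2)).
        rewrite lerXn2r ?nnegrE// ?addr_ge0//; apply: le_trans (ler_normB _ _) _.
        by rewrite lerD2l.
      rewrite -(real_normK (num_real (h x))); lra.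
  rewrite I0 in H; have e4 : 0 < e / 4 by lra.
  have [n _ Hn] := cvgr_lt _ H _ e4.
  by exists n; exact: (Hn n (leqnn n)).
pose N : R := n%:R + 2; have n0 : (0 : R) <= n%:R := ler0n _ _.
pose E : set R := `[- N, N]%classic.
have mE : measurable E by exact: measurable_itv.
have muE : (mu E < +oo)%E.
  by rewrite /E lebesgue_measure_itv/=; case: ifP => _; rewrite ?ltry// -EFinD ltry.
have chiI : Int (\1_E : R -> R) by exact: (@integrable_indic_itv R (- N) N true false).
have hn_n x : `|hn n x| <= n%:R.
  rewrite normrM; have /andP[c0 c1] := cut01 n%:R x.
  by rewrite (ger0_norm c0); apply: le_trans (ler_piMl _ c1) _ => //; exact: clip_bound.
have notE x : x \notin E -> N < `|x|.
  rewrite notin_setE /E/= in_itv/= => /negP; rewrite -ler_norml -ltNge; exact.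
have inE' x : x \in E -> `|x| <= N.
  by rewrite inE /E/= in_itv/= ler_norml.
have Ihn : Int (hn n).
  apply: (@le_Int R _ (fun x => n%:R * \1_E x)) => //; last exact: IntZ.
  move=> x; rewrite indicE; case: (boolP (x \in E)) => [_|/notE xE]; first by rewrite mulr1.
  by rewrite /N in xE; rewrite /hn cut0 ?mul0r ?mulr0 ?normr0//; lra.
have IhnE : mu.-integrable E (EFin \o hn n) by exact: integrableS Ihn.
have [g [cg Ig Hg]] := approximation_continuous_integrable mE muE IhnE.
have Ig' k : mu.-integrable E (EFin \o (fun z => `|hn n z - g k z|)).
  by apply: eq_integrable (integrable_abse (integrableB _ IhnE (Ig k))).
pose d k := I ((fun z => `|hn n z - g k z|) \_ E).
have Hd : d @ \oo --> (0 : R).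
  have -> : d = fine \o (fun k => \int[mu]_(z in E) `|(hn n z - g k z)%:E|)%E.
    by apply/funext => k; rewrite /d /I -Rintegral_mkcond.
  exact: fine_cvg Hg.
(* Chosen so that [(2 n + 1) * eta = e / 4]; the added 1 covers [n = 0]. *)
pose eta := e / (4 * (2 * n%:R + 1)).
have q0 : (0 : R) < 4 * (2 * n%:R + 1) by lra.
have eta0 : 0 < eta by rewrite divr_gt0.
have [k _ Hk] := cvgr_lt _ Hd _ eta0.
have {}Hk := Hk k (leqnn k); rewrite -/(d k) in Hk.
(* This cut-off is 1 wherever [hn n] may be nonzero, and vanishes outside [E]. *)
pose h0 x := cut (n%:R + 1) x * clip n%:R (g k x).
have ch0 : continuous h0.
  by apply: contM; [exact: cont_cut|apply: cont_clip; exact: cg].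
have h0_n x : `|h0 x| <= n%:R.
  rewrite normrM; have /andP[c0 c1] := cut01 (n%:R + 1) x.
  by rewrite (ger0_norm c0); apply: le_trans (ler_piMl _ c1) _ => //; exact: clip_bound.
have mh0 : meas h0 by exact: cont_meas.
have h0E x : x \notin E -> h0 x = 0.
  by move=> /notE xE; rewrite /N in xE; rewrite /h0 cut0 ?mul0r//; lra.
have Ih0 : Int h0.
  apply: (@le_Int R _ (fun x => n%:R * \1_E x)) => //; last exact: IntZ.
  move=> x; rewrite indicE; case: (boolP (x \in E)) => [_|/h0E ->]; first by rewrite mulr1.
  by rewrite mulr0 normr0.
have Lh0 : L2 h0.
  apply: (@L2_intro R _ (fun x => n%:R ^+ 2 * \1_E x)) => //; last exact: IntZ.
  move=> x; rewrite indicE; case: (boolP (x \in E)) => [_|/h0E ->].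
    by rewrite mulr1 -(real_normK (num_real (h0 x))) lerXn2r ?nnegrE.
  by rewrite mulr0 expr0n.
have Lhn : L2 (hn n).
  apply: (@L2_intro R _ (fun x => h x ^+ 2)) => // x.
  by rewrite -(real_normK (num_real (h x))) -(real_normK (num_real (hn n x))) lerXn2r ?nnegrE.
exists h0; split => //; first by exists n%:R.
have I1 : Int (fun x => (h x - hn n x) ^+ 2) by exact: (L2B Lh Lhn).2.
have I2 : Int (fun x => (hn n x - h0 x) ^+ 2) by exact: (L2B Lhn Lh0).2.
have Idk : Int ((fun z => `|hn n z - g k z|) \_ E).
  have J := proj1 (integrable_mkcond (mu := mu) _ mE) (Ig' k).
  apply: eq_integrable J => // x _.
  by rewrite /= !patchE; case: ifP.
have B2 : I (fun x => (hn n x - h0 x) ^+ 2) <= 2 * n%:R * d k.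
  rewrite /d -(IZ _ Idk); apply: le_I => //; first exact: IntZ.
  move=> x; rewrite patchE; case: (boolP (x \in E)) => [xE|xE]; last first.
    rewrite h0E// /hn cut0 ?mul0r ?subrr ?expr0n ?mulr0//.
    by move/notE : xE; rewrite /N; lra.
  rewrite -(real_normK (num_real (_ - _))) expr2; apply: ler_pM => //.
    by apply: le_trans (ler_normB _ _) _; have := hn_n x; have := h0_n x; lra.
  have [xn|xn] := leP `|x| (n%:R + 1).
    rewrite /h0 cut1// mul1r -{1}(@clip_id n%:R (hn n x))//.
    exact: clip_lip.
  rewrite /hn cut0 ?mul0r ?sub0r ?normrN; last lra.
  rewrite /h0 normrM; have /andP[c0 c1] := cut01 (n%:R + 1) x.
  by rewrite (ger0_norm c0); apply: le_trans (ler_piMl _ c1) _ => //; exact: clip_le.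
have B3 : 2 * n%:R * d k <= e / 4.
  apply: (@le_trans _ _ ((2 * n%:R + 1) * eta)).
    have d0 : 0 <= d k by apply: I_ge0 => x; rewrite patchE; case: ifP.
    by nra.
  by rewrite /eta le_eqVlt; apply/orP; left; apply/eqP; field; lra.
apply: (@le_trans _ _ (I (fun x => 2 * (h x - hn n x) ^+ 2 + 2 * (hn n x - h0 x) ^+ 2))).
  apply: le_I; [exact: (L2B Lh Lh0).2|by apply: IntD; exact: IntZ|] => x.
  by have := sqr_ge0 ((h x - hn n x) - (hn n x - h0 x)); nra.
rewrite ID ?IZ//; [lra|exact: IntZ..].
Qed.

End density.

(** * The Hartley transform *)

Section hartley.
Variable R : realType.
Notation mu := (@lebesgue_measure R).
Implicit Types (f g h : R -> R) (a x y xi b c e M : R).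

Definition cas (z : R) : R := cos z + sin z.
Definition ht h x := I (fun xi => h xi * cas (2 * pi * xi * x)).

Lemma cas_le z : `|cas z| <= 2.
Proof.
apply: le_trans (ler_normD _ _) _.
by have := norm_cos_le1 z; have := norm_sin_le1 z; lra.
Qed.

Lemma isD_cas f x df : is_derive x 1 f df ->
  is_derive x 1 (fun y => cas (f y)) (cas (- f x) * df).
Proof.
by move=> hf; rewrite /cas; isD_tac; rewrite cosN sinN; ring.
Qed.

Lemma cont_cas : continuous cas.
Proof.
apply: (@isD_continuous _ _ (fun x => cas (- x))) => x.
by apply: isD_eq (isD_cas (isD_id x)) _; rewrite mulr1.
Qed.

Lemma meas_cas f : meas f -> meas (fun x => cas (f x)).
Proof. by move=> mf; apply: meas_comp mf; apply: cont_meas; exact: cont_cas. Qed.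

Lemma meas_lin (c : R) : meas (fun x => c * x).
Proof. by apply: measM; [exact: meas_cst|exact: meas_id]. Qed.

Lemma meas_cas_l x : meas (fun xi => cas (2 * pi * xi * x)).
Proof.
apply: meas_cas; apply: measM; last exact: meas_cst.
exact: meas_lin.
Qed.

Lemma Int_cas h x : Int h -> Int (fun xi => h xi * cas (2 * pi * xi * x)).
Proof.
by apply: IntMb; [exact: meas_cas_l|move=> xi; exact: cas_le].
Qed.

Lemma ht_bound h x : Int h -> `|ht h x| <= 2 * I (fun xi => `|h xi|).
Proof.
move=> Ih; rewrite -(IZ 2 (Int_norm Ih)).
apply: norm_I_le.
- by apply: measM; [exact: Int_meas|exact: meas_cas_l].
- by apply: IntZ; exact: Int_norm.
- by move=> xi; rewrite normrM mulrC; apply: ler_wpM2r => //; exact: cas_le.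
Qed.

Lemma cont_ht h : Int h -> continuous (ht h).
Proof.
move=> Ih; apply: (@cont_I R (fun x xi => h xi * cas (2 * pi * xi * x))
  (fun xi => 2 * `|h xi|)).
- by move=> x; exact: Int_cas.
- move=> xi; apply: contM; first exact: cont_cst.
  apply: (cont_comp cont_cas); apply: contM; first exact: cont_cst.
  exact: cont_id.
- by apply: IntZ; exact: Int_norm.
- by move=> x xi; rewrite normrM mulrC; apply: ler_wpM2r => //; exact: cas_le.
Qed.
Lemma meas_ht h : Int h -> meas (ht h).
Proof. by move=> Ih; apply: cont_meas; exact: cont_ht. Qed.

Lemma htB g h x : Int g -> Int h -> ht (fun xi => g xi - h xi) x = ht g x - ht h x.
Proof.
move=> Ig Ih; rewrite /ht -IB; [|exact: Int_cas..].
by apply: eq_I => xi; rewrite mulrBl.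
Qed.
Lemma htZ c h x : Int h -> ht (fun xi => c * h xi) x = c * ht h x.
Proof.
move=> Ih; rewrite /ht -IZ; [|exact: Int_cas..].
by apply: eq_I => xi; rewrite mulrA.
Qed.
Lemma ht_ae h g x : Int h -> meas g -> {ae mu, forall xi, h xi = g xi} ->
  ht h x = ht g x.
Proof.
move=> Ih mg hg.
have [] := @ae_eq_I R _ (fun xi => g xi * cas (2 * pi * xi * x)) (Int_cas x Ih) => //.
- by apply: measM => //; exact: meas_cas_l.
- by apply: aeS hg => xi ->.
Qed.

(* [ht (hD h)] is the derivative of [ht h]: differentiation exchanges cos and sin, hence the reflection. *)
Definition hD h xi := - (2 * pi * xi) * h (- xi).

Lemma isD_ht h x : Int h -> Int (fun xi => xi * h xi) ->
  Int (hD h) /\ is_derive x 1 (ht h) (ht (hD h) x).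
Proof.
move=> Ih Ixh.
have ID1 : Int (hD h).
  apply: eq_Int (IntZ (2 * pi) (Int_opp Ixh)) => xi; rewrite /hD; ring.
split => //.
have H : is_derive x 1 (ht h) (I (fun xi => h xi * (cas (- (2 * pi * xi * x)) * (2 * pi * xi)))).
  apply: (@isD_I R (fun x xi => h xi * cas (2 * pi * xi * x))
    (fun x xi => h xi * (cas (- (2 * pi * xi * x)) * (2 * pi * xi))) x
    (fun xi => 4 * pi * `|xi * h xi|)).
  - by move=> z; exact: Int_cas.
  - move=> z xi; have hc : is_derive z 1 (fun z : R => 2 * pi * xi * z) (2 * pi * xi).
      by isD_tac; rewrite /=; ring.
    by have hh := isD_cas hc; isD_tac; rewrite /=; ring.
  - by apply: IntZ; exact: Int_norm.
  - move=> z xi _; rewrite !normrM normr_nat (ger0_norm (pi_ge0 R)).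
    rewrite (_ : 4 * pi * (`|xi| * `|h xi|) = `|h xi| * (2 * (2 * pi * `|xi|))); last by ring.
    apply: ler_wpM2l => //; apply: ler_wpM2r; last exact: cas_le.
    by rewrite !mulr_ge0// pi_ge0.
apply: isD_eq H _; rewrite /ht.
have Ihd := Int_cas x ID1.
rewrite -(I_opp Ihd); apply: eq_I => xi.
rewrite /hD opprK (_ : 2 * pi * - xi * x = - (2 * pi * xi * x)); last by ring.
by ring.
Qed.

Lemma ht_swap f h : Int f -> Int h ->
  I (fun x => f x * ht h x) = I (fun xi => h xi * ht f xi).
Proof.
move=> If Ih.
have mk : measurable_fun setT (fun p : R * R => cas (2 * pi * p.2 * p.1)).
  apply: measurableT_comp; first by apply: cont_meas; exact: cont_cas.
  apply: measurable_funM; last exact: measurable_fst.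
  by apply: measurable_funM => //; exact: measurable_snd.
have [_ _ E] := fubini_prod If Ih mk (fun p => cas_le _).
rewrite [LHS]E; apply: eq_I => xi; congr (_ * _); apply: eq_I => x /=.
by rewrite -!mulrA (mulrC xi).
Qed.

(** The Fourier transform of [gauss a]: a probability density that concentrates at 0 as [a] tends to
    0. *)
Definition Gk a z := (Num.sqrt a)^-1 * gauss a^-1 z.

Lemma Gk_ge0 a z : 0 <= Gk a z.
Proof. by rewrite mulr_ge0 ?gauss_ge0// invr_ge0 sqrtr_ge0. Qed.
Lemma Gk_sym a x y : Gk a (x - y) = Gk a (y - x).
Proof. by rewrite /Gk -gaussN opprB. Qed.
Lemma Gk_le a z : 0 < a -> Gk a z <= (Num.sqrt a)^-1.
Proof.
move=> a0; rewrite /Gk -[leRHS]mulr1 ler_wpM2l ?invr_ge0 ?sqrtr_ge0//.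
by apply: gauss_le1; rewrite invr_ge0 ltW.
Qed.
Lemma Int_Gk a xi : 0 < a -> Int (fun eta => Gk a (xi - eta)).
Proof.
move=> a0; have Ig : Int (gauss a^-1) by apply: Int_gauss; rewrite invr_gt0.
apply: eq_Int (IntZ (Num.sqrt a)^-1 (Int_shift (- xi) Ig)) => eta.
by rewrite /Gk -gaussN opprB.
Qed.
Lemma I_Gk a xi : 0 < a -> I (fun eta => Gk a (xi - eta)) = 1.
Proof.
move=> a0; have Ig : Int (gauss a^-1) by apply: Int_gauss; rewrite invr_gt0.
rewrite (eq_I (g := fun eta => (Num.sqrt a)^-1 * gauss a^-1 (eta + - xi))); last first.
  by move=> eta; rewrite /Gk -gaussN opprB.
rewrite (IZ _ (Int_shift (- xi) Ig)) (I_shift (- xi) Ig) I_gauss ?invr_gt0//.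
by rewrite sqrtrV ?ltW// invrK mulVf// gt_eqF// sqrtr_gt0.
Qed.
Lemma cont_Gk_l a eta : continuous (fun xi => Gk a (xi - eta)).
Proof.
apply: contM; first exact: cont_cst.
apply: cont_comp; first exact: cont_gauss.
by apply: contD; [exact: cont_id|exact: cont_cst].
Qed.
Lemma meas_Gk a xi : meas (fun eta => Gk a (xi - eta)).
Proof.
by rewrite (_ : (fun _ => _) = (fun eta => Gk a (eta - xi)));
  [apply: cont_meas; exact: cont_Gk_l|apply/funext => eta; exact: Gk_sym].
Qed.

(** The product of two [cas] is the cosine of the difference plus the sine of the sum. The sine part
    integrates to 0 by parity, so a convolution kernel in [xi - eta] remains. *)
Lemma gauss_cas_cas a xi eta : 0 < a ->
  I (fun x => gauss a x * cas (2 * pi * x * xi) * cas (2 * pi * x * eta)) = Gk a (xi - eta).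
Proof.
move=> a0.
have I1 : Int (fun x => gauss a x * cos (2 * pi * (xi - eta) * x)).
  by apply: eq_Int (Int_gauss_cos (2 * pi * (xi - eta)) 0 a0) => y; rewrite addr0.
have I2 : Int (fun x => gauss a x * sin (2 * pi * (xi + eta) * x)).
  by apply: eq_Int (Int_gauss_sin (2 * pi * (xi + eta)) 0 a0) => y; rewrite addr0.
rewrite -[RHS]addr0 -(fourier_gauss_sin (xi + eta) a0) /Gk -(fourier_gauss (xi - eta) a0).
rewrite -ID//; apply: eq_I => x.
have -> : 2 * pi * (xi - eta) * x = 2 * pi * x * xi - 2 * pi * x * eta by ring.
have -> : 2 * pi * (xi + eta) * x = 2 * pi * x * xi + 2 * pi * x * eta by ring.
by rewrite cosB sinD /cas; ring.
Qed.

Definition conv a g xi := I (fun eta => g eta * Gk a (xi - eta)).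

Lemma Int_conv_in a g xi : 0 < a -> Int g -> Int (fun eta => g eta * Gk a (xi - eta)).
Proof.
move=> a0; apply: IntMb; first exact: meas_Gk.
by move=> eta; rewrite (ger0_norm (Gk_ge0 _ _)); exact: Gk_le.
Qed.

Lemma cont_conv a g : 0 < a -> Int g -> continuous (conv a g).
Proof.
move=> a0 Ig.
apply: (@cont_I R (fun xi eta => g eta * Gk a (xi - eta))
  (fun eta => (Num.sqrt a)^-1 * `|g eta|)).
- by move=> xi; exact: Int_conv_in.
- by move=> eta; apply: contM; [exact: cont_cst|exact: cont_Gk_l].
- by apply: IntZ; exact: Int_norm.
- move=> xi eta; rewrite normrM mulrC; apply: ler_wpM2r => //.
  by rewrite (ger0_norm (Gk_ge0 _ _)); exact: Gk_le.
Qed.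

(** Parseval's identity with a Gaussian factor inserted, which makes each exchange of integrals
    legitimate for merely integrable [g] and [h]. The factor is removed as [a] tends to 0. *)
Lemma ht_ht_gauss a g h : 0 < a -> Int g -> Int h ->
  I (fun x => ht g x * ht h x * gauss a x) = I (fun xi => g xi * conv a h xi).
Proof.
move=> a0 Ig Ih.
have If : Int (fun x => gauss a x * ht h x).
  apply: (IntMb (M := 2 * I (fun xi => `|h xi|))); first exact: meas_ht.
    by move=> x; exact: ht_bound.
  exact: Int_gauss.
transitivity (I (fun x => (gauss a x * ht h x) * ht g x)).
  by apply: eq_I => x; ring.
rewrite (ht_swap If Ig); apply: eq_I => xi; congr (_ * _).
have Ic : Int (fun x => gauss a x * cas (2 * pi * x * xi)).
  apply: (IntMb (M := 2)); [exact: meas_cas_l|by move=> ?; exact: cas_le|].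
  exact: Int_gauss.
transitivity (I (fun x => (gauss a x * cas (2 * pi * x * xi)) * ht h x)).
  by apply: eq_I => x; ring.
rewrite (ht_swap Ic Ih); apply: eq_I => eta; congr (_ * _).
exact: gauss_cas_cas.
Qed.

(** Jensen's inequality for the probability density [Gk a (xi - _)]: the variance of [g] about its
    mean [c] is nonnegative. *)
Lemma conv_sqr a g xi : 0 < a -> Int g -> L2 g ->
  conv a g xi ^+ 2 <= conv a (fun eta => g eta ^+ 2) xi.
Proof.
move=> a0 Ig [mg Ig2].
set c := conv a g xi.
have J1 := Int_conv_in xi a0 Ig; have J2 := Int_conv_in xi a0 Ig2.
have J3 := Int_Gk xi a0.
have : 0 <= I (fun eta => (g eta - c) ^+ 2 * Gk a (xi - eta)).
  by apply: I_ge0 => eta; rewrite mulr_ge0 ?sqr_ge0 ?Gk_ge0.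
rewrite (eq_I (g := fun eta => g eta ^+ 2 * Gk a (xi - eta) -
    (2 * c) * (g eta * Gk a (xi - eta)) + c ^+ 2 * Gk a (xi - eta))); last first.
  by move=> eta; ring.
have K1 := IntZ (2 * c) J1; have K2 := IntZ (c ^+ 2) J3; have K3 := IntB J2 K1.
rewrite (ID K3 K2) (IB J2 K1) (IZ _ J1) (IZ _ J3) I_Gk// -/(conv a g xi) -/c -/(conv a (fun eta => g eta ^+ 2) xi).
lra.
Qed.

Lemma I_conv a g : 0 < a -> Int g -> Int (conv a g) /\ I (conv a g) = I g.
Proof.
move=> a0 Ig.
pose F (p : R * R) := g p.2 * Gk a (p.1 - p.2).
have E2 eta : I (fun xi => Gk a (xi - eta)) = 1.
  by rewrite -(I_Gk eta a0); apply: eq_I => xi; exact: Gk_sym.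
have J2 eta : Int (fun xi => Gk a (xi - eta)).
  by apply: eq_Int (Int_Gk eta a0) => xi; exact: Gk_sym.
have Fx xi : Int (fun eta => F (xi, eta)) by exact: Int_conv_in.
have Fy eta : Int (fun xi => F (xi, eta)) by exact: (IntZ (g eta) (J2 eta)).
have F2 : Int2 F.
  apply: (@Int2_dom _ _ (fun eta => `|g eta|)) => //; last exact: Int_norm.
    apply: measurable_funM.
      by apply: measurableT_comp; [exact: Int_meas|exact: measurable_snd].
    apply: measurable_funM => //; apply: measurableT_comp; first exact: meas_gauss.
    by apply: measurable_funB; [exact: measurable_fst|exact: measurable_snd].
  move=> eta; rewrite -[leRHS]mulr1 -(E2 eta) -(IZ _ (J2 eta)).
  rewrite le_eqVlt; apply/orP; left; apply/eqP/eq_I => xi.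
  by rewrite /F/= normrM (ger0_norm (Gk_ge0 _ _)).
have [K1 _ E] := fubini F2 Fx Fy.
split; first exact: K1.
rewrite [LHS]E; apply: eq_I => eta.
by rewrite (IZ (g eta) (J2 eta)) E2 mulr1.
Qed.

Lemma L2_conv a g : 0 < a -> Int g -> L2 g ->
  L2 (conv a g) /\ I (fun xi => conv a g xi ^+ 2) <= I (fun xi => g xi ^+ 2).
Proof.
move=> a0 Ig Lg; have [mg Ig2] := Lg.
have [J1 J2] := I_conv a0 Ig2.
have Lc : L2 (conv a g).
  apply: L2_intro J1; first by apply: cont_meas; exact: cont_conv.
  by move=> xi; exact: conv_sqr.
split => //; rewrite -J2; apply: le_I => //; first exact: Lc.2.
by move=> xi; exact: conv_sqr.
Qed.

Definition an (n : nat) : R := n.+1%:R^-1.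
Lemma an_gt0 n : 0 < an n.
Proof. by rewrite invr_gt0 ltr0n. Qed.
Lemma an_cvg0 : an @ \oo --> (0 : R).
Proof. exact: cvg_harmonic. Qed.

Lemma gauss_an_cvg x : (fun n => gauss (an n) x) @ \oo --> (1 : R).
Proof.
have c : continuous (fun a => gauss a x).
  apply: (@isD_continuous _ _ (fun a => - (pi * x ^+ 2) * gauss a x)) => a.
  by rewrite /gauss; isD_tac; rewrite /=; ring.
have -> : (1 : R) = gauss 0 x by rewrite /gauss mulr0 mul0r oppr0 expR0.
exact: (continuous_cvg _ (c 0) an_cvg0).
Qed.

Lemma moment_Gk a xi : 0 < a ->
  Int (fun eta => (xi - eta) ^+ 2 * Gk a (xi - eta)) /\
  I (fun eta => (xi - eta) ^+ 2 * Gk a (xi - eta)) = a * I (fun y => `|y| ^+ 2 * gauss 1 y).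
Proof.
move=> a0; have s0 : 0 < Num.sqrt a by rewrite sqrtr_gt0.
have I0 : Int (fun y : R => `|y| ^+ 2 * gauss 1 y) by exact: Int_pow_gauss.
have i0 : (Num.sqrt a)^-1 != 0 by rewrite invr_eq0 gt_eqF.
have E eta : (xi - eta) ^+ 2 * Gk a (xi - eta) =
  Num.sqrt a * (`|(Num.sqrt a)^-1 * eta + - (xi / Num.sqrt a)| ^+ 2 *
    gauss 1 ((Num.sqrt a)^-1 * eta + - (xi / Num.sqrt a))).
  have -> : (Num.sqrt a)^-1 * eta + - (xi / Num.sqrt a) = - ((xi - eta) / Num.sqrt a).
    by field; rewrite gt_eqF.
  rewrite normrN gaussN real_normK ?num_real// /Gk.
  have -> : gauss 1 ((xi - eta) / Num.sqrt a) = gauss a^-1 (xi - eta).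
    rewrite /gauss mulr1 expr_div_n sqr_sqrtr ?ltW//.
    by rewrite -[in RHS]mulrA [a^-1 * _]mulrC.
  move: (gauss _ _) => G; by field; rewrite gt_eqF.
have J := IntZ (Num.sqrt a) (Int_affine (- (xi / Num.sqrt a)) i0 I0).
split; first by apply: eq_Int J => eta; rewrite E.
rewrite (eq_I E) IZ; last exact: (Int_affine (- (xi / Num.sqrt a)) i0 I0).
rewrite (I_affine _ i0 I0) normfV invrK gtr0_norm// mulrA.
by rewrite -expr2 sqr_sqrtr// ltW.
Qed.

(** Chebyshev's argument: within distance [d] of [xi] continuity is used, and beyond it
    [1 <= (xi - eta)^2 / d^2], whose mean under the kernel is [a * m2 / d^2] by [moment_Gk]. *)
Lemma conv_cvg g M xi : Int g -> continuous g -> (forall x, `|g x| <= M) ->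
  (fun n => conv (an n) g xi) @ \oo --> g xi.
Proof.
move=> Ig cg gM; have M0 : 0 <= M by exact: le_trans (gM 0).
set m2 := I (fun y : R => `|y| ^+ 2 * gauss 1 y).
have m20 : 0 <= m2 by apply: I_ge0 => y; rewrite mulr_ge0 ?gauss_ge0 ?exprn_ge0.
apply/cvgrPdist_le => e e0.
have /cvgrPdist_le/(_ (e / 2)) := cg xi; rewrite divr_gt0// => /(_ isT).
move=> /nbhs_ballP[d /= d0 Hd].
pose K := 2 * M / d ^+ 2 * m2 + 1.
have d20 : 0 < d ^+ 2 by rewrite exprn_gt0.
have K0 : 0 < K.
  rewrite /K ltr_wpDl//; apply: mulr_ge0 => //; apply: divr_ge0; last exact: ltW.
  exact: mulr_ge0.
have HK : 0 < e / 2 / K by rewrite !divr_gt0.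
have [N _ HN] := cvgr_lt _ an_cvg0 _ HK.
exists N => // n /HN /= Hn.
have a0 := an_gt0 n.
have [J1 J2] := moment_Gk xi a0.
have J3 := Int_Gk xi a0.
have J4 := Int_conv_in xi a0 Ig.
rewrite -[X in `|X - _|]mulr1 -(I_Gk xi a0) -(IZ _ J3) /conv -(IB (IntZ _ J3) J4).
apply: (@le_trans _ _ (I (fun eta => (e / 2) * Gk (an n) (xi - eta) +
   (2 * M / d ^+ 2) * ((xi - eta) ^+ 2 * Gk (an n) (xi - eta))))).
  apply: norm_I_le.
  - by apply: measB; [exact: Int_meas (IntZ _ J3)|exact: Int_meas J4].
  - by apply: IntD; exact: IntZ.
  - move=> eta; rewrite -mulrBl normrM (ger0_norm (Gk_ge0 _ _)) mulrA -mulrDl.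
    apply: ler_wpM2r; first exact: Gk_ge0.
    have [xe|xe] := ltP `|xi - eta| d.
      apply: (@le_trans _ _ (e / 2)); first exact: (Hd eta).
      rewrite lerDl; apply: mulr_ge0; last exact: sqr_ge0.
      by apply: divr_ge0; [exact: mulr_ge0|exact: ltW].
    apply: (@le_trans _ _ (2 * M)).
      by apply: le_trans (ler_normB _ _) _; have := gM xi; have := gM eta; lra.
    apply: (@le_trans _ _ (2 * M / d ^+ 2 * (xi - eta) ^+ 2)); last by rewrite lerDr; lra.
    rewrite mulrAC ler_pdivlMr// ler_wpM2l ?mulr_ge0//.
    by rewrite -(real_normK (num_real (_ - _))) lerXn2r ?nnegrE// ltW.
rewrite (ID (IntZ _ J3) (IntZ _ J1)) (IZ _ J3) (IZ _ J1) I_Gk// J2 -/m2 mulr1.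
have : an n * K <= e / 2 by rewrite -ler_pdivlMr// ltW.
rewrite /K; nra.
Qed.

Lemma abs3_le (p q r s e : R) : `|p - q| <= e / 2 -> `|r| <= e / 4 ->
  `|s| <= e / 4 -> `|p + r - (q + s)| <= e.
Proof.
rewrite !ler_norml => /andP[? ?] /andP[? ?] /andP[? ?].
by apply/andP; split; lra.
Qed.

(** For a bounded continuous [h0] this is dominated convergence. The error [h - h0] is small in L^2
    and stays so after convolution, a contraction of L^2, so Cauchy-Schwarz disposes of it uniformly
    in [n]. *)
Lemma conv_pair_cvg g h : Int g -> L2 g -> Int h -> L2 h ->
  (fun n => I (fun xi => g xi * conv (an n) h xi)) @ \oo --> I (fun xi => g xi * h xi).
Proof.
move=> Ig Lg Ih Lh.
pose A := I (fun xi => g xi ^+ 2).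
have A0 : 0 <= A by apply: I_ge0 => x; exact: sqr_ge0.
apply/cvgrPdist_le => e e0.
pose e1 := (e / 4) ^+ 2 / (A + 1).
have e10 : 0 < e1 by rewrite divr_gt0 ?exprn_gt0 ?divr_gt0//; lra.
have [h0 [ch0 [M h0M] Ih0 Lh0 Hh0]] := dense_continuous Lh e10.
have CSe k : L2 k -> I (fun x => k x ^+ 2) <= e1 -> `|I (fun xi => g xi * k xi)| <= e / 4.
  move=> Lk Hk; have e4 : 0 <= e / 4 by lra.
  rewrite -(ler_pXn2r (n := 2))// ?nnegrE//.
  rewrite real_normK ?num_real//; apply: le_trans (CS Lg Lk) _.
  apply: (@le_trans _ _ (A * e1)); first by rewrite ler_wpM2l.
  rewrite /e1 mulrCA ger_pMr ?exprn_gt0 ?divr_gt0// ler_pdivrMr; lra.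
have Lk := L2B Lh Lh0.
have Ik : Int (fun x => h x - h0 x) by exact: IntB.
have H1 : (fun n => I (fun xi => g xi * conv (an n) h0 xi)) @ \oo -->
    I (fun xi => g xi * h0 xi).
  apply: (@cvg_dominated R _ _ (fun xi => M * `|g xi|)).
  - move=> n; apply: measM; first exact: Int_meas.
    by apply: cont_meas; apply: cont_conv => //; exact: an_gt0.
  - by apply: measM; exact: Int_meas.
  - move=> xi; apply: cvgM; first exact: cvg_cst.
    exact: conv_cvg Ih0 ch0 h0M.
  - by apply: IntZ; exact: Int_norm.
  - move=> n xi; rewrite normrM mulrC; apply: ler_wpM2r => //.
    have a0 := an_gt0 n.
    rewrite -[M]mulr1 -(I_Gk xi a0) -(IZ M (Int_Gk xi a0)).
    apply: norm_I_le; first exact: Int_meas (Int_conv_in xi a0 Ih0).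
      by apply: IntZ; exact: Int_Gk.
    by move=> eta; rewrite normrM (ger0_norm (Gk_ge0 _ _)) ler_wpM2r ?Gk_ge0.
have e2 : 0 < e / 2 by lra.
move/cvgrPdist_le : H1 => /(_ _ e2)[N _ HN]; exists N => // n /HN /= Hn.
have a0 := an_gt0 n.
have [Lck Bck] := L2_conv a0 Ik Lk.
have [Lch0 _] := L2_conv a0 Ih0 Lh0.
have E1 : I (fun xi => g xi * h xi) = I (fun xi => g xi * h0 xi) +
    I (fun xi => g xi * (h xi - h0 xi)).
  by rewrite -ID; [apply: eq_I => x; ring|exact: L2M..].
have E2 : I (fun xi => g xi * conv (an n) h xi) = I (fun xi => g xi * conv (an n) h0 xi) +
    I (fun xi => g xi * conv (an n) (fun x => h x - h0 x) xi).
  rewrite -ID; [|exact: L2M..]; apply: eq_I => xi; rewrite -mulrDr; congr (_ * _).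
  rewrite /conv -ID; [|exact: Int_conv_in..].
  by apply: eq_I => eta; ring.
rewrite E1 E2.
have B1 := CSe _ Lk Hh0.
have B2 := CSe _ Lck (le_trans Bck Hh0).
exact: abs3_le Hn B1 B2.
Qed.

Lemma I_gauss_fatou f M : meas f -> (forall x, 0 <= f x) ->
  (forall n, Int (fun x => f x * gauss (an n) x)) ->
  (forall n, I (fun x => f x * gauss (an n) x) <= M) -> Int f /\ I f <= M.
Proof.
move=> mf f0 Ifn IM; apply: (fatou_I Ifn) => //.
- by move=> n x; rewrite mulr_ge0 ?gauss_ge0.
- move=> x; rewrite -[X in _ --> X]mulr1.
  by apply: cvgM; [exact: cvg_cst|exact: gauss_an_cvg].
Qed.

(** The integrals of [ht h ^ 2] against the Gaussians are bounded by [I (h^2)], by [ht_ht_gauss],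
    Cauchy-Schwarz and the contraction property of [conv]; Fatou's lemma removes the Gaussian. *)
Lemma L2_ht h : Int h -> L2 h -> L2 (ht h).
Proof.
move=> Ih Lh; split; first exact: meas_ht.
have [] := @I_gauss_fatou (fun x => ht h x ^+ 2) (I (fun x => h x ^+ 2)) => //.
- by apply: measX; exact: meas_ht.
- by move=> x; exact: sqr_ge0.
- move=> n; apply: (eq_Int (f := fun x => gauss (an n) x * ht h x ^+ 2)).
    by move=> x; rewrite mulrC.
  apply: (IntMb (M := (2 * I (fun xi => `|h xi|)) ^+ 2)).
  + by apply: measX; exact: meas_ht.
  + by move=> x; rewrite normrX lerXn2r ?nnegrE ?ht_bound// mulr_ge0// I_ge0.
  + by apply: Int_gauss; exact: an_gt0.
- move=> n; have a0 := an_gt0 n.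
  have := ht_ht_gauss a0 Ih Ih; under eq_fun do rewrite -expr2.
  move=> ->.
  have [Lc Bc] := L2_conv a0 Ih Lh.
  have := CS Lh Lc; set B := I _; set A := I _; set C := I _ => H.
  have A0 : 0 <= A by apply: I_ge0 => x; exact: sqr_ge0.
  have H2 : B ^+ 2 <= A ^+ 2 by apply: le_trans H _; rewrite expr2 ler_wpM2l.
  by apply: le_trans (ler_norm _) _; rewrite -(ler_pXn2r (n := 2))// ?nnegrE// real_normK ?num_real.
Qed.

Theorem parseval g h : Int g -> L2 g -> Int h -> L2 h ->
  I (fun x => ht g x * ht h x) = I (fun xi => g xi * h xi).
Proof.
move=> Ig Lg Ih Lh.
have H1 := conv_pair_cvg Ig Lg Ih Lh.
have Lfg := L2M (L2_ht Ig Lg) (L2_ht Ih Lh).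
have H2 : (fun n => I (fun x => ht g x * ht h x * gauss (an n) x)) @ \oo -->
    I (fun x => ht g x * ht h x).
  apply: (@cvg_dominated R _ _ (fun x => `|ht g x * ht h x|)).
  - by move=> n; apply: measM; [exact: Int_meas|exact: meas_gauss].
  - exact: Int_meas.
  - move=> x; rewrite -[X in _ --> X]mulr1.
    by apply: cvgM; [exact: cvg_cst|exact: gauss_an_cvg].
  - exact: Int_norm.
  - move=> n x; rewrite normrM gauss_norm -[leRHS]mulr1 ler_wpM2l//.
    by apply: gauss_le1; exact/ltW/an_gt0.
have E : (fun n => I (fun x => ht g x * ht h x * gauss (an n) x)) =
    (fun n => I (fun xi => g xi * conv (an n) h xi)).
  by apply/funext => n; rewrite ht_ht_gauss//; exact: an_gt0.
rewrite E in H2.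
exact: (cvg_unique _ H2 H1).
Qed.

Lemma parseval2 h : Int h -> L2 h -> I (fun x => ht h x ^+ 2) = I (fun xi => h xi ^+ 2).
Proof. by move=> Ih Lh; have := parseval Ih Lh Ih Lh; under eq_fun do rewrite -expr2. Qed.

Lemma ht_inj h : Int h -> L2 h -> (forall x, ht h x = 0) ->
  {ae mu, forall x, h x = 0}.
Proof.
move=> Ih Lh h0.
have := parseval2 Ih Lh.
rewrite (eq_I (g := fun=> 0)); last by move=> x; rewrite h0 expr0n.
rewrite I0 => /esym H.
have := I_eq0_ae Lh.2 (fun x => sqr_ge0 _) H.
by apply: aeS => x /eqP; rewrite sqrf_eq0 => /eqP.
Qed.

(** [h] need not be integrable, so injectivity of [ht] is applied to [h] times a Gaussian, and the
    positive factor is then divided out. *)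
Lemma L2_ae0 h : L2 h ->
  (forall x, I (fun xi => h xi * (gauss 1 xi * cas (2 * pi * xi * x))) = 0) ->
  {ae mu, forall x, h x = 0}.
Proof.
move=> Lh H; have lt01 := @ltr01 R.
have Lg : L2 (gauss 1 : R -> R).
  apply: (@L2_intro R _ (gauss 1)); [exact: meas_gauss| |exact: Int_gauss].
  move=> x; rewrite expr2 -[leRHS]mulr1 ler_wpM2l ?gauss_ge0//.
  exact: gauss_le1.
have Ihg : Int (fun xi => h xi * gauss 1 xi) by exact: L2M.
have Lhg : L2 (fun xi => h xi * gauss 1 xi).
  apply: (@L2Mb _ _ _ 1) => //; first exact: meas_gauss.
  by move=> x; rewrite gauss_norm; exact: gauss_le1.
have : {ae mu, forall x, h x * gauss 1 x = 0}.
  apply: ht_inj => // x; rewrite -[RHS](H x); apply: eq_I => xi.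
  by rewrite mulrA.
apply: aeS => x /eqP; rewrite mulf_eq0 => /orP[/eqP//|].
by rewrite gt_eqF// gauss_gt0.
Qed.

End hartley.

(** * Schwartz test functions *)

Section schwartz_functions.
Variable R : realType.
Notation mu := (@lebesgue_measure R).
Implicit Types (f g h : R -> R) (a x y xi b c e M : R).

Lemma Int_oneDsqrV : Int (fun x => (1 + x ^+ 2)^-1).
Proof.
have W0 x : 0 < 1 + x ^+ 2 by rewrite ltr_pwDl// sqr_ge0.
have c1 : continuous (fun x : R => 1 + x ^+ 2).
  by apply: contD; [exact: cont_cst|apply: contX; exact: cont_id].
have cW : continuous (fun x : R => (1 + x ^+ 2)^-1).
  by move=> x; apply: cvgV; [rewrite gt_eqF|exact: c1].
apply: ge0_Int; first exact: cont_meas.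
  by move=> x; rewrite invr_ge0 ltW.
rewrite ge0_symfun_integralT//.
- have := integral0y_oneDsqr R; rewrite set_itvcy.
  move=> ->; rewrite -EFinM; exact: ltry.
- by move=> x; rewrite invr_ge0 ltW.
- by move=> x /=; rewrite sqrrN.
Qed.

Section closed_class.
Variable C : (R -> R) -> Prop.
Hypothesis Cder : forall f, C f -> exists2 f', C f' & forall x : R, is_derive x 1 f (f' x).

(** A class of rapidly decreasing functions stable under differentiation consists of Schwartz
    functions; no formula for the higher derivatives is needed. *)
Lemma class_derive1n f n : C f -> C (f^`(n))%classic.
Proof.
move=> Cf; elim: n => [//|n IH]; have [f' Cf' H] := Cder IH.
by rewrite derive1nS (isD_derive1 H).
Qed.

Lemma class_smooth f : C f -> smooth f.
Proof.
move=> Cf n x; have [f' _ H] := Cder (class_derive1n n Cf).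
exact: (@ex_derive _ _ _ _ _ _ _ (H x)).
Qed.

Hypothesis Cdecay : forall f, C f -> forall m : nat, exists M, forall x, `|x| ^+ m * `|f x| <= M.

Lemma class_decay f : C f -> forall m n : nat, exists M : R, forall x : R,
  `|x| ^+ m * `|(f^`(n))%classic x| <= M.
Proof. by move=> Cf m n; exact/Cdecay/class_derive1n. Qed.

Definition class_schwartz f (Cf : C f) : schwartz R :=
  Schwartz (class_smooth Cf) (class_decay Cf).

End closed_class.

Lemma schwartz_continuous (psi : schwartz R) : continuous psi.
Proof.
move=> x; apply/differentiable_continuous/derivable1_diffP.
by have := @schwartz_smooth R psi 0 x; rewrite derive1n0.
Qed.

Lemma schwartz_Int (psi : schwartz R) : Int psi.
Proof.
have [M0 H0] := schwartz_decay psi 0 0; have [M2 H2] := schwartz_decay psi 2 0.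
apply: (@le_Int R _ (fun x => (M0 + M2) * (1 + x ^+ 2)^-1)).
- by apply: cont_meas; exact: schwartz_continuous.
- move=> x; have W0 : 0 < 1 + x ^+ 2 by rewrite ltr_pwDl// sqr_ge0.
  rewrite ler_pdivlMr// mulrDr mulr1; apply: lerD.
    by have := H0 x; rewrite expr0 mul1r.
  by have := H2 x; rewrite real_normK ?num_real// mulrC.
- by apply: IntZ; exact: Int_oneDsqrV.
Qed.

Lemma schwartz_meas (psi : schwartz R) : meas psi.
Proof. exact: Int_meas (schwartz_Int psi). Qed.

(** Polynomials times one shifted Gaussian times one frequency: stable under differentiation, and
    containing the test Gaussians, the packets and the probe at its focusing time. *)
Inductive gclass (b c d : R) : (R -> R) -> Prop :=
| gclass_cos k : gclass b c d (fun x => x ^+ k * (gauss 1 (x + c) * cos (b * x + d)))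
| gclass_sin k : gclass b c d (fun x => x ^+ k * (gauss 1 (x + c) * sin (b * x + d)))
| gclass_add f g : gclass b c d f -> gclass b c d g -> gclass b c d (fun x => f x + g x)
| gclass_scale z f : gclass b c d f -> gclass b c d (fun x => z * f x).

Lemma isD_gauss_shift c x : is_derive x 1 (fun x => gauss 1 (x + c))
  (- (2 * pi * (x + c)) * gauss 1 (x + c)).
Proof. by rewrite /gauss; isD_tac; rewrite /=; ring. Qed.

Lemma gclass_der b c d f : gclass b c d f ->
  exists2 f', gclass b c d f' & forall x : R, is_derive x 1 f (f' x).
Proof.
elim=> {f} [k|k|f g _ [f' Cf Hf] _ [g' Cg Hg]|z f _ [f' Cf Hf]].
- eexists.
    apply: (gclass_add (gclass_scale k%:R (gclass_cos b c d k.-1))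
      (gclass_add (gclass_scale (- (2 * pi)) (gclass_cos b c d k.+1))
      (gclass_add (gclass_scale (- (2 * pi * c)) (gclass_cos b c d k))
        (gclass_scale (- b) (gclass_sin b c d k))))).
  move=> x; have Hg := isD_gauss_shift c x.
  isD_tac; rewrite /= exprS; ring.
- eexists.
    apply: (gclass_add (gclass_scale k%:R (gclass_sin b c d k.-1))
      (gclass_add (gclass_scale (- (2 * pi)) (gclass_sin b c d k.+1))
      (gclass_add (gclass_scale (- (2 * pi * c)) (gclass_sin b c d k))
        (gclass_scale b (gclass_cos b c d k))))).
  move=> x; have Hg := isD_gauss_shift c x.
  isD_tac; rewrite /= exprS; ring.
- eexists; first exact: (gclass_add Cf Cg).
  by move=> x; apply: isD_add.
- eexists; first exact: (gclass_scale z Cf).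
  move=> x; have Hfx := Hf x; isD_tac; rewrite /=; ring.
Qed.

Lemma gauss_shift_decay c (n : nat) : exists M, forall x, `|x| ^+ n * gauss 1 (x + c) <= M.
Proof.
pose A := 1 + `|c|; have A1 : 1 <= A by rewrite /A lerDl.
exists ((2 * A) ^+ n * (1 + (1 + n`!%:R * (2 / (pi * 1)) ^+ n))) => x.
have A0 : 0 <= A by lra.
have hx : `|x| <= A * (1 + `|x + c|).
  have : `|x| <= `|x + c| + `|c|.
    by rewrite -{1}(addrK c x); apply: le_trans (ler_normB _ _) _.
  have := normr_ge0 (x + c); have := normr_ge0 c; rewrite /A; nra.
have h1 : `|x| ^+ n <= A ^+ n * (1 + `|x + c|) ^+ n.
  by rewrite -exprMn lerXn2r ?nnegrE ?mulr_ge0 ?addr_ge0.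
have h2 : (1 + `|x + c|) ^+ n <= 2 ^+ n * (1 + `|x + c| ^+ n).
  have [y1|y1] := leP `|x + c| 1.
    apply: (@le_trans _ _ (2 ^+ n * 1)).
      by rewrite mulr1 lerXn2r ?nnegrE ?addr_ge0//; lra.
    by rewrite ler_wpM2l ?exprn_ge0// lerDl exprn_ge0.
  apply: (@le_trans _ _ (2 ^+ n * `|x + c| ^+ n)).
    by rewrite -exprMn lerXn2r ?nnegrE ?addr_ge0// ?mulr_ge0//; lra.
  by rewrite ler_wpM2l ?exprn_ge0// lerDr.
have g0 := gauss_ge0 1 (x + c).
have g1 := gauss_le1 (x + c) ler01.
have h3 : `|x + c| ^+ n * gauss 1 (x + c) <= 1 + n`!%:R * (2 / (pi * 1)) ^+ n.
  apply: le_trans (gauss_pow_le n _ ltr01) _.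
  rewrite -[leRHS]mulr1; apply: ler_wpM2l; last by apply: gauss_le1; lra.
  by rewrite addr_ge0// mulr_ge0// exprn_ge0// divr_ge0// mulr_ge0// pi_ge0.
apply: (@le_trans _ _ (A ^+ n * (2 ^+ n * (1 + `|x + c| ^+ n)) * gauss 1 (x + c))).
  apply: ler_wpM2r => //; apply: le_trans h1 _.
  by rewrite ler_wpM2l// exprn_ge0.
rewrite exprMn -!mulrA mulrCA.
apply: ler_wpM2l; first by rewrite exprn_ge0.
apply: ler_wpM2l; first by rewrite exprn_ge0.
by rewrite mulrDl mul1r; apply: lerD.
Qed.

Lemma gclass_decay b c d f : gclass b c d f ->
  forall m : nat, exists M, forall x, `|x| ^+ m * `|f x| <= M.
Proof.
elim=> {f} [k|k|f g _ IHf _ IHg|z f _ IHf] m.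
- have [M HM] := gauss_shift_decay c (m + k); exists M => x.
  apply: le_trans (HM x); rewrite !normrM gauss_norm normrX (mulrA (`|x| ^+ m)) -exprD.
  rewrite ler_wpM2l ?exprn_ge0// -[leRHS]mulr1 ler_wpM2l ?gauss_ge0//.
  exact: norm_cos_le1.
- have [M HM] := gauss_shift_decay c (m + k); exists M => x.
  apply: le_trans (HM x); rewrite !normrM gauss_norm normrX (mulrA (`|x| ^+ m)) -exprD.
  rewrite ler_wpM2l ?exprn_ge0// -[leRHS]mulr1 ler_wpM2l ?gauss_ge0//.
  exact: norm_sin_le1.
- have [M HM] := IHf m; have [M' HM'] := IHg m; exists (M + M') => x.
  apply: le_trans (lerD (HM x) (HM' x)).
  by rewrite -mulrDr ler_wpM2l ?exprn_ge0// ler_normD.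
- have [M HM] := IHf m; exists (`|z| * M) => x.
  by rewrite normrM mulrCA ler_wpM2l.
Qed.

Definition gclass_schwartz b c d f (Cf : gclass b c d f) : schwartz R :=
  class_schwartz (@gclass_der b c d) (@gclass_decay b c d) Cf.

Lemma gauss_shift_gclass c : gclass 0 c 0 (fun x => gauss 1 (x + c)).
Proof.
have := gclass_cos 0 c 0 0.
by under eq_fun do rewrite expr0 mul1r mul0r addr0 cos0 mulr1.
Qed.

(** The indices [k] and [n] make the span of these functions stable under differentiation: each
    derivative of [expR (- (1 - x^2)^-1)] produces a factor [x] and two more powers of
    [(1 - x^2)^-1]. *)
Definition bump1 (k n : nat) x : R :=
  if `|x| < 1 then x ^+ k * ((1 - x ^+ 2) ^- n * expR (- (1 - x ^+ 2)^-1)) else 0.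

(** Treats the boundary points [1], [-1] and the exterior of the support of [bump1] at once, with no
    one-sided limits. *)
Lemma isD_quad f x C : f x = 0 -> (forall y, `|f y| <= C * (y - x) ^+ 2) ->
  is_derive x 1 f 0.
Proof.
move=> fx0 fC.
have C0 : 0 <= C by have := fC (x + 1); rewrite (_ : x + 1 - x = 1); [rewrite expr1n mulr1; exact: le_trans|ring].
apply/is_derive1_caratheodory.
exists (fun y => if y == x then 0 else f y / (y - x)); split => [y||].
- case: eqP => [->|/eqP yx]; first by rewrite fx0 subrr mul0r.
  by rewrite fx0 subr0 divfK// subr_eq0.
- apply/cvgrPdist_le => /= e e0; rewrite eqxx.
  exists (e / (C + 1)) => /=; first by rewrite divr_gt0//; lra.
  move=> y /= xy; case: eqP => [_|/eqP yx]; first by rewrite subrr normr0 ltW.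
  have d0 : 0 < `|y - x| by rewrite normr_gt0 subr_eq0.
  rewrite sub0r normrN normf_div ler_pdivrMr//.
  apply: le_trans (fC y) _; rewrite -(real_normK (num_real (y - x))) expr2 mulrA.
  apply: ler_wpM2r => //; rewrite distrC ltr_pdivlMr in xy; last by lra.
  by nra.
- by rewrite eqxx.
Qed.

(** With [D = 1 - y^2], the exponential beats [n + 2] powers of [D^-1] and leaves a factor [D^2],
    and [D <= 2 |y - x|] because [|x| >= 1]. *)
Lemma bump1_quad k n : forall x y, 1 <= `|x| ->
  `|bump1 k n y| <= 4 * (n.+2)`!%:R * (y - x) ^+ 2.
Proof.
move=> x y x1; rewrite /bump1; case: ifP => [y1|_]; last first.
  by rewrite normr0 mulr_ge0 ?sqr_ge0// mulr_ge0.
set D := 1 - y ^+ 2.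
have yy : y ^+ 2 = `|y| ^+ 2 by rewrite real_normK ?num_real.
have D0 : 0 < D by rewrite /D yy; have := normr_ge0 y; nra.
have DD : D <= 2 * `|y - x|.
  have h := ler_normD y (x - y); rewrite addrC subrK (distrC x) in h.
  by rewrite /D yy; have := normr_ge0 y; nra.
have H : D ^- n * expR (- D^-1) <= (n.+2)`!%:R * D ^+ 2.
  have Di : 0 <= D^-1 by rewrite invr_ge0 ltW.
  have := expR_powN n.+2 Di; rewrite -(ler_pM2r (exprn_gt0 2 D0)) mulrAC.
  have -> : D^-1 ^+ n.+2 * D ^+ 2 = D ^- n; last by [].
  rewrite -(addn2 n) exprD -mulrA -[X in _ * X](exprMn 2 D^-1 D) mulVf ?gt_eqF//.
  by rewrite expr1n mulr1 exprVn.
have E0 : 0 <= D ^- n * expR (- D^-1).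
  by apply: mulr_ge0; [rewrite invr_ge0 exprn_ge0// ltW|exact: expR_ge0].
rewrite normrM normrX (ger0_norm E0).
apply: (@le_trans _ _ (1 * ((n.+2)`!%:R * D ^+ 2))).
  by apply: ler_pM => //; rewrite ?exprn_ge0 ?exprn_ile1 ?(ltW y1).
rewrite mul1r (_ : 4 * _ * _ = (n.+2)`!%:R * (4 * (y - x) ^+ 2)); last by ring.
apply: ler_wpM2l => //.
rewrite -(real_normK (num_real (y - x))).
have := normr_ge0 (y - x); nra.
Qed.

Lemma bump1_bound k n y : `|bump1 k n y| <= 16 * (n.+2)`!%:R.
Proof.
have f0 : (0 : R) <= (n.+2)`!%:R by [].
have [y1|y1] := ltP `|y| 1; last by rewrite /bump1 ltNge y1/= normr0 mulr_ge0.
have h : (1 : R) <= `|1| by rewrite normr1.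
apply: le_trans (bump1_quad k n y h) _.
rewrite mulrAC [leRHS](_ : _ = 4 * 4 * (n.+2)`!%:R); last by ring.
rewrite ler_wpM2r// ler_wpM2l//.
by move: y1; rewrite ltr_norml => /andP[? ?]; nra.
Qed.

Lemma bump1_der k n x : is_derive x 1 (bump1 k n)
  (k%:R * bump1 k.-1 n x + (2 * n%:R * bump1 k.+1 n.+1 x + -2 * bump1 k.+1 n.+2 x)).
Proof.
have [x1|x1] := ltP `|x| 1; last first.
  rewrite /bump1 ltNge x1/= !mulr0 !addr0.
  apply: (@isD_quad _ _ (4 * (n.+2)`!%:R)) => [|y]; first by rewrite /bump1 ltNge x1.
  exact: bump1_quad.
have D0 : 0 < 1 - x ^+ 2.
  by rewrite -(real_normK (num_real x)); have := normr_ge0 x; nra.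
have Dn : 1 - x ^+ 2 != 0 by rewrite gt_eqF.
rewrite /bump1 x1.
apply: (@near_eq_is_derive _ _ _ (fun x : R => x ^+ k * ((1 - x ^+ 2)^-1 ^+ n * expR (- (1 - x ^+ 2)^-1)))).
  exists (1 - `|x|) => /=; first by lra.
  move=> y /= xy; rewrite ifT ?exprVn//.
  have := ler_normB x (x - y); rewrite opprB addrC subrK; lra.
have hD : is_derive x 1 (fun x : R => 1 - x ^+ 2) (- (2 * x)).
  by isD_tac; rewrite /=; ring.
have hV := @isD_inv R (fun x : R => 1 - x ^+ 2) x _ Dn hD.
isD_tac; rewrite /=.
rewrite (exprS x k) -!exprVn; clear hD hV D0 Dn.
set V := (1 - x ^+ 2)^-1; set E := expR (- V); clearbody E; clearbody V.
move: (x ^+ k) (x ^+ k.-1) => X Y.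
case: n => [|n] /=; first by ring.
by rewrite !(exprS V n.+2) !(exprS V n.+1) !(exprS V n); ring.
Qed.

Inductive bclass (x0 r : R) : (R -> R) -> Prop :=
| bclass_bump k n : bclass x0 r (fun x => bump1 k n (r^-1 * x + - (x0 / r)))
| bclass_add f g : bclass x0 r f -> bclass x0 r g -> bclass x0 r (fun x => f x + g x)
| bclass_scale z f : bclass x0 r f -> bclass x0 r (fun x => z * f x).

Lemma bclass_der x0 r f : bclass x0 r f ->
  exists2 f', bclass x0 r f' & forall x : R, is_derive x 1 f (f' x).
Proof.
elim=> {f} [k n|f g _ [f' Cf Hf] _ [g' Cg Hg]|z f _ [f' Cf Hf]].
- eexists.
    apply: (bclass_scale r^-1 (bclass_add (bclass_scale k%:R (bclass_bump x0 r k.-1 n))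
      (bclass_add (bclass_scale (2 * n%:R) (bclass_bump x0 r k.+1 n.+1))
        (bclass_scale (-2) (bclass_bump x0 r k.+1 n.+2))))).
  move=> x; have hl : is_derive x 1 (fun x : R => r^-1 * x + - (x0 / r)) r^-1.
    by isD_tac; rewrite /=; ring.
  apply: isD_eq (isD_comp (bump1_der k n _) hl) _; rewrite /=; ring.
- eexists; first exact: (bclass_add Cf Cg).
  by move=> x; apply: isD_add.
- eexists; first exact: (bclass_scale z Cf).
  move=> x; have Hfx := Hf x; isD_tac; rewrite /=; ring.
Qed.

Lemma bclass_supp (x0 r : R) f : 0 < r -> bclass x0 r f ->
  forall x, r <= `|x - x0| -> f x = 0.
Proof.
move=> r0; elim=> {f} [k n|f g _ IHf _ IHg|z f _ IHf] x xr.
- rewrite /bump1 ltNge (_ : r^-1 * x + - (x0 / r) = (x - x0) / r); last by field; rewrite gt_eqF.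
  by rewrite normf_div (gtr0_norm r0) ler_pdivlMr// mul1r xr.
- by rewrite IHf// IHg// addr0.
- by rewrite IHf// mulr0.
Qed.

Lemma bclass_bounded x0 r f : bclass x0 r f -> exists M, forall x, `|f x| <= M.
Proof.
elim=> {f} [k n|f g _ [M HM] _ [M' HM']|z f _ [M HM]].
- by exists (16 * (n.+2)`!%:R) => x; exact: bump1_bound.
- by exists (M + M') => x; apply: le_trans (ler_normD _ _) _; exact: lerD.
- by exists (`|z| * M) => x; rewrite normrM ler_wpM2l.
Qed.

Lemma bclass_decay (x0 r : R) f : 0 < r -> bclass x0 r f ->
  forall m : nat, exists M, forall x, `|x| ^+ m * `|f x| <= M.
Proof.
move=> r0 Cf m; have [M HM] := bclass_bounded Cf.
have M0 : 0 <= M by exact: le_trans (HM 0).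
exists ((`|x0| + r) ^+ m * M) => x.
have [xr|xr] := leP r `|x - x0|.
  by rewrite (bclass_supp r0 Cf)// normr0 mulr0 mulr_ge0// exprn_ge0// addr_ge0// ltW.
apply: ler_pM => //.
rewrite lerXn2r ?nnegrE ?addr_ge0 ?(ltW r0)//.
rewrite -{1}(subrK x0 x); apply: le_trans (ler_normD _ _) _; lra.
Qed.

Definition bclass_schwartz (x0 r : R) (r0 : 0 < r) f (Cf : bclass x0 r f) : schwartz R :=
  class_schwartz (@bclass_der x0 r) (fun f => @bclass_decay x0 r f r0) Cf.

Lemma bump_schwartz (x0 r : R) : 0 < r -> exists psi : schwartz R,
  [/\ forall x, 0 <= psi x, forall x, r <= `|x - x0| -> psi x = 0 &
      forall x, `|x - x0| <= r / 2 -> expR (-2) <= psi x].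
Proof.
move=> r0; exists (bclass_schwartz r0 (bclass_bump x0 r 0 0)); split.
- move=> x /=; rewrite /bump1; case: ifP => // _.
  by rewrite !expr0 invr1 !mul1r expR_ge0.
- by move=> x xr /=; apply: (bclass_supp r0 (bclass_bump x0 r 0 0)).
- move=> x xr /=; have yE : r^-1 * x + - (x0 / r) = (x - x0) / r by field; rewrite gt_eqF.
  rewrite yE /bump1.
  have y2 : `|(x - x0) / r| <= 1 / 2.
    by rewrite normf_div (gtr0_norm r0) ler_pdivrMr//; lra.
  rewrite ifT; last by lra.
  rewrite !expr0 invr1 !mul1r ler_expR lerN2.
  (* On the ball of half radius this quantity is at least 3/4, so its inverse is below 2. *)
  have : 1 / 2 <= 1 - ((x - x0) / r) ^+ 2.
    by rewrite -(real_normK (num_real (_ / r))); have := normr_ge0 ((x - x0) / r); nra.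
  by move=> h; rewrite -[leRHS]invrK lef_pV2 ?posrE//; lra.
Qed.

Lemma I_itv_ge (a b : R) : a <= b -> Int (\1_(`[a, b]%classic : set R)) /\
  I (\1_(`[a, b]%classic : set R)) = b - a.
Proof.
move=> ab; split; first exact: (@integrable_indic_itv R a b true false).
rewrite /I /Rintegral integral_indic// setIT.
have := lebesgue_measure_itv `[a, b]; rewrite /= lte_fin => ->.
move: ab; rewrite le_eqVlt => /orP[/eqP ->|ab]; first by rewrite ltxx subrr.
by rewrite ab -EFinD.
Qed.

Lemma Int_cont_bump f (psi : schwartz R) (x0 r : R) : continuous f -> 0 < r ->
  (forall x, r <= `|x - x0| -> psi x = 0) -> Int (fun x => f x * psi x).
Proof.
move=> cf r0 Hpsi.
have le0 : x0 - r <= x0 + r by lra.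
have cg : continuous (fun x => `|f x * psi x|).
  by apply: cont_norm; apply: contM => //; exact: schwartz_continuous.
have [c _ Hc] := EVT_max le0 (continuous_subspaceT cg).
have [I1 _] := I_itv_ge le0.
apply: (@le_Int R _ (fun x => `|f c * psi c| * \1_(`[x0 - r, x0 + r]%classic) x)).
- by apply: cont_meas; apply: contM => //; exact: schwartz_continuous.
- move=> x; rewrite indicE; case: (boolP (x \in _)) => [|].
    by rewrite mulr1 inE /= => xI; exact: (Hc x xI).
  rewrite notin_setE/= in_itv/= => /negP xI; rewrite Hpsi ?mulr0 ?normr0//.
  rewrite leNgt; apply/negP; rewrite ltr_norml => /andP[? ?].
    by move/negP: xI; apply; apply/andP; split; lra.
- exact: IntZ.
Qed.

(** If [g x0 < f x0], the difference stays above half its value on a ball, and a nonnegative bump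
    supported there detects it. Compact support also provides integrability, since [f] and [g] are
    arbitrary at infinity. *)
Lemma cont_eq_of_tests f g : continuous f -> continuous g ->
  (forall psi : schwartz R, I (fun x => f x * psi x) = I (fun x => g x * psi x)) ->
  forall x, f x = g x.
Proof.
wlog suff: f g / continuous f -> continuous g ->
  (forall psi : schwartz R, I (fun x => f x * psi x) = I (fun x => g x * psi x)) ->
  forall x, f x <= g x.
  move=> H cf cg E x; apply/eqP; rewrite eq_le; apply/andP; split; first exact: H.
  by apply: H => // psi; rewrite E.
move=> cf cg E x0; rewrite leNgt; apply/negP => gf.
pose k x := f x - g x; have ck : continuous k by apply: contD => //; exact: contN.
have k0 : 0 < k x0 by rewrite /k subr_gt0.
have /cvgrPdist_le/(_ (k x0 / 2)) := ck x0; rewrite divr_gt0// => /(_ isT).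
move=> /nbhs_ballP[r /= r0 Hr].
have [psi [p0 p1 p2]] := bump_schwartz x0 r0.
have If := Int_cont_bump cf r0 p1; have Ig := Int_cont_bump cg r0 p1.
have H0 : I (fun x => k x * psi x) = 0.
  rewrite (eq_I (g := fun x => f x * psi x - g x * psi x)); last by move=> x; rewrite -mulrBl.
  by rewrite IB// E subrr.
have le1 : x0 - r / 2 <= x0 + r / 2 by lra.
have [I1 I1E] := I_itv_ge le1.
have : I (fun x => k x0 / 2 * expR (-2) * \1_(`[x0 - r / 2, x0 + r / 2]%classic) x) <= 0.
  rewrite -H0; apply: le_I; first exact: IntZ.
    by apply: eq_Int (IntB If Ig) => x; rewrite -mulrBl.
  move=> x.
  have kx : `|x - x0| < r -> k x0 / 2 <= k x.
    move=> xr; have := Hr x; rewrite /ball/= distrC => /(_ xr).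
    by rewrite ler_norml => /andP[? ?]; lra.
  rewrite indicE; case: (boolP (x \in _)) => [|_]; last first.
    rewrite mulr0; have [xr|xr] := leP r `|x - x0|; first by rewrite p1// mulr0.
    by apply: mulr_ge0 => //; have := kx xr; lra.
  rewrite inE/= in_itv/= mulr1 => /andP[? ?].
  have xr : `|x - x0| <= r / 2 by rewrite ler_norml; apply/andP; split; lra.
  apply: ler_pM; [by lra|exact: expR_ge0| |exact: p2].
  by apply: kx; lra.
rewrite IZ// I1E; have e2 := expR_gt0 (-2 : R).
apply/negP; rewrite -ltNge; apply: mulr_gt0; last by lra.
by apply: mulr_gt0 => //; lra.
Qed.

Lemma ht_of_tests f h : continuous f -> Int h ->
  (forall psi : schwartz R, I (fun x => f x * psi x) = I (fun xi => h xi * ht psi xi)) ->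
  forall x, f x = ht h x.
Proof.
move=> cf Ih H; apply: cont_eq_of_tests => //; first exact: cont_ht.
move=> psi; rewrite H -ht_swap//; last exact: schwartz_Int.
by apply: eq_I => x; rewrite mulrC.
Qed.

Lemma ht_gauss_shift c xi : ht (fun y => gauss 1 (y + c)) xi = gauss 1 xi * cas (2 * pi * xi * - c).
Proof.
have lt01 := @ltr01 R.
rewrite /ht.
have Ig : Int (fun y : R => gauss 1 (y + c)) by apply: Int_shift; exact: Int_gauss.
rewrite -(I_shift (- c) (Int_cas xi Ig)).
have I1 : Int (fun y => gauss 1 y * cos (2 * pi * xi * y)).
  by apply: eq_Int (Int_gauss_cos (2 * pi * xi) 0 lt01) => y; rewrite addr0.
have I2 : Int (fun y => gauss 1 y * sin (2 * pi * xi * y)).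
  by apply: eq_Int (Int_gauss_sin (2 * pi * xi) 0 lt01) => y; rewrite addr0.
set B := 2 * pi * xi * - c.
rewrite (eq_I (g := fun y => cas B * (gauss 1 y * cos (2 * pi * xi * y)) +
    (cos B - sin B) * (gauss 1 y * sin (2 * pi * xi * y)))); last first.
  move=> y; rewrite subrK (_ : 2 * pi * (y - c) * xi = 2 * pi * xi * y + B); last by rewrite /B; ring.
  by rewrite /cas cosD sinD; ring.
rewrite (ID (IntZ _ I1) (IntZ _ I2)) (IZ _ I1) (IZ _ I2) fourier_gauss1.
by rewrite fourier_gauss_sin// mulr0 addr0 mulrC.
Qed.

(** Translated Gaussians suffice: their Hartley transforms are the functions
    [gauss 1 xi * cas (2 pi xi x)] of [L2_ae0]. *)
Lemma repr_unique h : L2 h ->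
  (forall psi : schwartz R, I (fun xi => h xi * ht psi xi) = 0) ->
  {ae mu, forall xi, h xi = 0}.
Proof.
move=> Lh H; apply: L2_ae0 => // x.
rewrite -[RHS](H (gclass_schwartz (gauss_shift_gclass (- x)))).
by apply: eq_I => xi; rewrite /= ht_gauss_shift opprK.
Qed.

End schwartz_functions.

(** * Sobolev norms on the Hartley side *)

Section sobolev_representation.
Local Open Scope complex_scope.
Variable R : realType.
Notation mu := (@lebesgue_measure R).
Implicit Types (f g h : R -> R) (a x y xi b c e M s : R).

Lemma meas_inv f : meas f -> meas (fun x => (f x)^-1).
Proof.
(* Only a real power of a nonnegative function remains; at zeros of [f] both sides are 0, as
   [0^-1 = 0]. *)
move=> mf; rewrite (_ : (fun x => (f x)^-1) = (fun x => f x * (f x ^+ 2) `^ (-1))).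
  apply: measM => //; apply: (@measurableT_comp _ _ _ _ _ _ (fun z : R => z `^ (-1))).
    exact: measurable_powR.
  exact: measX.
apply/funext => x; rewrite powR_inv1 ?sqr_ge0//.
have [->|fx] := eqVneq (f x) 0; first by rewrite invr0 mul0r.
by field.
Qed.

Lemma meas_opp f : meas f -> meas (fun x => f (- x)).
Proof. by move=> mf; apply: (meas_comp mf); apply: measN; exact: meas_id. Qed.

Definition W xi : R := 1 + xi ^+ 2.
Lemma W_ge1 xi : 1 <= W xi. Proof. by rewrite /W lerDl sqr_ge0. Qed.
Lemma W_gt0 xi : 0 < W xi. Proof. exact: lt_le_trans (W_ge1 xi). Qed.
Lemma WN xi : W (- xi) = W xi. Proof. by rewrite /W sqrrN. Qed.
Lemma W_norm xi : `|xi| <= W xi.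
Proof. by rewrite /W -(real_normK (num_real xi)); have := sqr_ge0 (`|xi| - 1); nra. Qed.
Lemma meas_W : meas W.
Proof. by apply: measD; [exact: meas_cst|apply: measX; exact: meas_id]. Qed.
(** The square of the Sobolev weight [<xi>^s], since [W] is [<xi>^2]; it is the density of squared
    norms. *)
Definition wt s xi : R := W xi `^ s.
Lemma wt_ge0 s xi : 0 <= wt s xi. Proof. exact: powR_ge0. Qed.
Lemma wt_gt0 s xi : 0 < wt s xi. Proof. by apply: powR_gt0; exact: W_gt0. Qed.
Lemma meas_wt s : meas (wt s).
Proof.
apply: (@measurableT_comp _ _ _ _ _ _ (fun z : R => z `^ s)).
  exact: measurable_powR.
exact: meas_W.
Qed.
Lemma wtN s xi : wt s (- xi) = wt s xi. Proof. by rewrite /wt WN. Qed.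
Lemma wt_half s xi : wt (s / 2) xi ^+ 2 = wt s xi.
Proof.
rewrite /wt -powR_mulrn ?powR_ge0// -powRrM; congr (_ `^ _).
by field.
Qed.
Lemma wt_nat (n : nat) xi : wt n%:R xi = W xi ^+ n.
Proof. by rewrite /wt powR_mulrn// ltW// W_gt0. Qed.
Lemma wnorm_sq s (g : R -> R[i]) xi :
  ((1 + xi ^+ 2) `^ (s / 2) * Normc.normc (g xi)) ^+ 2 =
  wt s xi * (complex.Re (g xi) ^+ 2 + complex.Im (g xi) ^+ 2).
Proof.
rewrite exprMn -/(W xi) -/(wt (s / 2) xi) wt_half; congr (_ * _).
by case: (g xi) => p q /=; rewrite sqr_sqrtr// addr_ge0 ?sqr_ge0.
Qed.

Lemma normc_ge0 (z : R[i]) : 0 <= Normc.normc z.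
Proof. by case: z => p q /=; exact: sqrtr_ge0. Qed.

Lemma weighted_normE s (g : R -> R[i]) :
  meas (fun xi => complex.Re (g xi)) -> meas (fun xi => complex.Im (g xi)) ->
  (weighted_norm s g `^ 2 =
   \int[mu]_xi (wt s xi * (complex.Re (g xi) ^+ 2 + complex.Im (g xi) ^+ 2))%:E)%E.
Proof.
move=> mp mq; rewrite /weighted_norm poweR_Lnorm//.
apply: eq_integral => xi _; rewrite -wnorm_sq.
rewrite gee0_abs ?lee_fin ?mulr_ge0 ?powR_ge0 ?normc_ge0// poweR_EFin.
by rewrite powR_mulrn// mulr_ge0 ?powR_ge0 ?normc_ge0.
Qed.

Lemma weighted_norm_lt s (g : R -> R[i]) M :
  meas (fun xi => complex.Re (g xi)) -> meas (fun xi => complex.Im (g xi)) ->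
  (weighted_norm s g < M%:E)%E ->
  Int (fun xi => wt s xi * (complex.Re (g xi) ^+ 2 + complex.Im (g xi) ^+ 2)) /\
  I (fun xi => wt s xi * (complex.Re (g xi) ^+ 2 + complex.Im (g xi) ^+ 2)) <= M ^+ 2.
Proof.
move=> mp mq H; have H2 := weighted_normE s mp mq.
have n0 : (0 <= weighted_norm s g)%E by exact: Lnorm_ge0.
set K := fun xi => wt s xi * _ in H2 *.
have mK : meas K.
  by apply: measM; [exact: meas_wt|apply: measD; exact: measX].
have K0 xi : 0 <= K xi by rewrite mulr_ge0 ?wt_ge0// addr_ge0 ?sqr_ge0.
move: H H2 n0; case: (weighted_norm s g) => [r||]; [|by rewrite ltNge leey|by []].
rewrite lte_fin lee_fin poweR_EFin => rM E r0.
rewrite powR_mulrn// in E.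
have IK : Int K by apply: ge0_Int => //; rewrite /K -E ltry.
split=> //; rewrite -lee_fin (EFin_I IK) /K -E lee_fin.
by rewrite lerXn2r ?nnegrE ?(ltW rM)// (le_trans r0)// ltW.
Qed.

Lemma weighted_norm_eq s (g : R -> R[i]) :
  Int (fun xi => wt s xi * (complex.Re (g xi) ^+ 2 + complex.Im (g xi) ^+ 2)) ->
  weighted_norm s g =
  (Num.sqrt (I (fun xi => wt s xi * (complex.Re (g xi) ^+ 2 + complex.Im (g xi) ^+ 2))))%:E.
Proof.
move=> IK; rewrite /weighted_norm unlock /=.
set J := (\int[mu]_x _)%E.
have -> : J = (I (fun xi => wt s xi * (complex.Re (g xi) ^+ 2 + complex.Im (g xi) ^+ 2)))%:E.
  rewrite (EFin_I IK); apply: eq_integral => xi _; rewrite -wnorm_sq.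
  have n0 : 0 <= (1 + xi ^+ 2) `^ (s / 2) * Normc.normc (g xi).
    by rewrite mulr_ge0 ?powR_ge0 ?normc_ge0.
  by rewrite /= (ger0_norm n0) powR_mulrn.
rewrite poweR12_sqrt//= lee_fin.
by apply: I_ge0 => xi; rewrite mulr_ge0 ?wt_ge0// addr_ge0 ?sqr_ge0.
Qed.

Definition fcos f xi := I (fun x => f x * cos (2 * pi * x * xi)).
Definition fsin f xi := I (fun x => f x * sin (2 * pi * x * xi)).

Lemma inverse_fourierE f xi : inverse_fourier f xi = fcos f xi +i* fsin f xi.
Proof.
rewrite /inverse_fourier /cintegral /fcos /fsin; congr (_ +i* _); apply: eq_I => x /=.
  by rewrite mul0r subr0.
by rewrite mul0r addr0.
Qed.

Lemma meas_cos_r c : meas (fun x => cos (2 * pi * x * c)).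
Proof.
rewrite (_ : (fun x => _) = (fun x => cos (2 * pi * c * x + 0))); first exact: meas_cos_lin.
by apply/funext => x; rewrite addr0 mulrAC.
Qed.
Lemma meas_sin_r c : meas (fun x => sin (2 * pi * x * c)).
Proof.
rewrite (_ : (fun x => _) = (fun x => sin (2 * pi * c * x + 0))); first exact: meas_sin_lin.
by apply/funext => x; rewrite addr0 mulrAC.
Qed.
Lemma Int_cos_r f c : Int f -> Int (fun x => f x * cos (2 * pi * x * c)).
Proof. by apply: IntMb; [exact: meas_cos_r|move=> ?; exact: norm_cos_le1]. Qed.
Lemma Int_sin_r f c : Int f -> Int (fun x => f x * sin (2 * pi * x * c)).
Proof. by apply: IntMb; [exact: meas_sin_r|move=> ?; exact: norm_sin_le1]. Qed.

Lemma ht_fcos_fsin f xi : Int f -> ht f xi = fcos f xi + fsin f xi.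
Proof.
move=> If; rewrite /ht /fcos /fsin -ID; [|exact: Int_cos_r|exact: Int_sin_r].
by apply: eq_I => x; rewrite -mulrDr.
Qed.
Lemma fcosN f xi : fcos f (- xi) = fcos f xi.
Proof. by apply: eq_I => x; rewrite mulrN cosN. Qed.
Lemma fsinN f xi : Int f -> fsin f (- xi) = - fsin f xi.
Proof.
move=> If; rewrite /fsin -I_N; last exact: Int_sin_r.
by apply: eq_I => x; rewrite mulrN sinN mulrN.
Qed.
Lemma fcosE f xi : Int f -> fcos f xi = (ht f xi + ht f (- xi)) / 2.
Proof. by move=> If; rewrite !ht_fcos_fsin// fcosN fsinN//; field. Qed.
Lemma fsinE f xi : Int f -> fsin f xi = (ht f xi - ht f (- xi)) / 2.
Proof. by move=> If; rewrite !ht_fcos_fsin// fcosN fsinN//; field. Qed.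

Lemma schwartz_L2 (psi : schwartz R) : L2 psi.
Proof.
split; first exact: schwartz_meas.
have [M0 H0] := schwartz_decay psi 0 0.
have Hb x : `|psi x| <= M0 by have := H0 x; rewrite expr0 mul1r.
by apply: eq_Int (IntMb (schwartz_meas psi) Hb (schwartz_Int psi)) => x; rewrite expr2.
Qed.
Lemma ht_schwartz_L2 (psi : schwartz R) : L2 (ht psi).
Proof. by apply: L2_ht; [exact: schwartz_Int|exact: schwartz_L2]. Qed.

(* The Hartley transform attached to a Fourier transform [p + i q]; the real and even parts are recovered without assuming Hermitian symmetry. *)
Definition fold_hartley (p q : R -> R) xi := ((p xi - q xi) + (p (- xi) + q (- xi))) / 2.

(** The square of a mean is at most the mean of the squares. The weight is even, so the reflected
    half can be folded back, and the cross terms of [(p - q)^2] and [(p + q)^2] cancel. *)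
Lemma fold_hartley_wt s p q : meas p -> meas q ->
  Int (fun xi => wt s xi * (p xi ^+ 2 + q xi ^+ 2)) ->
  [/\ meas (fold_hartley p q), Int (fun xi => wt s xi * fold_hartley p q xi ^+ 2) &
    I (fun xi => wt s xi * fold_hartley p q xi ^+ 2) <=
    I (fun xi => wt s xi * (p xi ^+ 2 + q xi ^+ 2))].
Proof.
move=> mp mq IK.
have mh : meas (fold_hartley p q).
  apply: measM; last exact: meas_cst.
  apply: measD; first exact: measB.
  by apply: measD; exact: meas_opp.
have w0 := wt_ge0 s.
have I1 : Int (fun xi => wt s xi * (p xi - q xi) ^+ 2).
  apply: (@le_Int R _ (fun xi => 2 * (wt s xi * (p xi ^+ 2 + q xi ^+ 2)))).
  - by apply: measM; [exact: meas_wt|apply: measX; exact: measB].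
  - move=> xi; rewrite ger0_norm; last by apply: mulr_ge0 => //; exact: sqr_ge0.
    rewrite [leRHS]mulrCA; apply: ler_wpM2l => //.
    by have := sqr_ge0 (p xi + q xi); nra.
  - exact: IntZ.
have I2 : Int (fun xi => wt s xi * (p xi + q xi) ^+ 2).
  apply: (@le_Int R _ (fun xi => 2 * (wt s xi * (p xi ^+ 2 + q xi ^+ 2)))).
  - by apply: measM; [exact: meas_wt|apply: measX; exact: measD].
  - move=> xi; rewrite ger0_norm; last by apply: mulr_ge0 => //; exact: sqr_ge0.
    rewrite [leRHS]mulrCA; apply: ler_wpM2l => //.
    by have := sqr_ge0 (p xi - q xi); nra.
  - exact: IntZ.
have J := IntD (IntZ 2^-1 I1) (IntZ 2^-1 (Int_opp I2)).
have le xi : wt s xi * fold_hartley p q xi ^+ 2 <= 2^-1 * (wt s xi * (p xi - q xi) ^+ 2) +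
    2^-1 * (wt s (- xi) * (p (- xi) + q (- xi)) ^+ 2).
  rewrite wtN /fold_hartley; set X := p xi - q xi; set Y := p (- xi) + q (- xi).
  rewrite !(mulrCA 2^-1) -mulrDr ler_wpM2l//.
  by have := sqr_ge0 (X - Y); nra.
have Ih : Int (fun xi => wt s xi * fold_hartley p q xi ^+ 2).
  apply: (le_Int _ _ J); first by apply: measM; [exact: meas_wt|exact: measX].
  by move=> xi; rewrite ger0_norm; [exact: le|apply: mulr_ge0 => //; exact: sqr_ge0].
split => //.
apply: le_trans (le_I Ih J le) _.
rewrite (ID (IntZ _ I1) (IntZ _ (Int_opp I2))) (IZ _ I1) (IZ _ (Int_opp I2)) (I_opp I2).
rewrite -mulrDr -ID// -(IZ _ (IntD I1 I2)) le_eqVlt; apply/orP; left; apply/eqP/eq_I => xi.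
by field.
Qed.

Lemma L2_of_wt s p : 0 <= s -> meas p -> Int (fun xi => wt s xi * p xi ^+ 2) -> L2 p.
Proof.
move=> s0 mp Ip; apply: (L2_intro mp _ Ip) => xi.
by rewrite ler_peMl ?sqr_ge0// /wt -(powRr0 (W xi)) ler_powR// W_ge1.
Qed.

(** Only the real part [p fcos - q fsin] of the defining identity is used. [fcos] and [fsin] are the
    even and odd parts of [ht psi]; reflecting the terms in [ht psi (- xi)] collects the folded
    function. Nonnegative [s] places [p] and [q] in L^2. *)
Lemma fourier_hartley s u (g : R -> R[i]) M : 0 <= s -> has_fourier s u g ->
  (weighted_norm s g < M%:E)%E ->
  let h := fold_hartley (fun xi => complex.Re (g xi)) (fun xi => complex.Im (g xi)) in
  [/\ L2 h, Int (fun xi => wt s xi * h xi ^+ 2),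
      I (fun xi => wt s xi * h xi ^+ 2) <= M ^+ 2 &
      forall psi : schwartz R, u psi = I (fun xi => h xi * ht psi xi)].
Proof.
move=> s0 [mp mq _ Hu] gM h.
have [IK IKM] := weighted_norm_lt mp mq gM.
set p := fun xi => complex.Re (g xi) in h mp IK IKM *.
set q := fun xi => complex.Im (g xi) in h mq IK IKM *.
have [mh Ih IhK] := fold_hartley_wt mp mq IK.
have half f : meas f -> (forall xi, f xi ^+ 2 <= p xi ^+ 2 + q xi ^+ 2) -> L2 f.
  move=> mf fK; apply: (L2_of_wt s0 mf); apply: (le_Int _ _ IK).
    by apply: measM; [exact: meas_wt|exact: measX].
  move=> xi; rewrite ger0_norm; last by apply: mulr_ge0; [exact: wt_ge0|exact: sqr_ge0].
  by apply: ler_wpM2l; [exact: wt_ge0|exact: fK].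
have Lp : L2 p by apply: half => // xi; rewrite lerDl sqr_ge0.
have Lq : L2 q by apply: half => // xi; rewrite lerDr sqr_ge0.
have Lh : L2 h by apply: (L2_of_wt s0).
split => //; first exact: le_trans IhK IKM.
move=> psi; have Ipsi := schwartz_Int psi.
have /(congr1 (@complex.Re R)) /= := Hu psi.
move=> ->; rewrite -/(I _).
rewrite (eq_I (g := fun xi => p xi * fcos psi xi - q xi * fsin psi xi)); last first.
  by move=> xi; rewrite inverse_fourierE /p /q; case: (g xi) => a b /=.
have LH := ht_schwartz_L2 psi; have LH' := L2_opp LH.
have J1 := IntZ 2^-1 (L2M (L2B Lp Lq) LH).
have J2 := IntZ 2^-1 (L2M (L2D Lp Lq) LH').
transitivity (I (fun xi => 2^-1 * ((p xi - q xi) * ht psi xi)) +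
    I (fun xi => 2^-1 * ((p xi + q xi) * ht psi (- xi)))).
  by rewrite -ID//; apply: eq_I => xi; rewrite fcosE// fsinE//; field.
rewrite -(I_opp J2) -(ID J1 (Int_opp J2)); apply: eq_I => xi.
by rewrite opprK /h /fold_hartley; field.
Qed.

End sobolev_representation.

(** * Classical solutions on the Hartley side *)

Section symbol.
Variable R : realType.
Implicit Types (a x y z xi d : R).

Lemma cothN z : coth (- z) = - coth z :> R.
Proof. by rewrite /coth opprK addrC -mulrN -invrN opprB. Qed.

Lemma expR_sub_gt0 z : 0 < z -> 0 < expR z - expR (- z).
Proof. by move=> z0; rewrite subr_gt0 ltr_expR; lra. Qed.

Lemma coth_sub1 z : 0 < z -> coth z - 1 = 2 / (expR (2 * z) - 1).
Proof.
move=> z0; have h := expR_sub_gt0 z0.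
have E : expR (2 * z) = expR z * expR z by rewrite -expRD; congr expR; ring.
have E' : expR z * expR (- z) = 1 by exact: expRxMexpNx_1.
have h2 : expR (2 * z) - 1 = expR z * (expR z - expR (- z)) by rewrite mulrBr E' E.
have e0 := expR_gt0 z.
rewrite h2 /coth; have n0 := lt0r_neq0 h; have a0 := lt0r_neq0 e0.
transitivity (2 * (expR z * expR (- z)) / (expR z * (expR z - expR (- z)))).
  by move: (expR z) (expR (- z)) n0 a0 => A B n0 a0; field; rewrite n0 a0.
by rewrite E' mulr1.
Qed.

(** Equivalent to [sinh z <= z cosh z]; the difference vanishes at 0 and has derivative
    [z sinh z]. *)
Lemma coth_ge_inv z : 0 < z -> z^-1 <= coth z.
Proof.
move=> z0; have h := expR_sub_gt0 z0.
rewrite /coth ler_pdivlMr// mulrC ler_pdivrMr//.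
pose f y : R := (expR y + expR (- y)) * y - (expR y - expR (- y)).
pose f' y : R := y * (expR y - expR (- y)).
have df (y : R) : is_derive y 1 f (f' y) by rewrite /f /f'; isD_tac; rewrite /=; ring.
have [|c] := @MVT _ f f' 0 z z0 (fun y _ => df y).
  by apply: continuous_subspaceT; exact: isD_continuous df.
rewrite in_itv/= => /andP[c0 cz] E.
have f0 : f 0 = 0 by rewrite /f oppr0 subrr mulr0 subr0.
have : 0 <= f z.
  have -> : f z = f z - f 0 by rewrite f0 subr0.
  rewrite E; apply: mulr_ge0; last by lra.
  by apply: mulr_ge0; [exact: ltW|apply/ltW/expR_sub_gt0].
rewrite /f; lra.
Qed.

Lemma coth_le_inv z : 0 < z -> coth z - 1 <= z^-1.
Proof.
move=> z0; rewrite coth_sub1//.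
have h : 2 * z <= expR (2 * z) - 1 by have := expR_ge1Dx (2 * z); lra.
have h0 : 0 < expR (2 * z) - 1 by lra.
rewrite ler_pdivrMr// mulrC ler_pdivlMr//; lra.
Qed.

Variable delta : R.
Hypothesis delta0 : 0 < delta.

Definition csym xi := coth (2 * pi * delta * xi) - (2 * pi * delta * xi)^-1.
(* [kap] is the symbol of the kinetic energy, [om] the dispersion relation, [csym] that of [G_delta] (up to the factor [-i]). *)
Definition kap xi := 2 * pi * xi * csym xi.
Definition om xi := 2 * pi * xi * kap xi.

Lemma symbol_GE xi : symbol_G delta xi = Complex 0 (- csym xi).
Proof. by []. Qed.

Lemma csymN xi : csym (- xi) = - csym xi.
Proof. by rewrite /csym mulrN cothN invrN opprB opprK addrC. Qed.
Lemma kapN xi : kap (- xi) = kap xi.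
Proof. by rewrite /kap csymN; ring. Qed.
Lemma omN xi : om (- xi) = - om xi.
Proof. by rewrite /om kapN; ring. Qed.

Lemma tpd_gt0 : 0 < 2 * pi * delta.
Proof. by rewrite mulr_gt0// mulr_gt0// pi_gt0. Qed.

Lemma csym_pos xi : 0 < xi -> 0 <= csym xi <= 1.
Proof.
move=> xi0; have z0 : 0 < 2 * pi * delta * xi by rewrite mulr_gt0// tpd_gt0.
have h1 := coth_ge_inv z0; have h2 := coth_le_inv z0.
by rewrite /csym; apply/andP; split; lra.
Qed.

(** The convention [0^-1 = 0] makes both terms vanish, which happens to be the value that removes
    the singularity of the symbol. *)
Lemma csym0 : csym 0 = 0.
Proof. by rewrite /csym mulr0 invr0 subr0 /coth oppr0 subrr invr0 mulr0. Qed.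

Lemma csym_le1 xi : `|csym xi| <= 1.
Proof.
have [x0|x0|->] := ltgtP xi 0; last by rewrite csym0 normr0.
- have := @csym_pos (- xi); rewrite oppr_gt0 => /(_ x0) /andP[? ?].
  by rewrite -(opprK xi) csymN normrN ger0_norm.
- by have /andP[? ?] := csym_pos x0; rewrite ger0_norm.
Qed.

Lemma kap_ge0 xi : 0 <= kap xi.
Proof.
have p0 := pi_ge0 R.
have [x0|x0|->] := ltgtP xi 0; last by rewrite /kap mulr0 mul0r.
- rewrite -kapN /kap; have := @csym_pos (- xi); rewrite oppr_gt0 => /(_ x0) /andP[? _].
  by rewrite !mulr_ge0// oppr_ge0 ltW.
- by have /andP[? _] := csym_pos x0; rewrite /kap !mulr_ge0// ltW.
Qed.

Lemma kap_le xi : `|kap xi| <= 2 * pi * `|xi|.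
Proof.
rewrite /kap !normrM normr_nat (ger0_norm (pi_ge0 R)) -[leRHS]mulr1.
by rewrite ler_wpM2l ?csym_le1// !mulr_ge0// pi_ge0.
Qed.

Lemma om_le xi : `|om xi| <= 4 * pi ^+ 2 * xi ^+ 2.
Proof.
rewrite /om !normrM normr_nat (ger0_norm (pi_ge0 R)).
rewrite -(real_normK (num_real xi)).
rewrite [leLHS](_ : _ = 4 * pi ^+ 2 * `|xi| ^+ 2 * `|csym xi|); last by ring.
apply: ler_piMr; last exact: csym_le1.
by apply: mulr_ge0; [apply: mulr_ge0 => //|]; exact: sqr_ge0.
Qed.

Lemma meas_coth : meas (@coth R).
Proof.
have m1 : meas (expR : R -> R) by apply: cont_meas; exact: continuous_expR.
have m2 : meas (fun z : R => expR (- z)) by exact: meas_opp m1.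
by apply: measM; [exact: measD|apply: meas_inv; exact: measB].
Qed.

Lemma meas_csym : meas csym.
Proof.
have ml : meas (fun xi => 2 * pi * delta * xi) by exact: meas_lin.
apply: measB; first exact: (meas_comp meas_coth ml).
exact: meas_inv.
Qed.
Lemma meas_kap : meas kap.
Proof. by apply: measM; [exact: meas_lin|exact: meas_csym]. Qed.
Lemma meas_om : meas om.
Proof. by apply: measM; [exact: meas_lin|exact: meas_kap]. Qed.

End symbol.

(** * The space H^4 and multipliers of order two *)

Section x4.
Variable R : realType.
Notation mu := (@lebesgue_measure R).
Implicit Types (f g h m : R -> R) (a x y z xi d C : R).

Definition X4 h := meas h /\ Int (fun xi => W xi ^+ 4 * h xi ^+ 2).
Definition n4 h := I (fun xi => W xi ^+ 4 * h xi ^+ 2).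
Definition cW : R := I (fun xi => (W xi ^+ 2)^-1).

Lemma n4_ge0 h : 0 <= n4 h.
Proof. by apply: I_ge0 => xi; rewrite mulr_ge0 ?sqr_ge0// exprn_ge0// ltW// W_gt0. Qed.

Lemma Int_W2V : Int (fun xi : R => (W xi ^+ 2)^-1).
Proof.
apply: (@le_Int R _ (fun x => (1 + x ^+ 2)^-1)); last exact: Int_oneDsqrV.
  by apply: meas_inv; apply: measX; exact: meas_W.
move=> xi; have w1 := W_ge1 xi; have w0 := W_gt0 xi.
rewrite ger0_norm ?invr_ge0 ?sqr_ge0// lef_pV2 ?posrE ?exprn_gt0//.
by rewrite -/(W xi) expr2 ler_peMl// ltW.
Qed.
Lemma cW_ge0 : 0 <= cW.
Proof. by apply: I_ge0 => xi; rewrite invr_ge0 sqr_ge0. Qed.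

Lemma X4_mul h m C : X4 h -> meas m -> (forall xi, `|m xi| <= C * W xi) ->
  [/\ Int (fun xi => m xi * h xi), L2 (fun xi => m xi * h xi),
      I (fun xi => (m xi * h xi) ^+ 2) <= C ^+ 2 * n4 h &
      I (fun xi => `|m xi * h xi|) ^+ 2 <= C ^+ 2 * (cW * n4 h)].
Proof.
move=> [mh Ih] mm mC.
have C0 : 0 <= C.
  have := mC 0; rewrite /W expr0n addr0 mulr1; exact: le_trans.
have mmh : meas (fun xi => m xi * h xi) by exact: measM.
have le2 xi : (m xi * h xi) ^+ 2 <= C ^+ 2 * (W xi ^+ 4 * h xi ^+ 2).
  rewrite exprMn mulrA ler_wpM2r ?sqr_ge0//.
  apply: (@le_trans _ _ ((C * W xi) ^+ 2)).
    rewrite -(real_normK (num_real (m xi))) lerXn2r ?nnegrE//.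
    by rewrite mulr_ge0// ltW// W_gt0.
  rewrite exprMn ler_wpM2l ?sqr_ge0//.
  have w1 := W_ge1 xi; rewrite -[W xi ^+ 4]/(W xi ^+ (2 + 2)) exprD ler_peMr ?sqr_ge0//.
  by rewrite expr_ge1//; lra.
have Lmh : L2 (fun xi => m xi * h xi) by apply: (L2_intro mmh le2); exact: IntZ.
pose k xi := C * (W xi ^+ 2 * `|h xi|); pose v xi := (W xi)^-1.
have mv : meas v by apply: meas_inv; exact: meas_W.
have mk : meas k.
  by apply: measM; [exact: meas_cst|apply: measM; [apply: measX; exact: meas_W|exact: meas_norm]].
have kE xi : k xi ^+ 2 = C ^+ 2 * (W xi ^+ 4 * h xi ^+ 2).
  by rewrite /k -(real_normK (num_real (h xi))); ring.
have Lk : L2 k.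
  by split => //; apply: eq_Int (IntZ (C ^+ 2) Ih) => xi; rewrite kE.
have vE xi : v xi ^+ 2 = (W xi ^+ 2)^-1 by rewrite /v exprVn.
have Lv : L2 v by split => //; apply: eq_Int Int_W2V => xi; rewrite vE.
have Ikv := L2M Lk Lv.
have le1 xi : `|m xi * h xi| <= k xi * v xi.
  rewrite normrM /k /v (_ : C * _ * _ = C * W xi * `|h xi|).
    exact: ler_wpM2r.
  by have := W_gt0 xi => w0; field; rewrite gt_eqF.
have Imh : Int (fun xi => m xi * h xi) by exact: le_Int le1 Ikv.
split => //.
- rewrite /n4 -(IZ _ Ih); apply: le_I => //; [exact: Lmh.2|exact: IntZ].
- have := CS Lk Lv.
  rewrite (eq_I kE) (eq_I vE) (IZ _ Ih) -/(n4 h) -/cW => H.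
  rewrite (mulrC cW) mulrA; apply: le_trans H.
  have z0 : 0 <= I (fun xi => `|m xi * h xi|) by apply: I_ge0.
  have L := le_I (Int_norm Imh) Ikv le1.
  by rewrite lerXn2r ?nnegrE// (le_trans z0).
Qed.

Lemma X4D g h : X4 g -> X4 h -> X4 (fun xi => g xi + h xi).
Proof.
move=> [mg Ig] [mh Ih]; split; first exact: measD.
apply: (@le_Int R _ (fun xi => 2 * (W xi ^+ 4 * g xi ^+ 2) + 2 * (W xi ^+ 4 * h xi ^+ 2))).
- by apply: measM; [apply: measX; exact: meas_W|apply: measX; exact: measD].
- move=> xi; have w0 : 0 <= W xi ^+ 4 by rewrite exprn_ge0// ltW// W_gt0.
  rewrite ger0_norm; last by apply: mulr_ge0 => //; exact: sqr_ge0.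
  rewrite [leRHS](_ : _ = W xi ^+ 4 * (2 * g xi ^+ 2 + 2 * h xi ^+ 2)); last by ring.
  apply: ler_wpM2l => //.
  by have := sqr_ge0 (g xi - h xi); nra.
- by apply: IntD; exact: IntZ.
Qed.
Lemma X4Z c h : X4 h -> X4 (fun xi => c * h xi).
Proof.
move=> [mh Ih]; split; first by apply: measM => //; exact: meas_cst.
by apply: eq_Int (IntZ (c ^+ 2) Ih) => xi; ring.
Qed.
Lemma X4B g h : X4 g -> X4 h -> X4 (fun xi => g xi - h xi).
Proof.
move=> Xg Xh; have := X4D Xg (X4Z (-1) Xh).
by under eq_fun do rewrite mulN1r.
Qed.
Lemma X4_opp h : X4 h -> X4 (fun xi => h (- xi)).
Proof.
move=> [mh Ih]; split; first exact: meas_opp.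
by apply: eq_Int (Int_opp Ih) => xi; rewrite WN.
Qed.
Lemma n4_opp h : X4 h -> n4 (fun xi => h (- xi)) = n4 h.
Proof. by move=> [mh Ih]; rewrite /n4 -(I_opp Ih); apply: eq_I => xi; rewrite WN. Qed.

Lemma X4_Int h : X4 h -> Int h /\ L2 h.
Proof.
move=> Xh; have [] := @X4_mul h (fun=> 1) 1 Xh (meas_cst 1).
  by move=> xi; rewrite normr1 mul1r W_ge1.
by under eq_fun do rewrite mul1r.
Qed.
Lemma X4_xi h : X4 h -> Int (fun xi => xi * h xi).
Proof.
move=> Xh; have [] := @X4_mul h (fun xi => xi) 1 Xh (@meas_id R) => //.
by move=> xi; rewrite mul1r W_norm.
Qed.

End x4.

(** * Classical solutions as continuous curves in H^4 *)

Section solution_data.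
Variable R : realType.
Notation mu := (@lebesgue_measure R).
Implicit Types (f g m : R -> R) (t x y z xi d C : R).
Variables delta T : R.
Hypothesis delta0 : 0 < delta.
Hypothesis T0 : 0 < T.

(** The operator [G_delta d^2/dx^2], whose Fourier symbol is [i om]; as for [hD], the odd imaginary
    symbol produces the reflection. *)
Definition hA (h : R -> R) xi := - om delta xi * h (- xi).

(* A classical solution seen through its Hartley transform [h t]; times outside [[0, T]] are clamped, so that the continuity statements hold for all [t]. *)
Definition solution_data (h : R -> R -> R) :=
  [/\ forall t, X4 (h t),
      forall t e, 0 < e -> exists2 d, 0 < d &
        forall t', `|t' - t| < d -> n4 (fun xi => h t' xi - h t xi) <= e &
      forall t, 0 < t -> t < T -> forall x, is_derive t 1 (fun tau => ht (h tau) x)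
        (ht (hA (h t)) x + ht (h t) x ^+ 2 * ht (hD (h t)) x)].

Lemma hA_spec (h : R -> R) : X4 h ->
  [/\ Int (hA h), L2 (hA h), I (fun xi => hA h xi ^+ 2) <= (4 * pi ^+ 2) ^+ 2 * n4 h &
      I (fun xi => `|hA h xi|) ^+ 2 <= (4 * pi ^+ 2) ^+ 2 * (@cW R * n4 h)].
Proof.
move=> Xh; rewrite -(n4_opp Xh); apply: X4_mul; first exact: X4_opp.
  by apply: measN; exact: meas_om.
move=> xi; rewrite normrN; apply: le_trans (om_le delta0 xi) _.
apply: ler_wpM2l; first by apply: mulr_ge0 => //; exact: sqr_ge0.
by rewrite /W lerDr.
Qed.

Lemma hD_spec (h : R -> R) : X4 h ->
  [/\ Int (hD h), L2 (hD h), I (fun xi => hD h xi ^+ 2) <= (2 * pi) ^+ 2 * n4 h &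
      I (fun xi => `|hD h xi|) ^+ 2 <= (2 * pi) ^+ 2 * (@cW R * n4 h)].
Proof.
move=> Xh; rewrite -(n4_opp Xh); apply: X4_mul; first exact: X4_opp.
  by apply: measN; exact: meas_lin.
move=> xi; rewrite normrN !normrM normr_nat (ger0_norm (pi_ge0 R)).
by rewrite ler_wpM2l ?W_norm// mulr_ge0// pi_ge0.
Qed.

Lemma hDD (h : R -> R) xi : hD (hD h) xi = - (2 * pi * xi) ^+ 2 * h xi.
Proof. by rewrite /hD opprK; ring. Qed.

Lemma hDD_spec (h : R -> R) : X4 h -> Int (hD (hD h)) /\ L2 (hD (hD h)).
Proof.
move=> Xh; have -> : hD (hD h) = (fun xi => - (2 * pi * xi) ^+ 2 * h xi).
  by apply/funext => xi; exact: hDD.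
have [] := @X4_mul R h (fun xi => - (2 * pi * xi) ^+ 2) ((2 * pi) ^+ 2) Xh => //.
  by apply: measN; apply: measX; exact: meas_lin.
move=> xi; rewrite normrN ger0_norm ?sqr_ge0// exprMn ler_wpM2l ?sqr_ge0//.
by rewrite /W lerDr.
Qed.

Lemma isD_ht_X4 (h : R -> R) x : X4 h -> is_derive x 1 (ht h) (ht (hD h) x).
Proof. by move=> Xh; have [] := isD_ht x (X4_Int Xh).1 (X4_xi Xh). Qed.

Lemma isD_ht_X4_2 (h : R -> R) x : X4 h -> is_derive x 1 (ht (hD h)) (ht (hD (hD h)) x).
Proof.
move=> Xh; have [I1 _ _ _] := hD_spec Xh.
have Ixh : Int (fun xi => xi * hD h xi).
  have [] := @X4_mul R _ (fun xi => xi * - (2 * pi * xi)) (2 * pi) (X4_opp Xh).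
  - apply: measM; first exact: meas_id.
    by apply: measN; exact: meas_lin.
  - move=> xi; rewrite mulrN normrN (_ : xi * (2 * pi * xi) = 2 * pi * xi ^+ 2); last by ring.
    have p0 : 0 <= 2 * pi :> R by rewrite mulr_ge0// pi_ge0.
    rewrite ger0_norm; last by apply: mulr_ge0 => //; exact: sqr_ge0.
    by apply: ler_wpM2l => //; rewrite /W lerDr.
  - by move=> + _ _ _; apply: eq_Int => xi; rewrite /hD mulrA.
by have [] := isD_ht x I1 Ixh.
Qed.

Lemma Hs4_hartley (u : rdistribution R) M : (Hs_norm 4 u < M%:E)%E ->
  exists h : R -> R, [/\ X4 h, n4 h <= M ^+ 2 &
    forall psi : schwartz R, u psi = I (fun xi => h xi * ht psi xi)].
Proof.
move=> /ereal_inf_lt [_ [g Hg <-] gM].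
have s0 : (0 : R) <= 4 by [].
have [Lh Ih IM Hh] := fourier_hartley s0 Hg gM.
eexists; split; last exact: Hh.
- split; first exact: Lh.1.
  by apply: eq_Int Ih => xi; rewrite wt_nat.
- by apply: le_trans IM; rewrite /n4 le_eqVlt; apply/orP; left; apply/eqP/eq_I => xi; rewrite wt_nat.
Qed.

Definition clamp t := (`|t| - `|t - T| + T) / 2.
Lemma clamp_itv t : 0 <= clamp t <= T.
Proof.
move: T0 => T0'.
rewrite /clamp; case: (ger0P t) => ?; case: (ger0P (t - T)) => ?; apply/andP; split; lra.
Qed.
Lemma clamp_lip t (t' : R) : `|clamp t - clamp t'| <= `|t - t'|.
Proof.
move: T0 => T0'.
rewrite /clamp; case: (ger0P t) => ?; case: (ger0P (t - T)) => ?;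
 case: (ger0P t') => ?; case: (ger0P (t' - T)) => ?; case: (ger0P (t - t')) => ?;
 rewrite ler_norml; apply/andP; split; lra.
Qed.
Lemma clamp_id t : 0 <= t <= T -> clamp t = t.
Proof.
by move=> /andP[? ?]; rewrite /clamp; case: (ger0P t) => ?; case: (ger0P (t - T)) => ?; lra.
Qed.

Lemma smooth_continuous f : smooth f -> continuous f.
Proof.
move=> sf x; apply/differentiable_continuous/derivable1_diffP.
by have := sf 0%N x; rewrite derive1n0.
Qed.

(** The factor [- i csym] exchanges real and imaginary parts; as [csym] is odd, this amounts after
    folding to a reflection. *)
Lemma symbol_fold (g : R -> complex.complex R) xi :
  fold_hartley (fun xi => complex.Re (symbol_G delta xi * g xi))
    (fun xi => complex.Im (symbol_G delta xi * g xi)) xi =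
  csym delta xi * fold_hartley (fun xi => complex.Re (g xi)) (fun xi => complex.Im (g xi)) (- xi).
Proof.
rewrite /fold_hartley !symbol_GE csymN !opprK.
by case: (g xi) => a b; case: (g (- xi)) => a' b' /=; field.
Qed.

(** [is_G] only supplies some Fourier transform [g] of the second derivative. By [repr_unique] its
    folding agrees almost everywhere with [hD (hD h)], which may therefore replace it in the
    pairings; continuity of [v] makes the conclusion pointwise. *)
Lemma is_G_hartley (h : R -> R) (v : R -> R) : X4 h -> continuous v ->
  is_G delta (ht (hD (hD h))) v -> forall x, v x = ht (hA h) x.
Proof.
move=> Xh cv [g [Hg Hv]]; have [IA LA _ _] := hA_spec Xh.
have [I2 L2'] := hDD_spec Xh.
have [mp mq gf _] := Hg; have [mp' mq' gf' _] := Hv.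
have fin (s : R) (k : R -> complex.complex R) : (weighted_norm s k < +oo)%E ->
    exists M : R, (weighted_norm s k < M%:E)%E.
  have : (0 <= weighted_norm s k)%E by exact: Lnorm_ge0.
  case: (weighted_norm s k) => [r||] //= _ _; exists (r + 1).
  by rewrite lte_fin ltrDl.
have [M gM] := fin _ _ gf; have [M' gM'] := fin _ _ gf'.
have [Lh0 _ _ H0] := fourier_hartley (lexx 0) Hg gM.
have [Lh1 _ _ H1] := fourier_hartley (lexx 0) Hv gM'.
set h0 := fold_hartley _ _ in Lh0 H0.
have E0 : {ae mu, forall xi, h0 xi - hD (hD h) xi = 0}.
  apply: repr_unique; first exact: L2B.
  move=> psi; have LH := ht_schwartz_L2 psi.
  rewrite (eq_I (g := fun xi => h0 xi * ht psi xi - hD (hD h) xi * ht psi xi)); last first.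
    by move=> xi; rewrite mulrBl.
  rewrite (IB (L2M Lh0 LH) (L2M L2' LH)) -H0 /dist_of -/(I _).
  rewrite -(ht_swap (schwartz_Int psi) I2); apply/eqP; rewrite subr_eq0; apply/eqP.
  by apply: eq_I => x; rewrite mulrC.
apply: ht_of_tests => // psi.
have := H1 psi; rewrite /dist_of -/(I _) => ->.
have LH := ht_schwartz_L2 psi; have LH' := L2_opp LH.
have mc := meas_opp (@meas_csym R delta).
have bc xi : `|csym delta (- xi)| <= 1 by exact: csym_le1.
have J0 : Int (fun xi => h0 xi * (ht psi (- xi) * csym delta (- xi))).
  by apply: L2M => //; exact: L2Mb mc bc LH'.
have mL : meas (fun xi => hD (hD h) xi * (ht psi (- xi) * csym delta (- xi))).
  apply: measM; first exact: L2'.1.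
  by apply: measM; [exact: LH'.1|exact: mc].
have [J1 EJ] := ae_eq_I J0 mL (aeS (fun xi (e : h0 xi - hD (hD h) xi = 0) =>
  f_equal (fun z => z * (ht psi (- xi) * csym delta (- xi))) (subr0_eq e)) E0).
transitivity (I (fun xi => h0 xi * (ht psi (- xi) * csym delta (- xi)))).
  rewrite -(I_opp J0); apply: eq_I => xi; rewrite !opprK symbol_fold -/h0; ring.
rewrite EJ -(I_opp J1); apply: eq_I => xi.
by rewrite !opprK hDD /hA /om /kap; ring.
Qed.

Theorem classical_solution_data (u0 : R -> R) (u : R -> R -> R) :
  classical_solution delta T u0 u ->
  exists2 h, solution_data h & forall t, 0 <= t <= T -> forall x, u t x = ht (h t) x.
Proof.
move=> [_ Hu Hc Hd].
have inT t : 0 <= t <= T -> t \in `[0, T] by rewrite in_itv.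
have ex t : exists h : R -> R, 0 <= t <= T -> [/\ X4 h,
    forall psi : schwartz R, dist_of (u t) psi = I (fun xi => h xi * ht psi xi) &
    forall x, u t x = ht h x].
  have [tT|tT] := boolP (0 <= t <= T); last by exists (fun=> 0).
  have [su /(_ 4)] := Hu t (inT _ tT).
  have : (0 <= Hs_norm 4 (dist_of (u t)))%E.
    by apply: le_ereal_inf_tmp => _ [g _ <-]; exact: Lnorm_ge0.
  case: (Hs_norm 4 _) (@Hs4_hartley (dist_of (u t))) => [r||] //= H _ _.
  have [|h [Xh _ Hh]] := H (r + 1); first by rewrite lte_fin ltrDl.
  exists h => _; split => //.
  by apply: ht_of_tests => //; [exact: smooth_continuous|exact: (X4_Int Xh).1].
have {ex}[h Hh] := choice ex.
exists (fun t => h (clamp t)); last first.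
  by move=> t tT x; rewrite clamp_id//; have [_ _] := Hh t tT; exact.
split.
- by move=> t; have [] := Hh _ (clamp_itv t).
- move=> t0 e e0; pose t := clamp t0; have tT : 0 <= t <= T := clamp_itv t0.
  (* A norm below [e1] gives [n4] at most [e1^2], hence at most [e] because [e1 <= 1]. *)
  pose e1 := Num.min 1 e; have e10 : 0 < e1 by rewrite lt_min ltr01.
  have [_ /(_ t (inT _ tT) e1 e10)[d d0 Hcd]] := Hc 4.
  exists d => // t0' Ht0'; pose t' := clamp t0'; have tT' : 0 <= t' <= T := clamp_itv t0'.
  have dt : `|t' - t| < d by exact: le_lt_trans (clamp_lip _ _) Ht0'.
  have /Hs4_hartley[k [Xk nk Hk]] := Hcd t' (inT _ tT') dt.
  have [Xt Ht _] := Hh t tT; have [Xt' Ht' _] := Hh t' tT'.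
  have XB := X4B Xt' Xt.
  have E : {ae mu, forall xi, k xi - (h t' xi - h t xi) = 0}.
    apply: repr_unique; first by exact: L2B (X4_Int Xk).2 (X4_Int XB).2.
    move=> psi; have LH := ht_schwartz_L2 psi.
    have J1 := L2M (X4_Int Xk).2 LH; have J2 := L2M (X4_Int Xt).2 LH.
    have J3 := L2M (X4_Int Xt').2 LH.
    rewrite (eq_I (g := fun xi => k xi * ht psi xi - (h t' xi * ht psi xi - h t xi * ht psi xi))); last first.
      by move=> xi; ring.
    rewrite (IB J1 (IntB J3 J2)) (IB J3 J2) -Hk -Ht -Ht'.
    by rewrite subrr.
  have [_ En] := ae_eq_I Xk.2 (Int_meas XB.2) (aeS (fun xi e =>
    f_equal (fun z => W xi ^+ 4 * z ^+ 2) (subr0_eq e)) E).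
  rewrite /n4 -En; apply: le_trans nk _.
  have e1e : e1 <= e by rewrite ge_min lexx orbT.
  have e11 : e1 <= 1 by rewrite ge_min lexx.
  by apply: le_trans e1e; rewrite expr2 ler_piMl// ltW.
- move=> t t0 tT x.
  have tI : 0 <= t <= T by rewrite !ltW.
  rewrite (clamp_id tI).
  have [Xt _ ut] := Hh t tI.
  have tO : t \in `]0, T[ by rewrite in_itv/= t0.
  have [v [cv Gv /(_ x) dv]] := Hd t tO.
  have utE : u t = ht (h t) by apply/funext => y; exact: ut.
  have d1 : (u t)^`()%classic = ht (hD (h t)).
    by rewrite utE; apply: isD_derive1 => y; exact: isD_ht_X4.
  have d2 : ((u t)^`(2))%classic = ht (hD (hD (h t))).
    by rewrite derive1nS derive1n1 d1; apply: isD_derive1 => y; exact: isD_ht_X4_2.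
  rewrite d2 in Gv; rewrite d1 (is_G_hartley Xt cv Gv) ut in dv.
  (* At an interior time the clamping is the identity on a neighbourhood, so both functions have the
     same derivative. *)
  apply: (@near_eq_is_derive _ _ _ (fun tau => u tau x)) => //.
  have /near_in_itvoo[d /= d0 Hdd] := tO.
  exists d => //= s /= Hs; have := Hdd s Hs; rewrite /= in_itv/= => /andP[s0 sT].
  have sI : 0 <= s <= T by rewrite !ltW.
  by rewrite (clamp_id sI); have [_ _ ->] := Hh s sI.
Qed.

End solution_data.

(** * Differentiation in time of bilinear quantities *)

Section time_dependence.
Variable R : realType.
Notation mu := (@lebesgue_measure R).
Implicit Types (f g m : R -> R) (t s x y z xi d e C M : R) (U V F : R -> R -> R).

Lemma isD_lim (Q : R -> R) t (l : R) :
  (forall e, 0 < e -> exists2 d : R, 0 < d & forall s, `|s| < d ->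
     `|Q (t + s) - Q t - s * l| <= e * `|s|) -> is_derive t 1 Q l.
Proof.
move=> H; apply/is_derive1_caratheodory.
exists (fun y => if y == t then l else (Q y - Q t) / (y - t)); split => [y||].
- case: eqP => [->|/eqP yt]; first by rewrite !subrr mulr0.
  by rewrite divfK// subr_eq0.
- apply/cvgrPdist_le => /= e e0; rewrite eqxx.
  have [d d0 Hd] := H e e0; exists d => // y /= ty.
  case: eqP => [_|/eqP yt]; first by rewrite subrr normr0 ltW.
  have yt0 : y - t != 0 by rewrite subr_eq0.
  have n0 : 0 < `|y - t| by rewrite normr_gt0.
  have -> : l - (Q y - Q t) / (y - t) = - ((Q y - Q t - (y - t) * l) / (y - t)) by field.
  rewrite normrN normf_div ler_pdivrMr//.
  have yE : t + (y - t) = y by ring.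
  have := Hd (y - t); rewrite yE; apply.
  by rewrite distrC.
- by rewrite eqxx.
Qed.

(** Continuity at [t] in L^2 and in the sup norm together: the sup bounds are what makes products of
    such curves continuous in L^2 again. *)
Definition good V t :=
  [/\ forall t', L2 (V t'), forall t', exists M, forall x, `|V t' x| <= M &
      forall e, 0 < e -> exists2 d : R, 0 < d & forall t', `|t' - t| < d ->
        I (fun x => (V t' x - V t x) ^+ 2) <= e /\ forall x, `|V t' x - V t x| <= e].

Lemma good_cst (g : R -> R) M t : L2 g -> (forall x, `|g x| <= M) -> good (fun=> g) t.
Proof.
move=> Lg gM; split => [//|_|e e0]; first by exists M.
exists 1 => // t' _; split.
  by rewrite (eq_I (g := fun=> 0)) ?I0 ?ltW// => x; rewrite subrr expr0n.
by move=> x; rewrite subrr normr0 ltW.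
Qed.

Lemma I_sqrD_le f g : L2 f -> L2 g ->
  I (fun x => (f x + g x) ^+ 2) <= 2 * I (fun x => f x ^+ 2) + 2 * I (fun x => g x ^+ 2).
Proof.
move=> Lf Lg; rewrite -(IZ 2 Lf.2) -(IZ 2 Lg.2) -(ID (IntZ 2 Lf.2) (IntZ 2 Lg.2)).
apply: le_I; [exact: (L2D Lf Lg).2|exact: (IntD (IntZ 2 Lf.2) (IntZ 2 Lg.2))|].
by move=> x; have := sqr_ge0 (f x - g x); nra.
Qed.

Lemma I_sqrM_le f g M : L2 f -> meas g -> (forall x, `|g x| <= M) ->
  I (fun x => (g x * f x) ^+ 2) <= M ^+ 2 * I (fun x => f x ^+ 2).
Proof.
move=> Lf mg gM; rewrite -(IZ _ Lf.2).
have Lgf := L2Mb mg gM Lf.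
apply: le_I; [by apply: eq_Int Lgf.2 => x; rewrite mulrC|exact: IntZ Lf.2|].
move=> x; rewrite exprMn ler_wpM2r ?sqr_ge0//.
by rewrite -(real_normK (num_real (g x))) lerXn2r ?nnegrE// (le_trans _ (gM x)).
Qed.

Lemma goodD U V t : good U t -> good V t -> good (fun t x => U t x + V t x) t.
Proof.
move=> [LU BU CU] [LV BV CV]; split.
- by move=> t'; exact: L2D.
- move=> t'; have [M HM] := BU t'; have [N HN] := BV t'.
  by exists (M + N) => x; apply: le_trans (ler_normD _ _) _; exact: lerD.
- move=> e e0; have e4 : 0 < e / 4 by lra.
  have [d d0 Hd] := CU _ e4; have [d' d0' Hd'] := CV _ e4.
  exists (Num.min d d'); first by rewrite lt_min d0.
  move=> t'; rewrite lt_min => /andP[td td'].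
  have [I1 S1] := Hd _ td; have [I2 S2] := Hd' _ td'; split.
    rewrite (eq_I (g := fun x => ((U t' x - U t x) + (V t' x - V t x)) ^+ 2)); last first.
      by move=> x; ring.
    apply: le_trans (I_sqrD_le (L2B (LU t') (LU t)) (L2B (LV t') (LV t))) _.
    by move: I1 I2; move: (I _) (I _) => i1 i2 ? ?; lra.
  move=> x; rewrite (_ : _ - _ = (U t' x - U t x) + (V t' x - V t x)); last by ring.
  apply: le_trans (ler_normD _ _) _; have := S1 x; have := S2 x; lra.
Qed.

Lemma goodM U V t : good U t -> good V t -> good (fun t x => U t x * V t x) t.
Proof.
move=> [LU BU CU] [LV BV CV]; split.
- move=> t'; have [N HN] := BV t'; exact: L2Mb (LV t').1 HN (LU t').
- move=> t'; have [M HM] := BU t'; have [N HN] := BV t'.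
  by exists (M * N) => x; rewrite normrM ler_pM.
- move=> e e0.
  have [M HM] := BU t; have [N HN] := BV t.
  have M0 : 0 <= M by exact: le_trans (HM 0).
  have N0 : 0 <= N by exact: le_trans (HN 0).
  (* Dominates both the constant [2 (M + 1)^2 + 2 N^2] of the L^2 error and the constant [M + 1 + N]
     of the sup error. *)
  pose K := 4 * ((M + 1) ^+ 2 + N ^+ 2 + 1).
  have K0 : 0 < K by rewrite /K; have := sqr_ge0 (M + 1); have := sqr_ge0 N; lra.
  pose e1 := Num.min 1 (e / K).
  have e10 : 0 < e1 by rewrite lt_min ltr01 divr_gt0.
  have e11 : e1 <= 1 by rewrite ge_min lexx.
  have e1K : e1 * K <= e.
    by rewrite -ler_pdivlMr// ge_min lexx orbT.
  have [d d0 Hd] := CU _ e10; have [d' d0' Hd'] := CV _ e10.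
  exists (Num.min d d'); first by rewrite lt_min d0.
  move=> t'; rewrite lt_min => /andP[td td'].
  have [I1 S1] := Hd _ td; have [I2 S2] := Hd' _ td'.
  have HM' x : `|U t' x| <= M + 1.
    rewrite -(subrK (U t x) (U t' x)); apply: le_trans (ler_normD _ _) _.
    by have := S1 x; have := HM x; lra.
  have E x : U t' x * V t' x - U t x * V t x =
    U t' x * (V t' x - V t x) + V t x * (U t' x - U t x) by ring.
  split.
    rewrite (eq_I (g := fun x => (U t' x * (V t' x - V t x) + V t x * (U t' x - U t x)) ^+ 2)); last first.
      by move=> x; rewrite E.
    have L1 : L2 (fun x => U t' x * (V t' x - V t x)).
      have := L2Mb (LU t').1 HM' (L2B (LV t') (LV t)).
      by under eq_fun do rewrite mulrC.
    have L3 : L2 (fun x => V t x * (U t' x - U t x)).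
      have := L2Mb (LV t).1 HN (L2B (LU t') (LU t)).
      by under eq_fun do rewrite mulrC.
    apply: le_trans (I_sqrD_le L1 L3) _.
    have B1 := I_sqrM_le (L2B (LV t') (LV t)) (LU t').1 HM'.
    have B2 := I_sqrM_le (L2B (LU t') (LU t)) (LV t).1 HN.
    apply: le_trans e1K.
    have {}B1 := le_trans B1 (ler_wpM2l (sqr_ge0 (M + 1)) I2).
    have {}B2 := le_trans B2 (ler_wpM2l (sqr_ge0 N) I1).
    have {B1 B2} := lerD (ler_wpM2l (ler0n R 2) B1) (ler_wpM2l (ler0n R 2) B2).
    move/le_trans; apply; rewrite /K.
    have := mulr_ge0 (sqr_ge0 (M + 1)) (ltW e10); have := mulr_ge0 (sqr_ge0 N) (ltW e10).
    by move: ((M + 1) ^+ 2) (N ^+ 2) => p q; lra.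
  move=> x; rewrite E; apply: le_trans (ler_normD _ _) _; rewrite !normrM.
  apply: le_trans e1K.
  have h1 : `|U t' x| * `|V t' x - V t x| <= (M + 1) * e1 by rewrite ler_pM.
  have h2 : `|V t x| * `|U t' x - U t x| <= N * e1 by rewrite ler_pM.
  apply: le_trans (lerD h1 h2) _; rewrite -mulrDl mulrC; apply: ler_wpM2l; first exact: ltW.
  by rewrite /K; nra.
Qed.

Lemma good_pair_cont U V t : good U t -> good V t ->
  {for t, continuous (fun t => I (fun x => U t x * V t x))}.
Proof.
move=> [LU BU CU] [LV BV CV].
apply/cvgrPdist_le => /= e e0.
pose A := I (fun x => U t x ^+ 2); pose B := I (fun x => V t x ^+ 2).
have A0 : 0 <= A by apply: I_ge0 => x; exact: sqr_ge0.
have B0 : 0 <= B by apply: I_ge0 => x; exact: sqr_ge0.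
pose K := 2 * (2 * A + 2 + B + 1); have K0 : 0 < K by rewrite /K; lra.
pose e1 := Num.min 1 (e ^+ 2 / K).
have e10 : 0 < e1 by rewrite lt_min ltr01 divr_gt0// exprn_gt0.
have e11 : e1 <= 1 by rewrite ge_min lexx.
have e1K : e1 * K <= e ^+ 2 by rewrite -ler_pdivlMr// ge_min lexx orbT.
have [d d0 Hd] := CU _ e10; have [d' d0' Hd'] := CV _ e10.
exists (Num.min d d') => /=; first by rewrite lt_min d0.
move=> t' /=; rewrite distrC lt_min => /andP[td td'].
have [I1 _] := Hd _ td; have [I2 _] := Hd' _ td'.
have L1 := L2B (LU t') (LU t); have L3 := L2B (LV t') (LV t).
rewrite -(IB (L2M (LU t) (LV t)) (L2M (LU t') (LV t'))).
rewrite (eq_I (g := fun x => - (U t' x * (V t' x - V t x) + (U t' x - U t x) * V t x))); last first.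
  by move=> x; ring.
have J1 := L2M (LU t') L3; have J2 := L2M L1 (LV t).
rewrite (I_N (IntD J1 J2)) normrN (ID J1 J2).
have e0' := ltW e0.
rewrite -(ler_pXn2r (n := 2))// ?nnegrE// real_normK ?num_real//.
have C1 := CS (LU t') L3; have C2 := CS L1 (LV t).
have U2 : I (fun x => U t' x ^+ 2) <= 2 * A + 2.
  rewrite (eq_I (g := fun x => (U t x + (U t' x - U t x)) ^+ 2)); last by move=> x; ring.
  apply: le_trans (I_sqrD_le (LU t) L1) _; rewrite -/A.
  by move: I1; move: (I _) => i1 ?; lra.
have i10 : 0 <= I (fun x => (U t' x - U t x) ^+ 2) by apply: I_ge0 => x; exact: sqr_ge0.
have i20 : 0 <= I (fun x => (V t' x - V t x) ^+ 2) by apply: I_ge0 => x; exact: sqr_ge0.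
move: C1 C2 U2 I1 I2 i10 i20; rewrite -/B.
move: (I _) (I _) (I _) (I _) (I _) => k1 j2 k2 u2 j1 C1 C2 U2 h1 h2 i10 i20.
have : (j1 + j2) ^+ 2 <= 2 * j1 ^+ 2 + 2 * j2 ^+ 2 by have := sqr_ge0 (j1 - j2); nra.
have : j1 ^+ 2 <= (2 * A + 2) * e1 by apply: le_trans C1 _; nra.
have : j2 ^+ 2 <= e1 * B by apply: le_trans C2 _; exact: ler_wpM2r.
rewrite /K in e1K; nra.
Qed.

Definition L2diff U f t := forall e, 0 < e -> exists2 d : R, 0 < d & forall s, `|s| < d ->
  I (fun x => (U (t + s) x - U t x - s * f x) ^+ 2) <= e * s ^+ 2.

(** The second factor is taken at the new time and is only continuous. This half of the product rule
    already differentiates quantities whose increment factors through that of [U], as the energy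
    does. *)
Lemma L2diff_pair U V f t : (forall t', L2 (U t')) -> L2 f -> L2diff U f t -> good V t ->
  forall e, 0 < e -> exists2 d : R, 0 < d & forall s, `|s| < d ->
   `|I (fun x => (U (t + s) x - U t x) * V (t + s) x) - s * I (fun x => f x * V t x)|
     <= e * `|s|.
Proof.
move=> LU Lf dU [LV BV CV] e e0.
pose A := I (fun x => f x ^+ 2); pose B := I (fun x => V t x ^+ 2).
have A0 : 0 <= A by apply: I_ge0 => x; exact: sqr_ge0.
have B0 : 0 <= B by apply: I_ge0 => x; exact: sqr_ge0.
pose K := 2 * (2 * B + 2 + A + 1); have K0 : 0 < K by rewrite /K; lra.
pose e1 := Num.min 1 (e ^+ 2 / K).
have e10 : 0 < e1 by rewrite lt_min ltr01 divr_gt0// exprn_gt0.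
have e11 : e1 <= 1 by rewrite ge_min lexx.
have e1K : e1 * K <= e ^+ 2 by rewrite -ler_pdivlMr// ge_min lexx orbT.
have [d d0 Hd] := dU _ e10; have [d' d0' Hd'] := CV _ e10.
exists (Num.min d d'); first by rewrite lt_min d0.
move=> s; rewrite lt_min => /andP[sd sd'].
have I1 := Hd _ sd.
have [|I2 _] := Hd' (t + s); first by rewrite (_ : t + s - t = s); last by ring.
set q := fun x => U (t + s) x - U t x - s * f x.
have Lq : L2 q by apply: L2B; [exact: L2B|exact: L2Z].
have L3 := L2B (LV (t + s)) (LV t).
have J1 := L2M Lq (LV (t + s)); have J2 := L2M Lf L3.
have J3 := L2M (L2B (LU (t + s)) (LU t)) (LV (t + s)); have J4 := L2M Lf (LV t).
rewrite -(IZ s J4) -(IB J3 (IntZ s J4)).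
rewrite (eq_I (g := fun x => q x * V (t + s) x + s * (f x * (V (t + s) x - V t x)))); last first.
  by move=> x; rewrite /q; ring.
rewrite (ID J1 (IntZ s J2)) (IZ s J2).
have es0 : 0 <= e * `|s| by rewrite mulr_ge0// ltW.
rewrite -(ler_pXn2r (n := 2))// ?nnegrE// exprMn !real_normK ?num_real//.
have C1 := CS Lq (LV (t + s)); have C2 := CS Lf L3.
have V2 : I (fun x => V (t + s) x ^+ 2) <= 2 * B + 2.
  rewrite (eq_I (g := fun x => (V t x + (V (t + s) x - V t x)) ^+ 2)); last by move=> x; ring.
  apply: le_trans (I_sqrD_le (LV t) L3) _; rewrite -/B.
  by move: I2; move: (I _) => i2 ?; lra.
have i10 : 0 <= I (fun x => q x ^+ 2) by apply: I_ge0 => x; exact: sqr_ge0.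
have i20 : 0 <= I (fun x => (V (t + s) x - V t x) ^+ 2) by apply: I_ge0 => x; exact: sqr_ge0.
have v20 : 0 <= I (fun x => V (t + s) x ^+ 2) by apply: I_ge0 => x; exact: sqr_ge0.
move: C1 C2 V2 I1 I2 i10 i20 v20; rewrite -/A.
rewrite -[I (fun x => (U (t + s) x - U t x - s * f x) ^+ 2)]/(I (fun x => q x ^+ 2)).
move: (I (fun x => q x * _)) (I (fun x => f x * _)) (I (fun x => q x ^+ 2)) => j1 j2 i1.
move: (I (fun x => (V (t + s) x - V t x) ^+ 2)) (I (fun x => V (t + s) x ^+ 2)) => i2 v2.
move=> C1 C2 V2 h1 h2 i10 i20 v20.
have s2 := sqr_ge0 s.
have a1 : (j1 + s * j2) ^+ 2 <= 2 * j1 ^+ 2 + 2 * (s ^+ 2 * j2 ^+ 2).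
  by have := sqr_ge0 (j1 - s * j2); nra.
have a2 : j1 ^+ 2 <= (e1 * s ^+ 2) * (2 * B + 2).
  by apply: le_trans C1 _; apply: ler_pM.
have a3 : s ^+ 2 * j2 ^+ 2 <= s ^+ 2 * (A * e1).
  by apply: ler_wpM2l => //; apply: le_trans C2 _; apply: ler_wpM2l.
have a4 : s ^+ 2 * (e1 * K) <= s ^+ 2 * e ^+ 2 by apply: ler_wpM2l.
have a5 : 0 <= s ^+ 2 * e1 by rewrite mulr_ge0// ltW.
rewrite /K in a4; nra.
Qed.

End time_dependence.

(** * Curves in H^4 and their derivatives in L^2 *)

Section curves.
Variable R : realType.
Notation mu := (@lebesgue_measure R).
Implicit Types (f g m : R -> R) (t s x y z xi d e C M : R) (U V F k : R -> R -> R).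

Lemma eq_good U V t : U =2 V -> good U t -> good V t.
Proof. by move=> e; have -> // : V = U by apply/funext => a; apply/funext => x; rewrite e. Qed.

Definition curve k := (forall t, X4 (k t)) /\
  forall t e, 0 < e -> exists2 d : R, 0 < d &
    forall t', `|t' - t| < d -> n4 (fun xi => k t' xi - k t xi) <= e.

Lemma curve_opp k : curve k -> curve (fun t xi => k t (- xi)).
Proof.
move=> [Xk Ck]; split; first by move=> t; exact: X4_opp.
move=> t e e0; have [d d0 Hd] := Ck t e e0; exists d => // t' /Hd.
by rewrite -(n4_opp (X4B (Xk t') (Xk t))).
Qed.

(** Continuity in L^2 is Parseval's identity, continuity in the sup norm is the L^1 bound on the
    transform; [X4_mul] feeds both. *)
Lemma good_ht k m C t : curve k -> meas m -> (forall xi, `|m xi| <= C * W xi) ->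
  good (fun t => ht (fun xi => m xi * k t xi)) t.
Proof.
move=> [Xk Ck] mm mC.
have C0 : 0 <= C by have := mC 0; rewrite /W expr0n addr0 mulr1; exact: le_trans.
split.
- by move=> t'; have [I1 L1 _ _] := X4_mul (Xk t') mm mC; exact: L2_ht.
- move=> t'; have [I1 _ _ _] := X4_mul (Xk t') mm mC.
  by eexists => x; exact: ht_bound.
- move=> e e0; pose K := C ^+ 2 * (1 + 4 * @cW R) + 1.
  have cw := @cW_ge0 R; have c2 := sqr_ge0 C.
  have K0 : 0 < K by rewrite /K; have := mulr_ge0 c2 cw; nra.
  pose e1 := Num.min e (e ^+ 2) / K.
  have e10 : 0 < e1 by rewrite divr_gt0// lt_min e0 exprn_gt0.
  have e1K : e1 * K = Num.min e (e ^+ 2) by rewrite /e1 divfK// gt_eqF.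
  have [d d0 Hd] := Ck t _ e10; exists d => // t' /Hd {Hd}H.
  have XB := X4B (Xk t') (Xk t).
  have [IB LB B1 B2] := X4_mul XB mm mC.
  have [It' _ _ _] := X4_mul (Xk t') mm mC.
  have [It _ _ _] := X4_mul (Xk t) mm mC.
  have E x : ht (fun xi => m xi * k t' xi) x - ht (fun xi => m xi * k t xi) x =
      ht (fun xi => m xi * (k t' xi - k t xi)) x.
    by rewrite -htB//; congr ht; apply/funext => xi; ring.
  have n0 := n4_ge0 (fun xi => k t' xi - k t xi).
  split.
    rewrite (eq_I (g := fun x => ht (fun xi => m xi * (k t' xi - k t xi)) x ^+ 2)); last first.
      by move=> x; rewrite E.
    rewrite (parseval2 IB LB); apply: le_trans B1 _.
    apply: (@le_trans _ _ (C ^+ 2 * e1)); first exact: ler_wpM2l.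
    apply: (@le_trans _ _ (e1 * K)); last by rewrite e1K ge_min lexx.
    rewrite mulrC; apply: ler_wpM2l; first exact: ltW.
    by rewrite /K; have := mulr_ge0 c2 cw; nra.
  move=> x; rewrite E; apply: le_trans (ht_bound _ IB) _.
  have e0' := ltW e0.
  have a0 : 0 <= I (fun xi => `|m xi * (k t' xi - k t xi)|) by exact: I_ge0.
  have b0 : 0 <= 2 * I (fun xi => `|m xi * (k t' xi - k t xi)|) by rewrite mulr_ge0.
  rewrite -(ler_pXn2r (n := 2))// ?nnegrE// exprMn.
  apply: (@le_trans _ _ (e1 * K)); last by rewrite e1K ge_min lexx orbT.
  apply: (@le_trans _ _ (2 ^+ 2 * (C ^+ 2 * (cW R * e1)))).
    apply: ler_wpM2l => //; apply: le_trans B2 _.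
    by apply: ler_wpM2l => //; apply: ler_wpM2l.
  rewrite [leLHS](_ : _ = e1 * (4 * (C ^+ 2 * cW R))); last by ring.
  apply: ler_wpM2l; first exact: ltW.
  by rewrite /K; lra.
Qed.

Lemma good_cur k t : curve k -> good (fun t => ht (k t)) t.
Proof.
move=> ck; apply: eq_good (good_ht (m := fun=> 1) (C := 1) t ck (meas_cst 1) _).
  by move=> t' x; congr ht; apply/funext => xi; rewrite mul1r.
by move=> xi; rewrite normr1 mul1r W_ge1.
Qed.

(* Pointwise derivatives are upgraded to L^2 by testing the remainder [q] against [q] times a wide Gaussian. *)
Lemma L2diff_intro U (f : R -> R -> R) t (r : R) : 0 < r ->
  (forall t', `|t' - t| < r -> forall x, is_derive t' 1 (U ^~ x) (f t' x)) ->
  (forall t', L2 (U t')) -> (forall t', exists M, forall x, `|U t' x| <= M) ->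
  good f t -> L2diff U (f t) t.
Proof.
move=> r0 dU LU BU [Lf Bf Cf] e e0.
have e10 : 0 < Num.min 1 e by rewrite lt_min ltr01.
have [d d0 Hd] := Cf _ e10.
(* Half of the admissible radius, so that [t + c * s] remains admissible for [|c| < 2], a
   neighbourhood of [[0, 1]]. *)
exists (Num.min d r / 2); first by rewrite divr_gt0// lt_min d0.
move=> s; rewrite ltr_pdivlMr// lt_min => /andP[sd sr].
have Hs (c : R) : 0 <= c <= 1 -> `|c * s| < d / 2 /\ `|c * s| < r / 2.
  move=> /andP[c0 c1]; rewrite normrM (ger0_norm c0).
  have : c * `|s| <= `|s| by rewrite ler_piMl.
  by move=> H; split; lra.
set q := fun x => U (t + s) x - U t x - s * f t x.
have Lq : L2 q by apply: L2B; [exact: L2B|exact: L2Z].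
have [M HM] : exists M, forall x, `|q x| <= M.
  have [M1 H1] := BU (t + s); have [M2 H2] := BU t; have [M3 H3] := Bf t.
  exists (M1 + M2 + `|s| * M3) => x; rewrite /q.
  apply: le_trans (ler_normB _ _) _; apply: lerD.
    by apply: le_trans (ler_normB _ _) _; apply: lerD.
  by rewrite normrM ler_wpM2l.
have [N HN] := Bf t.
suff H n : I (fun x => q x ^+ 2 * gauss (an R n) x) <= e * s ^+ 2.
  have q2m : meas (fun x => q x ^+ 2) by apply: measX; exact: Lq.1.
  apply: (I_gauss_fatou q2m _ _ H).2 => [x|n]; first exact: sqr_ge0.
  apply: IntMb (@meas_gauss R _) _ Lq.2 => x.
  rewrite gauss_norm; apply: gauss_le1; exact/ltW/an_gt0.
have a0 := an_gt0 R n; have ag x : `|gauss (an R n) x| <= 1.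
  by rewrite gauss_norm; apply: gauss_le1; exact/ltW.
pose b x := q x * gauss (an R n) x.
have Ib : Int b.
  have := IntMb Lq.1 HM (Int_gauss a0).
  by apply: eq_Int => x; rewrite /b mulrC.
have Lb : L2 b by exact: L2Mb (@meas_gauss R _) ag Lq.
have Ibb : I (fun x => b x ^+ 2) <= I (fun x => q x ^+ 2 * gauss (an R n) x).
  apply: le_I; [exact: Lb.2|exact: IntMb (@meas_gauss R _) ag Lq.2|move=> x].
  rewrite /b exprMn; apply: ler_wpM2l; first exact: sqr_ge0.
  rewrite expr2; have := gauss_ge0 (an R n) x; have := ag x.
  by rewrite gauss_norm => h1 h2; rewrite ler_piMl.
(* Joins 0, at [c = 0], to the tested remainder, at [c = 1]. The mean value theorem in [c] expresses
   the Gaussian-weighted square of [q] by the oscillation of [f] near [t], paired with [b]. *)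
pose F c x := (U (t + c * s) x - U t x - (c * s) * f t x) * b x.
pose F' c x := s * (f (t + c * s) x - f t x) * b x.
have LF c : Int (F c).
  by apply: L2M => //; apply: L2B; [exact: L2B|exact: L2Z].
have dF (c x : R) : 0 <= c <= 1 \/ `|c| < 2 -> is_derive c 1 (F ^~ x) (F' c x).
  move=> Hc; rewrite /F /F'.
  have dU1 : is_derive (t + c * s) 1 (U ^~ x) (f (t + c * s) x).
    apply: dU; rewrite (_ : t + c * s - t = c * s); last by ring.
    rewrite normrM; case: Hc => [/andP[c0 c1]|].
      by rewrite ger0_norm//; have := normr_ge0 s; nra.
    by move=> H; have := normr_ge0 s; have := normr_ge0 c; nra.
  have dU2 : is_derive c 1 (fun c => U (t + c * s) x) (f (t + c * s) x * s).
    have da : is_derive c 1 (fun c : R => t + c * s) s by isD_tac; rewrite /=; ring.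
    exact: (@isD_comp R _ (fun c : R => t + c * s) c _ _ dU1 da).
  by isD_tac; rewrite /=; ring.
have dIF (c : R) : 0 <= c <= 1 -> is_derive c 1 (fun c => I (F c)) (I (F' c)).
  move=> /andP[c0 c1].
  apply: (@isD_I_loc R F F' c (1 / 2) (fun x => (`|s| * 1) * `|b x|)) => //.
  - move=> y x; rewrite ltr_norml => /andP[h1 h2]; apply: dF; right.
    by rewrite ltr_norml; apply/andP; split; lra.
  - by apply: IntZ; exact: Int_norm.
  - move=> y x; rewrite ltr_norml => /andP[h1 h2].
    rewrite /F' !normrM; apply: ler_wpM2r => //; apply: ler_wpM2l => //.
    have [|_ /(_ x)] := Hd (t + y * s); last by move/le_trans; apply; rewrite ge_min lexx.
    rewrite (_ : t + y * s - t = y * s); last by ring.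
    have y2 : `|y| < 2 by rewrite ltr_norml; apply/andP; split; lra.
    by rewrite normrM; have := normr_ge0 s; have := normr_ge0 y; nra.
have [||c cI] := @MVT R (fun c => I (F c)) (fun c => I (F' c)) 0 1 ltr01.
- move=> c; rewrite in_itv/= => /andP[c0 c1]; apply: dIF; by rewrite !ltW.
- apply: derivable_within_continuous => c; rewrite in_itv/= => cI.
  by have := dIF c cI => ?; exact: ex_derive.
have F0 : I (F 0) = 0.
  rewrite (eq_I (g := fun=> 0)) ?I0// => x; rewrite /F !mul0r addr0; ring.
have F1 : I (F 1) = I (fun x => q x ^+ 2 * gauss (an R n) x).
  by apply: eq_I => x; rewrite /F /b /q !mul1r; ring.
rewrite F0 F1 !subr0 mulr1 => E.
have {}cI : 0 <= c <= 1 by move: cI; rewrite in_itv/= => /andP[? ?]; rewrite !ltW.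
have Lff := L2B (Lf (t + c * s)) (Lf t).
have [|S1 _] := Hd (t + c * s).
  rewrite (_ : t + c * s - t = c * s); last by ring.
  by have [h _] := Hs c cI; lra.
have C1 := CS Lff Lb.
have E2 : I (F' c) = s * I (fun x => (f (t + c * s) x - f t x) * b x).
  rewrite -(IZ s (L2M Lff Lb)); apply: eq_I => x; rewrite /F'; ring.
rewrite E2 in E; have {}S1 : I (fun x => (f (t + c * s) x - f t x) ^+ 2) <= e.
  by apply: le_trans S1 _; rewrite ge_min lexx orbT.
have A0 : 0 <= I (fun x => q x ^+ 2 * gauss (an R n) x).
  by apply: I_ge0 => x; rewrite mulr_ge0 ?sqr_ge0// gauss_ge0.
have B0 : 0 <= I (fun x => b x ^+ 2) by apply: I_ge0 => x; exact: sqr_ge0.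
have G0 : 0 <= I (fun x => (f (t + c * s) x - f t x) ^+ 2) by apply: I_ge0 => x; exact: sqr_ge0.
move: E C1 S1 A0 B0 G0 Ibb.
move: (I (fun x => q x ^+ 2 * _)) (I (fun x => b x ^+ 2)) (I (fun x => (f (t + c * s) x - f t x) ^+ 2)).
move: (I _) => j A B G E C1 S1 A0 B0 G0 Ibb.
have H1 : j ^+ 2 <= e * A by apply: le_trans C1 _; apply: ler_pM.
(* [A] occurs on both sides because [b] is [q] times a Gaussian at most 1; it is then divided
   out. *)
have H2 : A * A <= (e * s ^+ 2) * A.
  by rewrite {1 2}E -expr2 exprMn [leRHS](_ : _ = s ^+ 2 * (e * A)); [apply: ler_wpM2l => //; exact: sqr_ge0|ring].
have [->|An0] := eqVneq A 0; first by apply: mulr_ge0; [exact: ltW|exact: sqr_ge0].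
by rewrite -(ler_pM2r (_ : 0 < A))// lt_neqAle eq_sym An0.
Qed.

Lemma isD_pair U V f g t : (forall t', L2 (U t')) -> L2 f -> L2 g ->
  (forall x, exists M, forall y, `|U x y| <= M) ->
  L2diff U f t -> L2diff V g t -> good V t ->
  is_derive t 1 (fun t => I (fun x => U t x * V t x))
    (I (fun x => f x * V t x) + I (fun x => g x * U t x)).
Proof.
move=> LU Lf Lg BU dU dV gV; apply: isD_lim => e e0.
have e2 : 0 < e / 2 by rewrite divr_gt0.
have [LV _ _] := gV.
have [M HM] := BU t.
have [d d0 H1] := L2diff_pair LU Lf dU gV e2.
have [d' d0' H2] := L2diff_pair LV Lg dV (good_cst t (LU t) HM) e2.
exists (Num.min d d'); first by rewrite lt_min d0.
move=> s; rewrite lt_min => /andP[sd sd'].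
have {}H1 := H1 s sd; have {}H2 := H2 s sd'.
have J1 := L2M (L2B (LU (t + s)) (LU t)) (LV (t + s)).
have J2 := L2M (L2B (LV (t + s)) (LV t)) (LU t).
have E : I (fun x => U (t + s) x * V (t + s) x) - I (fun x => U t x * V t x) =
   I (fun x => (U (t + s) x - U t x) * V (t + s) x) + I (fun x => (V (t + s) x - V t x) * U t x).
  rewrite -(IB (L2M (LU _) (LV _)) (L2M (LU _) (LV _))) -(ID J1 J2).
  by apply: eq_I => x; ring.
rewrite E; move: H1 H2; move: (I _) (I _) (I _) (I _) => a b c p H1 H2.
rewrite (_ : p + b - _ = (p - s * c) + (b - s * a)); last by ring.
by apply: le_trans (ler_normD _ _) _; lra.
Qed.

End curves.

(** * The linear flow *)

Section linear_flow.
Variable R : realType.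
Notation mu := (@lebesgue_measure R).
Implicit Types (f g m k : R -> R) (t s x y z xi d e C M : R).
Variable delta : R.
Hypothesis delta0 : 0 < delta.

Lemma lip1 (f df : R -> R) (a b : R) : (forall x : R, is_derive x 1 f (df x)) ->
  (forall x, `|df x| <= 1) -> `|f a - f b| <= `|a - b|.
Proof.
move=> fd fM; wlog ab : a b / a < b.
  move=> H; case: (ltgtP a b) => [|ba|->]; [exact: H| |by rewrite !subrr].
  by rewrite distrC (distrC a); exact: H.
have cf : {within `[a, b], continuous f}.
  by apply: continuous_subspaceT => x; exact: (isD_cont (fd x)).
have [c _ E] := @MVT R f df a b ab (fun x _ => fd x) cf.
by rewrite distrC (distrC a) E normrM ler_piMl.
Qed.
Lemma cos_lip (a b : R) : `|cos a - cos b| <= `|a - b|.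
Proof.
apply: (@lip1 _ (fun x => - sin x)) => x; last by rewrite normrN; exact: norm_sin_le1.
Qed.
Lemma sin_lip (a b : R) : `|sin a - sin b| <= `|a - b|.
Proof.
apply: (@lip1 _ cos) => x; last exact: norm_cos_le1.
Qed.

Lemma X4_mulb m k M : X4 k -> meas m -> (forall xi, `|m xi| <= M) ->
  X4 (fun xi => m xi * k xi).
Proof.
move=> [mk Ik] mm mM; split; first exact: measM.
have := IntMb (measX 2 mm) (M := M ^+ 2) _ Ik.
move=> H; have {}H := H _.
apply: eq_Int (H _) => xi; first by ring.
rewrite ger0_norm ?sqr_ge0// -(real_normK (num_real (m xi))) lerXn2r ?nnegrE//.
exact: le_trans (mM xi).
Qed.

(** The space H^infinity on the Hartley side, stable under all multipliers of polynomial growth. *)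
Definition nice k := forall n, X4 (fun xi => W xi ^+ n * k xi).

Lemma nice_X4 k : nice k -> X4 k.
Proof.
by move=> /(_ 0%N); under eq_fun do rewrite expr0 mul1r.
Qed.
Lemma nice_X4W k : nice k -> X4 (fun xi => W xi * k xi).
Proof. by move=> /(_ 1%N); under eq_fun do rewrite expr1. Qed.

Lemma X4_mulW m k C n : nice k -> meas m -> (forall xi, `|m xi| <= C * W xi ^+ n) ->
  nice (fun xi => m xi * k xi).
Proof.
move=> nk mm mC p.
have mW : meas (fun xi => m xi * (W xi ^+ n)^-1).
  by apply: measM => //; apply: meas_inv; apply: measX; exact: meas_W.
have : X4 (fun xi => m xi * (W xi ^+ n)^-1 * (W xi ^+ (n + p) * k xi)).
  apply: (X4_mulb (M := C)) => // xi.
  have w0 : 0 < W xi ^+ n by rewrite exprn_gt0// W_gt0.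
  by rewrite normrM normfV (ger0_norm (ltW w0)) ler_pdivrMr.
congr X4; apply/funext => xi; have w0 : W xi != 0 by rewrite gt_eqF// W_gt0.
rewrite exprD; field.
by rewrite expf_neq0.
Qed.

Lemma nice_opp k : nice k -> nice (fun xi => k (- xi)).
Proof. by move=> nk p; have := X4_opp (nk p); under eq_fun do rewrite WN. Qed.

(** The group generated by [hA]: as [om] is odd, the pair [(k xi, k (- xi))] is rotated by the angle
    [t * om xi]. *)
Definition flow k t xi := cos (t * om delta xi) * k xi - sin (t * om delta xi) * k (- xi).

Lemma meas_tom t : meas (fun xi => t * om delta xi).
Proof. by apply: measM; [exact: meas_cst|exact: meas_om]. Qed.
Lemma meas_cosf (f : R -> R) : meas f -> meas (fun xi => cos (f xi)).
Proof. by move=> mf; apply: meas_comp => //; apply: cont_meas; exact: continuous_cos. Qed.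
Lemma meas_sinf (f : R -> R) : meas f -> meas (fun xi => sin (f xi)).
Proof. by move=> mf; apply: meas_comp => //; apply: cont_meas; exact: continuous_sin. Qed.

Lemma flowN k t xi : flow k t (- xi) = cos (t * om delta xi) * k (- xi) + sin (t * om delta xi) * k xi.
Proof. by rewrite /flow omN mulrN cosN sinN opprK; ring. Qed.

Lemma flow0 k xi : flow k 0 xi = k xi.
Proof. by rewrite /flow mul0r cos0 sin0 mul1r mul0r subr0. Qed.

Lemma flow_kap k t xi : flow (fun xi => kap delta xi * k xi) t xi = kap delta xi * flow k t xi.
Proof. by rewrite /flow kapN; ring. Qed.

Lemma nice_flow k t : nice k -> nice (flow k t).
Proof.
move=> nk p.
have H1 : nice (fun xi => cos (t * om delta xi) * k xi).
  apply: (X4_mulW (C := 1) (n := 0)) => //; first (apply: meas_cosf; exact: meas_tom).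
  by move=> xi; rewrite expr0 mulr1; exact: norm_cos_le1.
have H2 : nice (fun xi => sin (t * om delta xi) * k (- xi)).
  apply: (X4_mulW (C := 1) (n := 0)); [exact: nice_opp|apply: meas_sinf; exact: meas_tom|].
  by move=> xi; rewrite expr0 mulr1; exact: norm_sin_le1.
have := X4B (H1 p) (H2 p); congr X4; apply/funext => xi; rewrite /flow; ring.
Qed.

Lemma om_leW xi : `|om delta xi| <= 4 * pi ^+ 2 * W xi.
Proof.
apply: le_trans (om_le delta0 xi) _; apply: ler_wpM2l; last by rewrite /W lerDr.
by apply: mulr_ge0 => //; exact: sqr_ge0.
Qed.

Lemma kap_leW xi : `|kap delta xi| <= 2 * pi * W xi.
Proof.
apply: le_trans (kap_le delta0 xi) _; apply: ler_wpM2l; last exact: W_norm.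
by rewrite mulr_ge0// pi_ge0.
Qed.

Lemma nice_kap k : nice k -> nice (fun xi => kap delta xi * k xi).
Proof.
move=> nk; apply: (X4_mulW (C := 2 * pi) (n := 1)) => //; first exact: meas_kap.
by move=> xi; rewrite expr1; exact: kap_leW.
Qed.
Lemma nice_om k : nice k -> nice (fun xi => om delta xi * k xi).
Proof.
move=> nk; apply: (X4_mulW (C := 4 * pi ^+ 2) (n := 1)) => //; first exact: meas_om.
by move=> xi; rewrite expr1; exact: om_leW.
Qed.

(** The flow is Lipschitz in time: an increment [s] changes sine and cosine by at most [|s om xi|],
    and [om * k] is still in [X4]. *)
Lemma curve_flow k : nice k -> curve (flow k).
Proof.
move=> nk; split; first by move=> t; apply: nice_X4; exact: nice_flow.
move=> t e e0.
have [m1 I1] := nice_X4 (nice_om nk); have [m2 I2] := nice_X4 (nice_om (nice_opp nk)).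
pose K := 2 * n4 (fun xi => om delta xi * k xi) + 2 * n4 (fun xi => om delta xi * k (- xi)) + 1.
have a0 := n4_ge0 (fun xi => om delta xi * k xi).
have b0 := n4_ge0 (fun xi => om delta xi * k (- xi)).
have K0 : 0 < K by rewrite /K; lra.
exists (Num.min 1 (e / K)); first by rewrite lt_min ltr01 divr_gt0.
move=> t' Ht; set s := t' - t in Ht *.
have s2 : s ^+ 2 * K <= e.
  move: Ht; rewrite lt_min => /andP[s1]; rewrite ltr_pdivlMr// => s2.
  rewrite -(real_normK (num_real s)); apply: le_trans (ltW s2).
  by apply: ler_wpM2r; [exact: ltW|rewrite expr2 ler_piMl// ltW].
apply: le_trans s2.
apply: (@le_trans _ _ (I (fun xi => s ^+ 2 * (2 * (W xi ^+ 4 * (om delta xi * k xi) ^+ 2)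
    + 2 * (W xi ^+ 4 * (om delta xi * k (- xi)) ^+ 2))))); last first.
  rewrite (IZ _ (IntD (IntZ 2 I1) (IntZ 2 I2))) (ID (IntZ 2 I1) (IntZ 2 I2)) (IZ 2 I1) (IZ 2 I2).
  by apply: ler_wpM2l; [exact: sqr_ge0|rewrite /K /n4 lerDl].
have XX := X4B (nice_X4 (nice_flow t' nk)) (nice_X4 (nice_flow t nk)).
apply: le_I; [exact: XX.2|exact: (IntZ _ (IntD (IntZ 2 I1) (IntZ 2 I2)))|move=> xi].
rewrite [leRHS](_ : _ = W xi ^+ 4 * (s ^+ 2 * (2 * (om delta xi * k xi) ^+ 2 +
   2 * (om delta xi * k (- xi)) ^+ 2))); last by ring.
apply: ler_wpM2l; first by rewrite exprn_ge0// ltW// W_gt0.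
have c1 := cos_lip (t' * om delta xi) (t * om delta xi).
have c2 := sin_lip (t' * om delta xi) (t * om delta xi).
rewrite -mulrBl -/s in c1 c2.
rewrite /flow.
have sq (a b : R) : `|a| <= `|b| -> a ^+ 2 <= b ^+ 2.
  by move=> ab; rewrite -(real_normK (num_real a)) -(real_normK (num_real b)) lerXn2r ?nnegrE.
have {}c1 := sq _ _ c1; have {}c2 := sq _ _ c2.
set A := cos _ - cos _ in c1; set B := sin _ - sin _ in c2.
rewrite [X in X ^+ 2](_ : _ = A * k xi - B * k (- xi)); last by rewrite /A /B; ring.
move: c1 c2; rewrite exprMn; move: (om _ _) (k xi) (k (- xi)) => o p q c1 c2.
have h1 := ler_wpM2r (sqr_ge0 p) c1; have h2 := ler_wpM2r (sqr_ge0 q) c2.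
by have := sqr_ge0 (A * p + B * q); nra.
Qed.

Lemma isD_flow k t x : nice k ->
  is_derive t 1 (fun tau => ht (flow k tau) x) (ht (hA delta (flow k t)) x).
Proof.
move=> nk.
have [I1 _] := X4_Int (nice_X4 (nice_om nk)).
have [I2 _] := X4_Int (nice_X4 (nice_om (nice_opp nk))).
apply: (@isD_I R (fun t xi => flow k t xi * cas (2 * pi * xi * x))
  (fun t xi => hA delta (flow k t) xi * cas (2 * pi * xi * x)) t
  (fun xi => (`|om delta xi * k xi| + `|om delta xi * k (- xi)|) * 2)).
- by move=> tau; apply: Int_cas; exact: (X4_Int (nice_X4 (nice_flow tau nk))).1.
- move=> tau xi; rewrite /hA flowN /flow; isD_tac; rewrite /=; ring.
- apply: (eq_Int (f := fun xi => 2 * (`|om delta xi * k xi| + `|om delta xi * k (- xi)|))).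
    by move=> xi; rewrite mulrC.
  by apply: IntZ; apply: IntD; exact: Int_norm.
- move=> tau xi _; rewrite normrM; apply: ler_pM => //; last exact: cas_le.
  rewrite /hA flowN normrM normrN !normrM -mulrDr; apply: ler_wpM2l => //.
  rewrite addrC; apply: le_trans (ler_normD _ _) _; rewrite !normrM.
  by apply: lerD; apply: ler_piMl => //; [exact: norm_sin_le1|exact: norm_cos_le1].
Qed.

Lemma good_hA (k : R -> R -> R) t : curve k -> good (fun t => ht (hA delta (k t))) t.
Proof.
move=> ck; apply: eq_good (good_ht t (curve_opp ck) (measN (@meas_om R delta)) _) => //.
by move=> xi; rewrite normrN; exact: om_leW.
Qed.

Lemma good_hD (k : R -> R -> R) t : curve k -> good (fun t => ht (hD (k t))) t.
Proof.
move=> ck; apply: (eq_good _ (good_ht (C := 2 * pi) t (curve_opp ck) (measN (meas_lin (2 * pi))) _)) => //.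
move=> xi; rewrite normrN !normrM normr_nat (ger0_norm (pi_ge0 R)).
by rewrite ler_wpM2l ?W_norm// mulr_ge0// pi_ge0.
Qed.

Lemma good_hK (k : R -> R -> R) t : curve k -> good (fun t => ht (fun xi => kap delta xi * k t xi)) t.
Proof. by move=> ck; apply: (good_ht t ck (@meas_kap R delta) kap_leW). Qed.

Lemma L2diff_flow k t : nice k ->
  L2diff (fun t => ht (flow k t)) (ht (hA delta (flow k t))) t.
Proof.
move=> nk; have cf := curve_flow nk; have [L B _] := good_cur t cf.
apply: (@L2diff_intro R _ (fun t => ht (hA delta (flow k t))) t 1) => //.
- by move=> t' _ x; exact: isD_flow.
- exact: good_hA.
Qed.

End linear_flow.

(** * Conservation laws *)

Section conservation.
Variable R : realType.
Notation mu := (@lebesgue_measure R).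
Implicit Types (f g m k l : R -> R) (t s x y z xi d e C M : R) (U V : R -> R -> R).
Variables delta T : R.
Hypothesis delta0 : 0 < delta.
Hypothesis T0 : 0 < T.

Definition pr f g := I (fun x => f x * g x).

Lemma eq_pr f g (f' g' : R -> R) : f =1 f' -> g =1 g' -> pr f g = pr f' g'.
Proof. by move=> e1 e2; apply: eq_I => x; rewrite e1 e2. Qed.

Lemma MVT0 (Q Q' : R -> R) t : (forall s, {for s, continuous Q}) ->
  0 < t -> (forall s, 0 < s -> s < t -> is_derive s 1 Q (Q' s)) ->
  exists c, [/\ 0 < c, c < t & Q t - Q 0 = t * Q' c].
Proof.
move=> cQ t0 dQ; have cf : {within `[0, t], continuous Q} by exact: continuous_subspaceT.
have [|c] := @MVT R Q Q' 0 t t0 _ cf.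
  by move=> x; rewrite in_itv/= => /andP[? ?]; exact: dQ.
by rewrite in_itv/= => /andP[c0 ct] ->; exists c; split => //; rewrite subr0 mulrC.
Qed.

Lemma const0 (Q : R -> R) t : (forall s, {for s, continuous Q}) ->
  0 <= t -> (forall s, 0 < s -> s < t -> is_derive s 1 Q 0) -> Q t = Q 0.
Proof.
move=> cQ; rewrite le_eqVlt => /predU1P[<-//|t0 dQ].
have [c [_ _ /eqP]] := MVT0 (Q' := fun=> 0) cQ t0 dQ.
by rewrite mulr0 subr_eq0 => /eqP.
Qed.

(** Only [U] is differentiated. For the energy [V] contains [Ku], which is continuous in L^2 but not
    known to be differentiable there. *)
Lemma isD_gen (Q : R -> R) U V f t : (forall t', L2 (U t')) -> L2 f ->
  L2diff U f t -> good V t ->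
  (forall s, Q (t + s) - Q t = pr (fun x => U (t + s) x - U t x) (V (t + s))) ->
  is_derive t 1 Q (pr f (V t)).
Proof.
move=> LU Lf dU gV E; apply: isD_lim => e e0.
have [d d0 H] := L2diff_pair LU Lf dU gV e0; exists d => // s /H.
by rewrite E.
Qed.

(** The identity [G_delta d^2/dx^2 = d/dx K], which puts the equation in the Hamiltonian form
    [u_t = d/dx (K u + u^3 / 3)]. *)
Lemma isD_Kht k x : X4 k ->
  is_derive x 1 (ht (fun xi => kap delta xi * k xi)) (ht (hA delta k) x).
Proof.
move=> Xk.
have [I1 _ _ _] := X4_mul Xk (@meas_kap R delta) (kap_leW delta0).
have [||I2 _ _ _] := @X4_mul R k (fun xi => xi * kap delta xi) (2 * pi) Xk.
- by apply: measM; [exact: meas_id|exact: meas_kap].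
- move=> xi; rewrite normrM; apply: (@le_trans _ _ (`|xi| * (2 * pi * `|xi|))).
    by apply: ler_wpM2l => //; exact: kap_le.
  rewrite mulrCA -expr2 real_normK ?num_real//; apply: ler_wpM2l.
    by rewrite mulr_ge0// pi_ge0.
  by rewrite /W lerDr.
- have [|_] := isD_ht x I1; first by apply: eq_Int I2 => xi; rewrite mulrA.
  congr is_derive; congr ht; apply/funext => xi.
  by rewrite /hD /hA kapN /om; ring.
Qed.

(** After Parseval, substituting [- xi] exchanges the two factors, and the oddness of [om] yields
    the sign. *)
Lemma hA_anti k l : X4 k -> X4 l ->
  pr (ht (hA delta k)) (ht l) = - pr (ht (hA delta l)) (ht k).
Proof.
move=> Xk Xl; have [Ak Lk _ _] := hA_spec delta0 Xk; have [Al Ll _ _] := hA_spec delta0 Xl.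
have [Ik Lk'] := X4_Int Xk; have [Il Ll'] := X4_Int Xl.
rewrite /pr (parseval Ak Lk Il Ll') (parseval Al Ll Ik Lk').
rewrite -(I_opp (L2M Ll Lk')) -(I_N (Int_opp (L2M Ll Lk'))).
by apply: eq_I => xi; rewrite /hA omN !opprK; ring.
Qed.

Lemma flow_pair k l t : nice k -> nice l -> 0 <= t ->
  pr (ht (flow delta k t)) (ht (flow delta l t)) = pr (ht k) (ht l).
Proof.
move=> nk nl t0; have ck := curve_flow delta0 nk; have cl := curve_flow delta0 nl.
have f0 p : flow delta p 0 = p by apply/funext => xi; exact: flow0.
rewrite -[in RHS](f0 k) -[in RHS](f0 l).
apply: (@const0 (fun t => pr (ht (flow delta k t)) (ht (flow delta l t)))) => //.
  by move=> s; exact: (good_pair_cont (good_cur s ck) (good_cur s cl)).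
move=> s _ _; have [Lk Bk _] := good_cur s ck; have [Ll Bl _] := good_cur s cl.
have [LAk _ _] := good_hA delta0 s ck; have [LAl _ _] := good_hA delta0 s cl.
apply: isD_eq (isD_pair Lk (LAk s) (LAl s) Bk (L2diff_flow delta0 s nk)
  (L2diff_flow delta0 s nl) (good_cur s cl)) _.
rewrite -/(pr _ _) -/(pr _ _) hA_anti; [exact: addNr| |].
  by apply: nice_X4; exact: nice_flow.
by apply: nice_X4; exact: nice_flow.
Qed.

(** Uniform in [t] because the rotation gives [|flow k t xi| <= |k xi| + |k (- xi)|], so transform
    and derivative are bounded by one L^1 norm; the weight [2 pi W] dominates both 1 and
    [2 pi |xi|]. *)
Lemma flow_sup k : nice k -> exists2 B, 0 <= B & forall t x,
  `|ht (flow delta k t) x| <= B /\ `|ht (hD (flow delta k t)) x| <= B.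
Proof.
move=> nk.
have [I1 _] := X4_Int (nice_X4 nk); have [I2 _] := X4_Int (nice_X4 (nice_opp nk)).
have [J1 _] := X4_Int (nice_X4W nk); have [J2 _] := X4_Int (nice_X4W (nice_opp nk)).
pose G xi := 2 * pi * (`|W xi * k xi| + `|W xi * k (- xi)|).
have IG : Int G by apply: IntZ; apply: IntD; exact: Int_norm.
have pi1 : 1 <= 2 * pi :> R by have := pi_ge2 R; lra.
have b1 t xi : `|flow delta k t xi| <= `|k xi| + `|k (- xi)|.
  rewrite /flow; apply: le_trans (ler_normB _ _) _; rewrite !normrM.
  by apply: lerD; apply: ler_piMl => //; [exact: norm_cos_le1|exact: norm_sin_le1].
have w0 xi : `|W xi| = W xi :> R by rewrite ger0_norm// ltW// W_gt0.
have H1 t : I (fun xi => `|flow delta k t xi|) <= I G.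
  have [If _] := X4_Int (nice_X4 (nice_flow delta t nk)).
  apply: le_I => //; first exact: Int_norm.
  move=> xi; apply: le_trans (b1 t xi) _; rewrite /G !normrM w0 -mulrDr mulrA.
  apply: ler_peMl; first exact: addr_ge0.
  by have := W_ge1 xi; nra.
have H2 t : I (fun xi => `|hD (flow delta k t) xi|) <= I G.
  have [If _ _ _] := hD_spec (nice_X4 (nice_flow delta t nk)).
  apply: le_I => //; first exact: Int_norm.
  move=> xi; rewrite /hD /G !normrM !normrN !normrM w0 -mulrDr mulrA normr_nat (ger0_norm (pi_ge0 R)).
  apply: ler_pM => //; first by rewrite mulr_ge0// mulr_ge0// pi_ge0.
    by rewrite ler_wpM2l ?W_norm// mulr_ge0// pi_ge0.
  by have := b1 t (- xi); rewrite opprK addrC.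
exists (2 * I G).
  by rewrite mulr_ge0// I_ge0// => xi; rewrite /G mulr_ge0// ?mulr_ge0 ?pi_ge0// addr_ge0.
move=> t x; split.
  have [If _] := X4_Int (nice_X4 (nice_flow delta t nk)).
  by apply: le_trans (ht_bound x If) _; apply: ler_wpM2l.
have [If _ _ _] := hD_spec (nice_X4 (nice_flow delta t nk)).
by apply: le_trans (ht_bound x If) _; apply: ler_wpM2l.
Qed.

Section solution.
Variable h : R -> R -> R.
Hypothesis Sd : solution_data delta T h.

Let u t := ht (h t).
Let ux t := ht (hD (h t)).
Let Au t := ht (hA delta (h t)).
Let Ku t := ht (fun xi => kap delta xi * h t xi).
Let f t x := Au t x + u t x ^+ 2 * ux t x.

Lemma curve_sol : curve h.
Proof. by have [? ? _] := Sd. Qed.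
Lemma good_u t : good u t. Proof. exact: good_cur curve_sol. Qed.
Lemma good_ux t : good ux t. Proof. exact: good_hD curve_sol. Qed.
Lemma good_Au t : good Au t. Proof. exact: (good_hA delta0 t curve_sol). Qed.
Lemma good_Ku t : good Ku t. Proof. exact: (good_hK delta0 t curve_sol). Qed.
Lemma good_f t : good f t.
Proof.
apply: eq_good (goodD (good_Au t) (goodM (goodM (good_u t) (good_u t)) (good_ux t))) => s x.
by rewrite /f expr2.
Qed.
Lemma good_u2 t : good (fun t x => u t x ^+ 2) t.
Proof. by apply: eq_good (goodM (good_u t) (good_u t)) => s x; rewrite expr2. Qed.
Lemma good_u3 t : good (fun t x => u t x ^+ 3) t.
Proof. by apply: eq_good (goodM (good_u t) (good_u2 t)) => s x; rewrite exprS. Qed.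

Lemma Xh t : X4 (h t). Proof. by have [] := curve_sol. Qed.
Lemma Lu t : L2 (u t). Proof. by have [] := good_u t. Qed.
Lemma Lux t : L2 (ux t). Proof. by have [] := good_ux t. Qed.
Lemma LAu t : L2 (Au t). Proof. by have [] := good_Au t. Qed.
Lemma LKu t : L2 (Ku t). Proof. by have [] := good_Ku t. Qed.
Lemma Lf t : L2 (f t). Proof. by have [] := good_f t. Qed.
Lemma Lu2 t : L2 (fun x => u t x ^+ 2). Proof. by have [] := good_u2 t. Qed.
Lemma Lu3 t : L2 (fun x => u t x ^+ 3). Proof. by have [] := good_u3 t. Qed.

Lemma cont_u t : continuous (u t).
Proof. by apply: cont_ht; exact: (X4_Int (Xh t)).1. Qed.
Lemma cont_ux t : continuous (ux t).
Proof. by apply: cont_ht; have [] := hD_spec (Xh t). Qed.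
Lemma cont_Au t : continuous (Au t).
Proof. by apply: cont_ht; have [] := hA_spec delta0 (Xh t). Qed.
Lemma cont_Ku t : continuous (Ku t).
Proof.
apply: cont_ht; by have [] := X4_mul (Xh t) (@meas_kap R delta) (kap_leW delta0).
Qed.
Lemma isD_u t x : is_derive x 1 (u t) (ux t x).
Proof. exact: isD_ht_X4 (Xh t). Qed.
Lemma isD_Ku t x : is_derive x 1 (Ku t) (Au t x).
Proof. exact: isD_Kht (Xh t). Qed.

Lemma L2diff_u t : 0 < t -> t < T -> L2diff u (f t) t.
Proof.
move=> t0 tT; have [L B _] := good_u t.
apply: (@L2diff_intro R u f t (Num.min t (T - t))) => //.
- by rewrite lt_min t0 subr_gt0.
- move=> t'; rewrite lt_min ltr_norml => /andP[/andP[h1 _]]; rewrite ltr_norml => /andP[_ h2] x.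
  by have [_ _ H] := Sd; apply: H; lra.
- exact: good_f.
Qed.

Definition mass t := pr (u t) (u t).
Definition quart t := pr (fun x => u t x ^+ 2) (fun x => u t x ^+ 2).
(** Twice the Hamiltonian; its variational derivative is [2 (K u + u^3 / 3)]. *)
Definition energy t := pr (u t) (Ku t) + 6^-1 * quart t.

Lemma mass_const t : 0 <= t <= T -> mass t = mass 0.
Proof.
move=> /andP[t0 tT]; apply: const0 => // [s|s s0 st].
  exact: good_pair_cont (good_u s) (good_u s).
have sT : s < T by exact: lt_le_trans st tT.
(* The increment of [u^2] from time [s] is the increment of [u] times the sum of both values of
   [u]. *)
have gV := goodD (good_u s) (good_cst s (Lu s) (M := _) _).
have [_ B _] := good_u s; have [M HM] := B s.
apply: isD_eq (isD_gen Lu (Lf s) (L2diff_u s0 sT) (gV M HM) _) _.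
  move=> r; rewrite /mass /pr -(IB (L2M (Lu _) (Lu _)) (L2M (Lu _) (Lu _))).
  by apply: eq_I => x; ring.
have A0 : pr (Au s) (u s) = 0.
  by have := hA_anti (Xh s) (Xh s); rewrite -/(u s) -/(Au s); lra.
have J1 := IntZ 2 (L2M (LAu s) (Lu s)).
have J2 : Int (fun x => u s x ^+ 3 * ux s x) by exact: L2M (Lu3 s) (Lux s).
rewrite /pr (eq_I (g := fun x => 2 * (Au s x * u s x) + 2 * (u s x ^+ 3 * ux s x))); last first.
  by move=> x; rewrite /f; ring.
rewrite (ID J1 (IntZ 2 J2)) (IZ 2 (L2M (LAu s) (Lu s))) -/(pr _ _) A0 mulr0 add0r (IZ 2 J2).
apply/eqP; rewrite mulf_eq0; apply/orP; right; apply/eqP.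
apply: (@I_derive_eq0 R (fun x => 4^-1 * u s x ^+ 4) (fun x => u s x ^+ 3 * ux s x)); last exact: J2.
- move=> x; have dux := isD_u s x; isD_tac; rewrite /=; by field.
- by apply: contM; [apply: contX; exact: cont_u|exact: cont_ux].
- apply: IntZ; apply: eq_Int (L2M (Lu2 s) (Lu2 s)) => x; ring.
Qed.

Lemma energy_const t : 0 <= t <= T -> energy t = energy 0.
Proof.
move=> /andP[t0 tT]; apply: const0 => // [s|s s0 st].
  apply: continuousD; first exact: good_pair_cont (good_u s) (good_Ku s).
  apply: continuousM; first exact: cst_continuous.
  exact: good_pair_cont (good_u2 s) (good_u2 s).
have sT : s < T by exact: lt_le_trans st tT.
have [_ Bu _] := good_u s; have [M HM] := Bu s.
have [_ Bk _] := good_Ku s; have [N HN] := Bk s.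
have gc := good_cst s (Lu s) HM.
(* [gV1] and [gV2] are the cofactors of the increment of [u]: [Ka + Kb] for the kinetic part, where
   the symmetry [ksym] removes the cross terms, and [(a^2 + b^2) (a + b)] for the quartic part. *)
have gV1 := goodD (good_Ku s) (good_cst s (LKu s) HN).
have gV2 := goodM (goodD (good_u2 s) (goodM gc gc)) (goodD (good_u s) gc).
have ksym r : pr (u s) (Ku r) = pr (u r) (Ku s).
  have [Is Ls _ _] := X4_mul (Xh s) (@meas_kap R delta) (kap_leW delta0).
  have [Ir Lr _ _] := X4_mul (Xh r) (@meas_kap R delta) (kap_leW delta0).
  have [Is' Ls'] := X4_Int (Xh s); have [Ir' Lr'] := X4_Int (Xh r).
  rewrite /pr (parseval Is' Ls' Ir Lr) (parseval Ir' Lr' Is Ls).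
  by apply: eq_I => xi; ring.
have d1 := isD_gen (Q := fun t => pr (u t) (Ku t)) Lu (Lf s) (L2diff_u s0 sT) gV1.
have d2 := isD_gen (Q := quart) Lu (Lf s) (L2diff_u s0 sT) gV2.
rewrite /energy.
have e1 r : pr (u (s + r)) (Ku (s + r)) - pr (u s) (Ku s) =
    pr (fun x => u (s + r) x - u s x) (fun x => Ku (s + r) x + Ku s x).
  transitivity ((pr (u (s + r)) (Ku (s + r)) - pr (u s) (Ku (s + r))) +
     (pr (u (s + r)) (Ku s) - pr (u s) (Ku s))); first by rewrite ksym addrA subrK.
  have L a b := L2M (Lu a) (LKu b).
  rewrite /pr -(IB (L _ _) (L _ _)) -(IB (L _ _) (L _ _)) -(ID (IntB (L _ _) (L _ _)) (IntB (L _ _) (L _ _))).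
  by apply: eq_I => x; ring.
have e2 r : quart (s + r) - quart s = pr (fun x => u (s + r) x - u s x)
    (fun x => (u (s + r) x ^+ 2 + u s x * u s x) * (u (s + r) x + u s x)).
  rewrite /quart /pr -(IB (L2M (Lu2 _) (Lu2 _)) (L2M (Lu2 _) (Lu2 _))).
  by apply: eq_I => x; ring.
have {}d1 := d1 e1; have {}d2 := d2 e2.
have c6 : is_derive s 1 (fun=> 6^-1 : R) 0 by exact: is_derive_cst.
apply: isD_eq (isD_add d1 (isD_mul c6 d2)) _.
have L3 : L2 (fun x => (u s x ^+ 2 + u s x * u s x) * (u s x + u s x)) by have [] := gV2.
have LP : L2 (fun x => Ku s x + 3^-1 * u s x ^+ 3) by apply: L2D; [exact: LKu|apply: L2Z; exact: Lu3].
rewrite mul0r add0r.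
transitivity (2 * I (fun x => f s x * (Ku s x + 3^-1 * u s x ^+ 3))).
  have [L1 _ _] := gV1.
  have J1 := L2M (Lf s) (L1 s); have J2 := L2M (Lf s) L3.
  rewrite /pr -(IZ _ J2) -(ID J1 (IntZ _ J2)) -(IZ 2 (L2M (Lf s) LP)).
  by apply: eq_I => x; field.
apply/eqP; rewrite mulf_eq0; apply/orP; right; apply/eqP.
(* [f] is the [x]-derivative of [Ku + u^3 / 3], so the integrand is the derivative of half of its
   square. *)
apply: (@I_derive_eq0 R (fun x => 2^-1 * (Ku s x + 3^-1 * u s x ^+ 3) ^+ 2)
  (fun x => f s x * (Ku s x + 3^-1 * u s x ^+ 3))).
- move=> x; have dux := isD_u s x; have dku := isD_Ku s x; isD_tac; rewrite /= /f; by field.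
- apply: contM.
    by apply: contD; [exact: cont_Au|apply: contM; [apply: contX; exact: cont_u|exact: cont_ux]].
  apply: contD; first exact: cont_Ku.
  by apply: contM; [exact: cont_cst|apply: contX; exact: cont_u].
- by apply: IntZ; exact: LP.2.
- exact: L2M (Lf s) LP.
Qed.

Definition Psi l t := ht (flow delta l t).
Definition Psix l t := ht (hD (flow delta l t)).

(** The linear contributions cancel by [hA_anti], and [u^2 u_x] against [Psi] is integrated by
    parts. The intermediate time [c] depends on the solution, so the integrand has to be controlled
    at every time. *)
Lemma Q_MVT l t : nice l -> 0 < t -> t <= T -> exists c, [/\ 0 < c, c < t &
  pr (u t) (Psi l t) - pr (u 0) (Psi l 0) = t * (- 3^-1 * pr (fun x => u c x ^+ 3) (Psix l c))].
Proof.
move=> nl t0 tT; have cl := curve_flow delta0 nl.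
apply: (@MVT0 (fun t => pr (u t) (Psi l t))
  (fun c => - 3^-1 * pr (fun x => u c x ^+ 3) (Psix l c))) => // [s|s s0 st].
  exact: good_pair_cont (good_u s) (good_cur s cl).
have sT : s < T by exact: lt_le_trans st tT.
have [_ Bu _] := good_u s; have [Ll Bl _] := good_cur s cl.
have [LAl _ _] := good_hA delta0 s cl; have [Lx Bx _] := good_hD s cl.
apply: isD_eq (isD_pair Lu (Lf s) (LAl s) Bu (L2diff_u s0 sT)
  (L2diff_flow delta0 s nl) (good_cur s cl)) _.
have Xl : X4 (flow delta l s) by apply: nice_X4; exact: nice_flow.
have L2ux : L2 (fun x => u s x ^+ 2 * ux s x).
  have [B3 H3] := Bu s.
  have [M HM] : exists M, forall x, `|u s x ^+ 2| <= M.
    by have [_ B2 _] := good_u2 s; exact: B2.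
  by have := L2Mb (Lu2 s).1 HM (Lux s); under eq_fun do rewrite mulrC.
have J1 := L2M (LAu s) (Ll s); have J2 := L2M L2ux (Ll s).
have J3 := L2M (LAl s) (Lu s); have J4 := L2M (Lu3 s) (Lx s).
have A0 := hA_anti (Xh s) Xl; rewrite /pr -/(u s) -/(Au s) in A0.
rewrite (eq_I (g := fun x => Au s x * ht (flow delta l s) x +
   u s x ^+ 2 * ux s x * ht (flow delta l s) x)); last by move=> x; rewrite /f; ring.
rewrite (ID J1 J2) A0.
have Z : I (fun x => u s x ^+ 2 * ux s x * ht (flow delta l s) x +
    3^-1 * (u s x ^+ 3 * Psix l s x)) = 0.
  apply: (@I_derive_eq0 R (fun x => 3^-1 * (u s x ^+ 3 * ht (flow delta l s) x))
    (fun x => u s x ^+ 2 * ux s x * ht (flow delta l s) x + 3^-1 * (u s x ^+ 3 * Psix l s x))).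
  - move=> x; have dux := isD_u s x; have dl := isD_ht_X4 x Xl.
    isD_tac; rewrite /Psix /=; by field.
  - have c1 := @cont_u s; have c2 := @cont_ux s.
    have c3 : continuous (ht (flow delta l s)) by apply: cont_ht; exact: (X4_Int Xl).1.
    have c4 : continuous (Psix l s) by apply: cont_ht; have [] := hD_spec Xl.
    apply: contD; first by apply: contM; [apply: contM; [apply: contX; exact: c1|exact: c2]|exact: c3].
    apply: contM; first exact: cont_cst.
    by apply: contM; [apply: contX; exact: c1|exact: c4].
  - by apply: IntZ; exact: L2M (Lu3 s) (Ll s).
  - by apply: (IntD J2); exact: (IntZ _ J4).
rewrite (ID J2 (IntZ _ J4)) (IZ _ J4) in Z; rewrite /pr.
by move: Z; move: (I _) (I _) (I _) => a b c Z; lra.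
Qed.

End solution.
End conservation.

(** * The cubic term *)

Ltac pos := repeat first [exact: sqr_ge0 | assumption | apply: mulr_ge0 | apply: addr_ge0 | exact: ler0n | by apply: ltW].

Section estimates.
Variable R : realType.
Notation mu := (@lebesgue_measure R).
Implicit Types (f g m k l : R -> R) (t s x y z xi d e C M B : R).
Variables delta T : R.
Hypothesis delta0 : 0 < delta.
Hypothesis T0 : 0 < T.

Lemma le_sqr1 (z : R) : 0 <= z -> z <= (z + 1) ^+ 2.
Proof. by move=> z0; nra. Qed.

Lemma pr_ge0 f : 0 <= pr f f.
Proof. by apply: I_ge0 => x; rewrite -expr2 sqr_ge0. Qed.

Lemma pr_sqr f : pr f f = I (fun x => f x ^+ 2).
Proof. by apply: eq_I => x; rewrite expr2. Qed.

Lemma cubic_pair f g B : L2 f -> L2 (fun x => f x ^+ 2) -> meas g -> (forall x, `|g x| <= B) ->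
  pr (fun x => f x ^+ 3) g ^+ 2 <= B ^+ 2 * (pr f f * pr (fun x => f x ^+ 2) (fun x => f x ^+ 2)).
Proof.
move=> Lf Lf2 mg gB.
have Lgf : L2 (fun x => g x * f x ^+ 2).
  by have := L2Mb mg gB Lf2; under eq_fun do rewrite mulrC.
rewrite /pr (eq_I (g := fun x => f x * (g x * f x ^+ 2))); last by move=> x; ring.
apply: le_trans (CS Lf Lgf) _.
rewrite mulrCA (eq_I (f := fun x => f x * f x) (g := fun x => f x ^+ 2)); last by move=> x; ring.
apply: ler_wpM2l; first by apply: I_ge0 => x; exact: sqr_ge0.
apply: le_trans (I_sqrM_le Lf2 mg gB) _.
by rewrite le_eqVlt; apply/orP; left; apply/eqP; congr (_ * _); apply: eq_I => x; ring.
Qed.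

(** Here [a], [b], [p] are [(u, Ku)], [(u, Kv)] and the conserved [(v, Kv)]; [q] and [r] are the
    quartic integrals of [u] and of the unscaled datum. *)
Lemma energy_algebra (a b q r p e : R) :
  a + 6^-1 * q = e ^+ 2 * p + 6^-1 * (e ^+ 4 * r) -> 0 <= a - 2 * e * b + e ^+ 2 * p ->
  q <= e ^+ 4 * r - 12 * e * (b - e * p).
Proof.
rewrite mulrBr (_ : 12 * e * (e * p) = 12 * (e ^+ 2 * p)); last by ring.
rewrite -(mulrA 2) -(mulrA 12).
move: (e ^+ 2 * p) (e ^+ 4 * r) (e * b) => x y z E P; lra.
Qed.

(** An absorption argument: [D] is bounded in terms of [M] itself, but only with power 1/2, so the
    inequality of means gives [M / 2] plus a term of order [e^4]. *)
Lemma quart_algebra (M q m e D S B : R) : M <= e ^+ 4 * q - 12 * e * D ->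
  D ^+ 2 <= S ^+ 2 * (B ^+ 2 * (e ^+ 2 * m * M)) / 9 -> 0 <= m -> 0 <= M ->
  M <= e ^+ 4 * (2 * q + 16 * (S ^+ 2 * B ^+ 2 * m)).
Proof.
move=> H1 H2 m0 M0.
set Z := e ^+ 4 * (S ^+ 2 * B ^+ 2 * m).
have Z0 : 0 <= Z.
  rewrite /Z (_ : e ^+ 4 = (e ^+ 2) ^+ 2); last by ring.
  apply: mulr_ge0; [exact: sqr_ge0|apply: mulr_ge0 => //; apply: mulr_ge0; exact: sqr_ge0].
have H3 : (- (12 * e * D)) ^+ 2 <= 16 * Z * M.
  rewrite [leLHS](_ : _ = (144 * e ^+ 2) * D ^+ 2); last by ring.
  apply: le_trans (ler_wpM2l _ H2) _; first by rewrite mulr_ge0// sqr_ge0.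
  by rewrite le_eqVlt; apply/orP; left; apply/eqP; rewrite /Z; field.
rewrite [leRHS](_ : _ = 2 * (e ^+ 4 * q) + 16 * Z); last by rewrite /Z; ring.
set Y := - (12 * e * D) in H1 H3.
set X := e ^+ 4 * q in H1 *.
have {}H1 : M <= X + Y by rewrite /Y.
have : Y <= M / 2 + 8 * Z.
  have [Y0|Y0] := leP Y 0; first by apply: le_trans Y0 _; lra.
  have p0 : 0 <= M / 2 + 8 * Z by lra.
  have Y0' := ltW Y0.
  rewrite -(ler_pXn2r (n := 2))// ?nnegrE//.
  by apply: le_trans H3 _; have := sqr_ge0 (M / 2 - 8 * Z); nra.
lra.
Qed.

Lemma diff_algebra (X D m C e S B : R) : X = - 2 * e * D ->
  D ^+ 2 <= S ^+ 2 * (B ^+ 2 * (e ^+ 2 * m * (e ^+ 4 * C))) / 9 ->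
  0 <= m -> 0 <= C -> 0 <= S -> 0 <= B -> X <= e ^+ 4 * (S * B * (m + C)).
Proof.
move=> -> H2 m0 C0 S0 B0.
have e4 : 0 <= e ^+ 4 by rewrite (_ : e ^+ 4 = (e ^+ 2) ^+ 2); [exact: sqr_ge0|ring].
have p0 : 0 <= e ^+ 4 * (S * B * (m + C)).
  by apply: mulr_ge0 => //; apply: mulr_ge0; [exact: mulr_ge0|exact: addr_ge0].
have [Y0|Y0] := leP (- 2 * e * D) 0; first exact: le_trans Y0 _.
have Y0' := ltW Y0.
rewrite -(ler_pXn2r (n := 2))// ?nnegrE//.
rewrite [leLHS](_ : _ = 4 * e ^+ 2 * D ^+ 2); last by ring.
apply: le_trans (ler_wpM2l _ H2) _; first by rewrite mulr_ge0// sqr_ge0.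
rewrite [leLHS](_ : _ = (e ^+ 4 * S * B) ^+ 2 * (4 / 9 * (m * C))); last by field.
rewrite [leRHS](_ : _ = (e ^+ 4 * S * B) ^+ 2 * (m + C) ^+ 2); last by ring.
apply: ler_wpM2l; first exact: sqr_ge0.
by have := mulr_ge0 m0 C0; have := sqr_ge0 (m - C); nra.
Qed.

Lemma sum_algebra (p q r e B C : R) : q <= e * C -> e * p <= e * (B ^+ 2 * r) ->
  5 * (q + e * p) <= e * (5 * (C + B ^+ 2 * r)).
Proof.
move: (B ^+ 2 * r) => s; rewrite [e * (5 * _)](_ : _ = 5 * (e * C + e * s)); last by ring.
by move: (e * C) (e * s) (e * p) => x y z h1 h2; apply: ler_wpM2l => //; exact: lerD.
Qed.

Variable k0 : R -> R.
Hypothesis nk : nice k0.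

Notation v t := (ht (flow delta k0 t)).
Notation Kv t := (ht (flow delta (fun xi => kap delta xi * k0 xi) t)).

Lemma v_L2 k t : nice k -> L2 (ht (flow delta k t)).
Proof. by move=> nk'; have [I1 L1] := X4_Int (nice_X4 (nice_flow delta t nk')); exact: L2_ht. Qed.

Lemma vx_L2 k t : nice k -> L2 (ht (hD (flow delta k t))).
Proof.
by move=> nk'; have [I1 L1 _ _] := hD_spec (nice_X4 (nice_flow delta t nk')); exact: L2_ht.
Qed.

Lemma v_L2sq k t : nice k -> L2 (fun x => ht (flow delta k t) x ^+ 2).
Proof.
move=> nk'; have [B _ HB] := flow_sup delta nk'; have Lv := v_L2 t nk'.
have := L2Mb Lv.1 (fun x => (HB t x).1) Lv.
by congr L2; apply/funext => x; rewrite expr2.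
Qed.

Section one_solution.
Variables (eps : R) (h : R -> R -> R).
Hypothesis Sd : solution_data delta T h.
Hypothesis H0 : forall x, ht (h 0) x = eps * ht k0 x.

Notation u t := (ht (h t)).
Notation Ku t := (ht (fun xi => kap delta xi * h t xi)).

(** [h 0] is known only through its transform; injectivity of [ht] identifies it almost everywhere
    with [eps * k0] before the multiplier is applied. *)
Lemma init_kap x : Ku 0 x = eps * ht (fun xi => kap delta xi * k0 xi) x.
Proof.
have [Ih Lh] := X4_Int (Xh Sd 0); have [Ik Lk] := X4_Int (nice_X4 nk).
have [JK _] := X4_Int (nice_X4 (nice_kap delta0 nk)).
have [Jh _ _ _] := X4_mul (Xh Sd 0) (@meas_kap R delta) (kap_leW delta0).
have E : {ae mu, forall xi, h 0 xi - eps * k0 xi = 0}.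
  apply: ht_inj; [exact: IntB Ih (IntZ _ Ik)|exact: L2B Lh (L2Z _ Lk)|].
  by move=> y; rewrite htB//; [rewrite htZ// H0 subrr|exact: IntZ].
rewrite -htZ//; apply: ht_ae => //; first exact: Int_meas (IntZ eps JK).
by apply: aeS E => xi /subr0_eq ->; rewrite mulrCA.
Qed.

Lemma pr_v t : 0 <= t -> pr (v t) (v t) = pr (ht k0) (ht k0).
Proof. exact: flow_pair. Qed.

Lemma mass_sol t : 0 <= t <= T -> pr (u t) (u t) = eps ^+ 2 * pr (ht k0) (ht k0).
Proof.
move=> tT; have := mass_const delta0 Sd tT; rewrite /mass => ->.
have [Ik Lk] := X4_Int (nice_X4 nk); have L := L2_ht Ik Lk.
rewrite /pr -(IZ _ (L2M L L)); apply: eq_I => x; rewrite H0; ring.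
Qed.

Lemma Q_bound l t B C : nice l -> (forall t x, `|ht (hD (flow delta l t)) x| <= B) ->
  (forall s, 0 <= s <= T -> quart h s <= C) -> 0 <= t <= T ->
  (pr (u t) (Psi delta l t) - pr (u 0) (Psi delta l 0)) ^+ 2 <=
  T ^+ 2 * (B ^+ 2 * (eps ^+ 2 * pr (ht k0) (ht k0) * C)) / 9.
Proof.
move=> nl lB qC /andP[t0 tT].
have C0 : 0 <= C.
  by apply: le_trans (qC 0 _); [exact: pr_ge0|rewrite lexx/= ltW].
have m0 := pr_ge0 (ht k0).
have [->|tn0] := eqVneq t 0.
  rewrite subrr expr0n/= divr_ge0// mulr_ge0 ?sqr_ge0// mulr_ge0 ?sqr_ge0// mulr_ge0// mulr_ge0 ?sqr_ge0//.
have {t0}t0 : 0 < t by rewrite lt_neqAle eq_sym tn0.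
have [c [c0 ct ->]] := Q_MVT delta0 Sd nl t0 tT.
have cT : 0 <= c <= T by rewrite ltW//= (le_trans (ltW ct)).
have := cubic_pair (Lu Sd c) (Lu2 Sd c) (vx_L2 c nl).1 (lB c).
rewrite -/(quart h c) (mass_sol cT) -/(Psix delta l c).
have := qC c cT; move: (quart h c) (pr _ (Psix _ _ _)) => q p Hq Hp.
have {}Hp : p ^+ 2 <= B ^+ 2 * (eps ^+ 2 * pr (ht k0) (ht k0) * C).
  apply: le_trans Hp _; apply: ler_wpM2l; first exact: sqr_ge0.
  by apply: ler_wpM2l => //; rewrite mulr_ge0// sqr_ge0.
rewrite [leLHS](_ : _ = t ^+ 2 * p ^+ 2 / 9); last by field.
apply: ler_wpM2r; first by rewrite invr_ge0.
by apply: ler_pM => //; rewrite ?sqr_ge0// lerXn2r// nnegrE ltW.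
Qed.

(* Positivity of the kinetic energy of [u - eps v], expanded with the conservation of energy. *)
Lemma quart_le t : 0 <= t <= T ->
  quart h t <= eps ^+ 4 * pr (fun x => ht k0 x ^+ 2) (fun x => ht k0 x ^+ 2)
    - 12 * eps * (pr (u t) (Kv t) - pr (u 0) (Kv 0)).
Proof.
move=> tT; have t0 : 0 <= t by case/andP: tT.
have nK := nice_kap delta0 nk.
have := energy_const delta0 Sd tT; rewrite /energy.
have [Ih Lh] := X4_Int (Xh Sd t).
have [JK JL _ _] := X4_mul (Xh Sd t) (@meas_kap R delta) (kap_leW delta0).
have [If Lf] := X4_Int (nice_X4 (nice_flow delta t nk)).
have [Ig Lg] := X4_Int (nice_X4 (nice_flow delta t nK)).
have Lu' := Lu Sd t; have LKu' := LKu delta0 Sd t.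
have Lv := v_L2 t nk; have LKv := v_L2 t nK.
have vK := flow_pair delta0 nk nK t0.
have sym : pr (v t) (Ku t) = pr (u t) (Kv t).
  rewrite /pr (parseval If Lf JK JL) (parseval Ih Lh Ig Lg).
  by apply: eq_I => xi; rewrite flow_kap; ring.
have pos : 0 <= pr (fun x => u t x - eps * v t x) (fun x => Ku t x - eps * Kv t x).
  have IB1 := IntB Ih (IntZ eps If); have LB1 := L2B Lh (L2Z eps Lf).
  have IB2 := IntB JK (IntZ eps Ig); have LB2 := L2B JL (L2Z eps Lg).
  rewrite (@eq_pr R _ _ (ht (fun xi => h t xi - eps * flow delta k0 t xi))
    (ht (fun xi => kap delta xi * h t xi - eps * flow delta (fun xi => kap delta xi * k0 xi) t xi))).
  - rewrite /pr (parseval IB1 LB1 IB2 LB2); apply: I_ge0 => xi; rewrite flow_kap.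
    rewrite [X in 0 <= X](_ : _ = kap delta xi * (h t xi - eps * flow delta k0 t xi) ^+ 2); last by ring.
    by apply: mulr_ge0; [exact: kap_ge0|exact: sqr_ge0].
  - by move=> x; rewrite (htB x Ih (IntZ eps If)) (htZ eps x If).
  - by move=> x; rewrite (htB x JK (IntZ eps Ig)) (htZ eps x Ig).
have {pos} : 0 <= pr (u t) (Ku t) - 2 * eps * pr (u t) (Kv t) + eps ^+ 2 * pr (v t) (Kv t).
  suff <- : pr (fun x => u t x - eps * v t x) (fun x => Ku t x - eps * Kv t x) =
    pr (u t) (Ku t) - 2 * eps * pr (u t) (Kv t) + eps ^+ 2 * pr (v t) (Kv t) by [].
  rewrite (_ : 2 * eps * pr (u t) (Kv t) = eps * pr (u t) (Kv t) + eps * pr (v t) (Ku t)); last first.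
    by rewrite sym; ring.
  have J1 := L2M Lu' LKu'; have J2 := L2M Lu' LKv; have J3 := L2M Lv LKu'; have J4 := L2M Lv LKv.
  rewrite /pr -(IZ eps J2) -(IZ eps J3) -(ID (IntZ eps J2) (IntZ eps J3)).
  rewrite -(IB J1 (IntD (IntZ eps J2) (IntZ eps J3))) -(IZ _ J4).
  rewrite -(ID (IntB J1 (IntD (IntZ eps J2) (IntZ eps J3))) (IntZ _ J4)).
  by apply: eq_I => x; ring.
rewrite vK.
have [Ik Lk] := X4_Int (nice_X4 nk); have Lk0 := L2_ht Ik Lk.
have [IkK LkK] := X4_Int (nice_X4 nK); have LkK0 := L2_ht IkK LkK.
have fl k : flow delta k 0 = k by apply/funext => xi; exact: flow0.
have i1 : pr (u 0) (Ku 0) = eps ^+ 2 * pr (ht k0) (ht (fun xi => kap delta xi * k0 xi)).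
  rewrite /pr -(IZ _ (L2M Lk0 LkK0)); apply: eq_I => x; rewrite H0 init_kap; ring.
have i2 : pr (u 0) (Kv 0) = eps * pr (ht k0) (ht (fun xi => kap delta xi * k0 xi)).
  rewrite fl /pr -(IZ _ (L2M Lk0 LkK0)); apply: eq_I => x; rewrite H0; ring.
have Lk02 : L2 (fun x => ht k0 x ^+ 2) by have := v_L2sq 0 nk; rewrite fl.
have i3 : quart h 0 = eps ^+ 4 * pr (fun x => ht k0 x ^+ 2) (fun x => ht k0 x ^+ 2).
  rewrite /quart /pr -(IZ _ (L2M Lk02 Lk02)); apply: eq_I => x; rewrite H0; ring.
rewrite i1 i2 i3; move: (pr _ (ht (fun xi => kap delta xi * k0 xi))) => p.
by move=> P E; exact: energy_algebra E P.
Qed.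

(** [quart_le] is used at a maximum point of [quart] on [[0, T]], so that the quantity to be bounded
    is the one entering the bound of its own error term. *)
Lemma quart_bound B : 0 <= B ->
  (forall t x, `|ht (hD (flow delta (fun xi => kap delta xi * k0 xi) t)) x| <= B) ->
  forall t, 0 <= t <= T -> quart h t <= eps ^+ 4 *
    (2 * pr (fun x => ht k0 x ^+ 2) (fun x => ht k0 x ^+ 2) +
     16 * (T ^+ 2 * B ^+ 2 * pr (ht k0) (ht k0))).
Proof.
move=> B0 HB; have nK := nice_kap delta0 nk.
have cq t : {for t, continuous (quart h)}.
  exact: good_pair_cont (good_u2 Sd t) (good_u2 Sd t).
have [c cI cM] := EVT_max (ltW T0) (continuous_subspaceT cq).
have cT : 0 <= c <= T by move: cI; rewrite in_itv.
have {}cM s : 0 <= s <= T -> quart h s <= quart h c.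
  by move=> sT; apply: cM; rewrite in_itv.
move=> t tT; apply: le_trans (cM t tT) _.
have H1 := quart_le cT; have H2 := Q_bound nK HB cM cT.
have m0 := pr_ge0 (ht k0); have q0 := pr_ge0 (fun x => ht k0 x ^+ 2).
have M0 : 0 <= quart h c by exact: pr_ge0.
by move: H1 H2; rewrite /Psi => H1 H2; exact: quart_algebra H1 H2 m0 M0.
Qed.

(** Both masses are conserved, so the square expands to [- 2 eps] times the increment of [(u, v)].
    That increment is cubic in [u], of order [eps * eps^2] by mass and quartic bounds. *)
Lemma diff_bound B C : 0 <= B -> 0 <= C ->
  (forall t x, `|ht (hD (flow delta k0 t)) x| <= B) ->
  (forall t, 0 <= t <= T -> quart h t <= eps ^+ 4 * C) ->
  forall t, 0 <= t <= T -> pr (fun x => u t x - eps * v t x) (fun x => u t x - eps * v t x) <=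
    eps ^+ 4 * (T * B * (pr (ht k0) (ht k0) + C)).
Proof.
move=> B0 C0 HB HC t tT; have t0 : 0 <= t by case/andP: tT.
have Lu' := Lu Sd t; have Lv := v_L2 t nk.
have E : pr (fun x => u t x - eps * v t x) (fun x => u t x - eps * v t x) =
    - 2 * eps * (pr (u t) (Psi delta k0 t) - pr (u 0) (Psi delta k0 0)).
  have fl : flow delta k0 0 = k0 by apply/funext => xi; exact: flow0.
  have [Ik Lk] := X4_Int (nice_X4 nk); have Lk0 := L2_ht Ik Lk.
  have i1 : pr (u 0) (Psi delta k0 0) = eps * pr (ht k0) (ht k0).
    rewrite /Psi fl /pr -(IZ _ (L2M Lk0 Lk0)); apply: eq_I => x; rewrite H0; ring.
  have J1 := L2M Lu' Lu'; have J2 := L2M Lu' Lv; have J3 := L2M Lv Lv.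
  rewrite i1 {1}/pr (eq_I (g := fun x => u t x * u t x - (2 * eps) * (u t x * v t x)
    + eps ^+ 2 * (v t x * v t x))); last by move=> x; ring.
  rewrite (ID (IntB J1 (IntZ _ J2)) (IntZ _ J3)) (IB J1 (IntZ _ J2)) (IZ _ J2) (IZ _ J3).
  rewrite -/(pr (u t) (u t)) -/(pr (u t) (v t)) -/(pr (v t) (v t)) (mass_sol tT) (pr_v t0) /Psi.
  move: (pr (ht k0) (ht k0)) (pr (u t) (v t)) => p q; ring.
have H2 := Q_bound nk HB HC tT.
have m0 := pr_ge0 (ht k0).
exact: diff_algebra E H2 m0 C0 (ltW T0) B0.
Qed.

(** [u^3 - eps^3 v^3 = w z] with [w = u - eps v] and [z] quadratic; the squared L^2 norms of both
    factors are of order [eps^4]. *)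
Lemma cubic_bound l B B' C (D : R) t : nice l -> 0 <= B -> 0 <= C -> 0 <= D ->
  (forall t x, `|ht (hD (flow delta l t)) x| <= B) ->
  (forall t x, `|v t x| <= B') ->
  quart h t <= eps ^+ 4 * C -> 0 <= t ->
  pr (fun x => u t x - eps * v t x) (fun x => u t x - eps * v t x) <= eps ^+ 4 * D ->
  (pr (fun x => u t x ^+ 3) (Psix delta l t) -
   eps ^+ 3 * pr (fun x => v t x ^+ 3) (Psix delta l t)) ^+ 2 <=
  (eps ^+ 4) ^+ 2 * (D * (B ^+ 2 * (5 * (C + B' ^+ 2 * pr (ht k0) (ht k0))))).
Proof.
move=> nl B0 C0 D0 HB HB' HC t0 HD.
have Lu' := Lu Sd t; have Lv := v_L2 t nk; have Ll := vx_L2 t nl.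
have Lu2' := Lu2 Sd t; have Lv2 := v_L2sq t nk.
have Lu3' := Lu3 Sd t.
have Lv3 : L2 (fun x => v t x ^+ 3).
  have := L2Mb Lv.1 (HB' t) Lv2; congr L2; apply/funext => x; rewrite [RHS]exprS mulrC; ring.
have Luv : L2 (fun x => u t x * v t x) by exact: L2Mb Lv.1 (HB' t) Lu'.
pose w x := u t x - eps * v t x.
pose z x := u t x ^+ 2 + (eps * (u t x * v t x) + eps ^+ 2 * v t x ^+ 2).
have Lw : L2 w by apply: L2B => //; exact: L2Z.
have Lz : L2 z by apply: L2D => //; apply: L2D; exact: L2Z.
have Lpz : L2 (fun x => Psix delta l t x * z x).
  by have := L2Mb Ll.1 (HB t) Lz; under eq_fun do rewrite mulrC.
have J1 := L2M Lu3' Ll; have J2 := L2M Lv3 Ll.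
rewrite /pr -(IZ _ J2) -(IB J1 (IntZ _ J2)).
rewrite (eq_I (g := fun x => w x * (Psix delta l t x * z x))); last first.
  by move=> x; rewrite /w /z /Psix; ring.
apply: le_trans (CS Lw Lpz) _.
rewrite expr2 -[leRHS]mulrA [leRHS](_ : _ = (eps ^+ 4 * D) * (B ^+ 2 *
   (eps ^+ 4 * (5 * (C + B' ^+ 2 * I (fun x => ht k0 x * ht k0 x)))))); last by ring.
apply: ler_pM => //.
- by apply: I_ge0 => x; exact: sqr_ge0.
- by apply: I_ge0 => x; exact: sqr_ge0.
rewrite /Psix; apply: le_trans (I_sqrM_le Lz Ll.1 (HB t)) _.
apply: ler_wpM2l; first exact: sqr_ge0.
have Kv4 : pr (fun x => v t x ^+ 2) (fun x => v t x ^+ 2) <= B' ^+ 2 * pr (ht k0) (ht k0).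
  rewrite -(pr_v t0) !pr_sqr; apply: le_trans (I_sqrM_le Lv Lv.1 (HB' t)).
  by rewrite le_eqVlt; apply/orP; left; apply/eqP/eq_I => x; rewrite -expr2.
have K1 := L2M Lu2' Lu2'; have K2 := L2M Lv2 Lv2.
(* The quadratic form [a^2 + a c + c^2] is at most [3/2 (a^2 + c^2)], and squaring costs
   [2 (3/2)^2 = 9/2], which is below 5. *)
apply: (@le_trans _ _ (I (fun x => 5 * (u t x ^+ 2 * u t x ^+ 2 + eps ^+ 4 * (v t x ^+ 2 * v t x ^+ 2))))).
  apply: le_I; [exact: Lz.2|exact: IntZ (IntD K1 (IntZ _ K2))|move=> x; rewrite /z].
  move: (u t x) (v t x) => a b; set c := eps * b.
  rewrite (_ : _ + (_ + _) = a ^+ 2 + a * c + c ^+ 2); last by rewrite /c; ring.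
  rewrite (_ : eps ^+ 4 * _ = c ^+ 2 * c ^+ 2); last by rewrite /c; ring.
  have h1 : `|a ^+ 2 + a * c + c ^+ 2| <= 3 / 2 * (a ^+ 2 + c ^+ 2).
    by rewrite ler_norml; apply/andP; split; have := sqr_ge0 (a - c); have := sqr_ge0 (a + c); nra.
  rewrite -(real_normK (num_real (_ + _))).
  apply: (@le_trans _ _ ((3 / 2 * (a ^+ 2 + c ^+ 2)) ^+ 2)).
    by rewrite lerXn2r// nnegrE; have := sqr_ge0 a; have := sqr_ge0 c; lra.
  have := sqr_ge0 (a ^+ 2 - c ^+ 2); move: (a ^+ 2) (c ^+ 2) => p q; nra.
rewrite (IZ _ (IntD K1 (IntZ _ K2))) (ID K1 (IntZ _ K2)) (IZ _ K2) -!/(pr _ _).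
have e4 : 0 <= eps ^+ 4 by rewrite (_ : eps ^+ 4 = (eps ^+ 2) ^+ 2); [exact: sqr_ge0|ring].
exact: sum_algebra HC (ler_wpM2l e4 Kv4).
Qed.

End one_solution.

Lemma cubic_asymptotics l : nice l -> exists2 C, 0 <= C &
  forall eps h, solution_data delta T h -> (forall x, ht (h 0) x = eps * ht k0 x) ->
  forall t, 0 <= t <= T ->
  `|pr (fun x => ht (h t) x ^+ 3) (Psix delta l t) -
    eps ^+ 3 * pr (fun x => v t x ^+ 3) (Psix delta l t)| <= C * eps ^+ 4.
Proof.
move=> nl; have nK := nice_kap delta0 nk.
have [B1 B10 HB1] := flow_sup delta nK; have [B2 B20 HB2] := flow_sup delta nk.
have [B3 B30 HB3] := flow_sup delta nl.
have m0 := pr_ge0 (ht k0); have q0 := pr_ge0 (fun x => ht k0 x ^+ 2).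
pose C1 := 2 * pr (fun x => ht k0 x ^+ 2) (fun x => ht k0 x ^+ 2) +
     16 * (T ^+ 2 * B1 ^+ 2 * pr (ht k0) (ht k0)).
have C10 : 0 <= C1.
  by rewrite /C1; pos.
pose D := T * B2 * (pr (ht k0) (ht k0) + C1).
have D0 : 0 <= D by rewrite /D; pos.
pose E := D * (B3 ^+ 2 * (5 * (C1 + B2 ^+ 2 * pr (ht k0) (ht k0)))).
have E0 : 0 <= E by rewrite /E; pos.
(* [E] bounds a square; [E + 1] stands in for its square root, by [le_sqr1]. *)
exists (E + 1); first by rewrite addr_ge0.
move=> eps h Sd H0 t tT; have t0 : 0 <= t by case/andP: tT.
have e4 : 0 <= eps ^+ 4 by rewrite (_ : eps ^+ 4 = (eps ^+ 2) ^+ 2); [exact: sqr_ge0|ring].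
have Q := quart_bound Sd H0 B10 (fun t x => (HB1 t x).2).
have W := diff_bound Sd H0 B20 C10 (fun t x => (HB2 t x).2) Q tT.
have := cubic_bound Sd nl B30 C10 D0 (fun t x => (HB3 t x).2) (fun t x => (HB2 t x).1) (Q t tT) t0 W.
rewrite -/E => H.
have g0 : 0 <= (E + 1) * eps ^+ 4 by rewrite mulr_ge0// addr_ge0.
rewrite -(ler_pXn2r (n := 2))// ?nnegrE// real_normK ?num_real//.
apply: le_trans H _; rewrite [leRHS](_ : _ = (eps ^+ 4) ^+ 2 * (E + 1) ^+ 2); last by ring.
apply: ler_wpM2l; first exact: sqr_ge0.
exact: le_sqr1.
Qed.

End estimates.

(** * Wave packets *)

Section packets.
Variable R : realType.
Notation mu := (@lebesgue_measure R).
Implicit Types (f g m k l A B : R -> R) (t s x y z xi d e C M : R).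
Variable delta : R.
Hypothesis delta0 : 0 < delta.

(* [ht (symm A B)] is the wave [\int A cos + B sin]. *)
Definition symm A B xi : R := ((A xi + A (- xi)) + (B xi - B (- xi))) / 2.

Lemma Int_symm A B : Int A -> Int B -> Int (symm A B).
Proof.
move=> IA IB; have := IntZ 2^-1 (IntD (IntD IA (Int_opp IA)) (IntB IB (Int_opp IB))).
by apply: eq_Int => xi; rewrite /symm mulrC.
Qed.

Lemma I_symm2 f g : Int f -> Int g -> (forall x, f x + f (- x) = g x + g (- x)) -> I f = I g.
Proof.
move=> If Ig E; have : I (fun x => f x + f (- x)) = I (fun x => g x + g (- x)) by exact: eq_I.
rewrite (ID If (Int_opp If)) (ID Ig (Int_opp Ig)) !I_opp//.
by move: (I f) (I g) => a b; lra.
Qed.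

Lemma Int_cosb A f : Int A -> meas f -> Int (fun xi => A xi * cos (f xi)).
Proof. by move=> IA mf; apply: IntMb (meas_cosf mf) (fun x => norm_cos_le1 _) IA. Qed.
Lemma Int_sinb A f : Int A -> meas f -> Int (fun xi => A xi * sin (f xi)).
Proof. by move=> IA mf; apply: IntMb (meas_sinf mf) (fun x => norm_sin_le1 _) IA. Qed.

Lemma meas_phase x t : meas (fun xi => 2 * pi * xi * x + t * om delta xi).
Proof.
apply: measD; last exact: meas_tom.
by apply: measM; [exact: meas_lin|exact: meas_cst].
Qed.

Lemma ht_symm A B t x : Int A -> Int B -> ht (flow delta (symm A B) t) x =
  I (fun xi => A xi * cos (2 * pi * xi * x + t * om delta xi) +
               B xi * sin (2 * pi * xi * x + t * om delta xi)).
Proof.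
move=> IA IB; have Is := Int_symm IA IB; have mt := @meas_tom R delta t.
have If : Int (flow delta (symm A B) t).
  have := IntB (Int_cosb Is mt) (Int_sinb (Int_opp Is) mt).
  by apply: eq_Int => xi; rewrite /flow mulrC (mulrC (sin _)).
apply: I_symm2; first exact: Int_cas.
  by apply: IntD; [apply: Int_cosb|apply: Int_sinb] => //; exact: meas_phase.
move=> xi; rewrite flowN /flow /symm !opprK omN.
rewrite !(mulrN, mulNr) -opprD cosN sinN !cosD !sinD /cas cosN sinN.
by move: (A xi) (A (- xi)) (B xi) (B (- xi)) (cos _) (sin _) (cos _) (sin _) => *; field.
Qed.

Lemma hD_flow_symm A B t : hD (flow delta (symm A B) t) =
  flow delta (symm (fun xi => 2 * pi * xi * B xi) (fun xi => - (2 * pi * xi * A xi))) t.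
Proof.
apply/funext => xi; rewrite /hD flowN /flow /symm !opprK.
move: (cos _) (sin _) => C S; move: (pi : R) => q.
by move: (A xi) (A (- xi)) (B xi) (B (- xi)) => a a' b b'; field.
Qed.

Lemma sqr_csym z : 0 < z -> z ^+ 2 * (coth z - 1) <= 2.
Proof.
move=> z0; rewrite coth_sub1//.
have e1 : 1 + z <= expR z by exact: expR_ge1Dx.
have e2 : z ^+ 2 <= expR (2 * z) - 1.
  rewrite expRM_natl; apply: (@le_trans _ _ ((1 + z) ^+ 2 - 1)); first by nra.
  by rewrite lerB// lerXn2r// nnegrE ?expR_ge0//; lra.
have p0 : 0 < expR (2 * z) - 1 by apply: lt_le_trans e2; rewrite exprn_gt0.
rewrite mulrA ler_pdivrMr// mulrC; exact: ler_wpM2l.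
Qed.

(** For positive frequencies [coth] may be replaced by 1: the correction decays exponentially, so
    multiplied by the square of its argument it stays bounded, by [sqr_csym]. *)
Lemma om_pos xi : 0 < xi ->
  `|om delta xi - (4 * pi ^+ 2 * xi ^+ 2 - 2 * pi * xi / delta)| <= 2 / delta ^+ 2.
Proof.
move=> x0; have p0 := pi_gt0 R.
have z0 : 0 < 2 * pi * delta * xi by rewrite !mulr_gt0.
have E : om delta xi - (4 * pi ^+ 2 * xi ^+ 2 - 2 * pi * xi / delta) =
    (2 * pi * delta * xi) ^+ 2 * (coth (2 * pi * delta * xi) - 1) / delta ^+ 2.
  rewrite /om /kap /csym; move: (coth _) p0 => c; move: (pi : R) => q q0.
  by field; rewrite !gt_eqF.
rewrite E; have c1 : 0 <= coth (2 * pi * delta * xi) - 1 :> R.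
  rewrite coth_sub1// divr_ge0// subr_ge0; have := expR_ge1Dx (2 * (2 * pi * delta * xi)).
  by move=> h; apply: le_trans h; rewrite lerDl mulr_ge0// ltW.
rewrite ger0_norm; last by rewrite divr_ge0 ?sqr_ge0// mulr_ge0// sqr_ge0.
by rewrite ler_wpM2r ?sqr_csym// invr_ge0 sqr_ge0.
Qed.

Section frequency.
Variable N : R.
Hypothesis N1 : 1 <= N.

(** The tangent at [N] of the quadratic part of [om], with its linear part kept unchanged. *)
Definition lin_om xi : R := 4 * pi ^+ 2 * (N ^+ 2 + 2 * N * (xi - N)) - 2 * pi * xi / delta.

(** The right-hand side depends on [xi - N] only, as the second derivative of the quadratic part is
    constant. This uniformity in [N] is what allows a fixed time [t0]. *)
Lemma om_lin_bound xi :
  `|om delta xi - lin_om xi| <= 4 * pi ^+ 2 * (xi - N) ^+ 2 + 2 / delta ^+ 2.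
Proof.
move: N1 => N1'; have p0 := pi_gt0 R.
have q0 : 0 <= 4 * pi ^+ 2 :> R by rewrite mulr_ge0// sqr_ge0.
have d2 : 0 <= 2 / delta ^+ 2 by rewrite divr_ge0// sqr_ge0.
rewrite /lin_om; set Q := 4 * pi ^+ 2 in q0 *.
have [x0|x0|<-] := ltgtP 0 xi.
- have := om_pos x0; rewrite -/Q.
  move: (2 * pi * xi / delta) (om _ _) (2 / delta ^+ 2) => b o r.
  rewrite !ler_norml => /andP[h1 h2].
  have := mulr_ge0 q0 (sqr_ge0 (xi - N)).
  by move=> h3; apply/andP; split; nra.
(* For negative [xi] the quadratic part of [om] has the opposite sign, but the mismatch is
   controlled by [N^2 + xi^2 + 2 N |xi|], which is [(xi - N)^2]. *)
- have nx0 : 0 < - xi by rewrite oppr_gt0.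
  have := om_pos nx0; rewrite -/Q omN sqrrN mulrN mulNr opprK.
  move: (2 * pi * xi / delta) (om _ _) (2 / delta ^+ 2) => b o r.
  rewrite !ler_norml => /andP[h1 h2].
  have h3 : 0 <= Q * (N ^+ 2) by rewrite mulr_ge0// sqr_ge0.
  have h4 : 0 <= Q * (xi ^+ 2) by rewrite mulr_ge0// sqr_ge0.
  have h5 : 0 <= Q * (N * - xi) by rewrite mulr_ge0// mulr_ge0 ?ltW//; lra.
  by apply/andP; split; nra.
- rewrite /om !mulr0 !mul0r sub0r !subr0 sub0r normrN.
  rewrite (_ : N ^+ 2 + _ = - N ^+ 2); last by ring.
  by rewrite mulrN normrN sqrrN ger0_norm ?lerDl// mulr_ge0// sqr_ge0.
Qed.

End frequency.
End packets.

(** * Gaussian integrals with affine phases and polynomial weights *)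

Section gauss_waves.
Variable R : realType.
Notation mu := (@lebesgue_measure R).
Implicit Types (f g m k l A B : R -> R) (a c p q t s x y z xi d e C M N : R).

Lemma gauss_cos_lin a p q : 0 < a -> I (fun x => gauss a x * cos (p * x + q)) =
  cos q * ((Num.sqrt a)^-1 * gauss a^-1 (p / (2 * pi))).
Proof.
move=> a0; have p0 := pi_gt0 R.
have pE x : 2 * pi * (p / (2 * pi)) * x = p * x.
  by move: p0; move: (pi : R) => r r0; field; rewrite gt_eqF.
rewrite -(fourier_gauss _ a0).
have Ic : Int (fun x => gauss a x * cos (2 * pi * (p / (2 * pi)) * x)).
  by apply: eq_Int (Int_gauss_cos (2 * pi * (p / (2 * pi))) 0 a0) => x; rewrite addr0.
have Is : Int (fun x => gauss a x * sin (2 * pi * (p / (2 * pi)) * x)).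
  by apply: eq_Int (Int_gauss_sin (2 * pi * (p / (2 * pi))) 0 a0) => x; rewrite addr0.
have := IB (IntZ (cos q) Ic) (IntZ (sin q) Is).
rewrite (IZ _ Ic) (IZ _ Is) fourier_gauss_sin// mulr0 subr0 => <-.
by apply: eq_I => x; rewrite cosD pE; ring.
Qed.

Lemma gauss_sin_lin a p q : 0 < a -> I (fun x => gauss a x * sin (p * x + q)) =
  sin q * ((Num.sqrt a)^-1 * gauss a^-1 (p / (2 * pi))).
Proof.
move=> a0; have e x : sin (p * x + q) = cos (p * x + (q - pi / 2)).
  by rewrite addrA cosB cos_pihalf sin_pihalf mulr0 mulr1 add0r.
under eq_I do rewrite e.
by rewrite gauss_cos_lin// cosB cos_pihalf sin_pihalf mulr0 mulr1 add0r.
Qed.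

Lemma gauss_shift_cos c p q : I (fun x => gauss 1 (x + c) * cos (p * x + q)) =
  cos (q - p * c) * gauss 1 (p / (2 * pi)).
Proof.
have := gauss_cos_lin p (q - p * c) (ltr01 : 0 < 1 :> R).
rewrite sqrtr1 invr1 mul1r => <-.
rewrite -(I_shift c (Int_gauss_cos p (q - p * c) (ltr01 : 0 < 1 :> R))).
by apply: eq_I => x; congr (_ * cos _); ring.
Qed.

Lemma gauss_shift_sin c p q : I (fun x => gauss 1 (x + c) * sin (p * x + q)) =
  sin (q - p * c) * gauss 1 (p / (2 * pi)).
Proof.
have := gauss_sin_lin p (q - p * c) (ltr01 : 0 < 1 :> R).
rewrite sqrtr1 invr1 mul1r => <-.
rewrite -(I_shift c (Int_gauss_sin p (q - p * c) (ltr01 : 0 < 1 :> R))).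
by apply: eq_I => x; congr (_ * sin _); ring.
Qed.

Lemma I_gauss1 : I (gauss 1 : R -> R) = 1.
Proof. by rewrite I_gauss// sqrtr1 invr1. Qed.

Lemma peetre x y : W x <= 2 * W y * W (x - y).
Proof.
rewrite /W; have := sqr_ge0 (y * (x - y)); have := sqr_ge0 (x - 2 * y); nra.
Qed.

Lemma W_pow_le n x : W x ^+ n <= 2 ^+ n * (1 + `|x| ^+ (2 * n)).
Proof.
have w0 : 0 <= W x by rewrite ltW// W_gt0.
rewrite exprM real_normK ?num_real//; set y := x ^+ 2.
have y0 : 0 <= y by exact: sqr_ge0.
have [y1|y1] := leP y 1.
  apply: (@le_trans _ _ (2 ^+ n)).
    by rewrite lerXn2r ?nnegrE// /W -/y; lra.
  by rewrite ler_peMr ?exprn_ge0// lerDl exprn_ge0.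
apply: (@le_trans _ _ ((2 * y) ^+ n)).
  by rewrite lerXn2r ?nnegrE// /W -/y; lra.
by rewrite exprMn ler_wpM2l ?exprn_ge0// lerDr.
Qed.

Lemma Int_W_gauss n : Int (fun x : R => W x ^+ n * gauss 1 x).
Proof.
have I1 := Int_pow_gauss (2 * n) (ltr01 : 0 < 1 :> R).
have I0' := Int_gauss (ltr01 : 0 < 1 :> R).
apply: (@le_Int R _ (fun x => 2 ^+ n * (gauss 1 x + `|x| ^+ (2 * n) * gauss 1 x))).
- by apply: measM; [apply: measX; exact: meas_W|exact: meas_gauss].
- move=> x; have w0 : 0 <= W x ^+ n by rewrite exprn_ge0// ltW// W_gt0.
  rewrite normrM gauss_norm (ger0_norm w0).
  rewrite [leRHS](_ : _ = 2 ^+ n * (1 + `|x| ^+ (2 * n)) * gauss 1 x); last by ring.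
  by apply: ler_wpM2r; [exact: gauss_ge0|exact: W_pow_le].
- by apply: IntZ; exact: IntD.
Qed.

Definition gs N xi : R := gauss 1 (xi - N).

Lemma gs_ge0 N xi : 0 <= gs N xi. Proof. exact: gauss_ge0. Qed.
Lemma gs_le1 N xi : gs N xi <= 1. Proof. exact: gauss_le1. Qed.
Lemma meas_gs N : meas (gs N).
Proof.
by apply: meas_comp; [exact: meas_gauss|apply: measB; [exact: meas_id|exact: meas_cst]].
Qed.

Lemma Int_shiftB N f : Int f -> Int (fun xi => f (xi - N)).
Proof. exact: Int_shift. Qed.
Lemma I_shiftB N f : Int f -> I (fun xi => f (xi - N)) = I f.
Proof. exact: I_shift. Qed.

Lemma Int_gs N : Int (gs N). Proof. exact: Int_shiftB (Int_gauss ltr01). Qed.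
Lemma I_gs N : I (gs N) = 1.
Proof. by rewrite (I_shiftB N (Int_gauss ltr01)) I_gauss1. Qed.

Lemma nice_gs N : nice (gs N).
Proof.
move=> n; split.
  by apply: measM; [apply: measX; exact: meas_W|exact: meas_gs].
have IW := IntZ ((2 * W N) ^+ (4 + 2 * n)) (Int_shiftB N (Int_W_gauss (4 + 2 * n))).
apply: (@le_Int R _ _ _ _ IW).
  apply: measM; first by apply: measX; exact: meas_W.
  by apply: measX; apply: measM; [apply: measX; exact: meas_W|exact: meas_gs].
move=> xi; have w0 y : 0 <= W y :> R by rewrite ltW// W_gt0.
have g0 := gs_ge0 N xi.
rewrite ger0_norm; last by rewrite mulr_ge0 ?sqr_ge0// exprn_ge0.
have -> : W xi ^+ 4 * (W xi ^+ n * gs N xi) ^+ 2 = W xi ^+ (4 + 2 * n) * gs N xi ^+ 2.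
  by rewrite exprMn -exprM (mulnC n) exprD mulrA.
move: (4 + 2 * n)%N => p; rewrite mulrA -exprMn.
apply: ler_pM => //; rewrite ?exprn_ge0//.
  by rewrite lerXn2r ?nnegrE ?mulr_ge0// peetre.
by rewrite expr2 ler_piMl// gs_le1.
Qed.

Lemma niceD k l : nice k -> nice l -> nice (fun xi => k xi + l xi).
Proof. by move=> nk nl n; have := X4D (nk n) (nl n); under eq_fun do rewrite -mulrDr. Qed.
Lemma niceZ c k : nice k -> nice (fun xi => c * k xi).
Proof. by move=> nk n; have := X4Z c (nk n); under eq_fun do rewrite mulrCA. Qed.
Lemma nice_symm A B : nice A -> nice B -> nice (symm A B).
Proof.
move=> nA nB; have := niceZ 2^-1 (niceD (niceD nA (nice_opp nA)) (niceD nB (niceZ (-1) (nice_opp nB)))).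
by congr nice; apply/funext => xi; rewrite /symm mulN1r mulrC.
Qed.
Lemma nice_cos k f : nice k -> meas f -> nice (fun xi => k xi * cos (f xi)).
Proof.
move=> nk mf; have := @X4_mulW R (fun xi => cos (f xi)) k 1 0 nk (meas_cosf mf).
under [fun xi => cos _ * _]eq_fun do rewrite mulrC.
by apply=> xi; rewrite expr0 mulr1; exact: norm_cos_le1.
Qed.
Lemma nice_sin k f : nice k -> meas f -> nice (fun xi => k xi * sin (f xi)).
Proof.
move=> nk mf; have := @X4_mulW R (fun xi => sin (f xi)) k 1 0 nk (meas_sinf mf).
under [fun xi => sin _ * _]eq_fun do rewrite mulrC.
by apply=> xi; rewrite expr0 mulr1; exact: norm_sin_le1.
Qed.
Lemma nice0 : nice (fun=> 0 : R).
Proof. by have := niceZ 0 (nice_gs 0); under eq_fun do rewrite mul0r. Qed.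

End gauss_waves.

(** * Lower bound for the cubic interaction of packets *)

Section packet_estimate.
Variable R : realType.
Notation mu := (@lebesgue_measure R).
Implicit Types (f g m k l A B : R -> R) (t s x y z xi d e C M : R).
Variables delta N t0 : R.
Hypothesis delta0 : 0 < delta.
Hypothesis N1 : 1 <= N.
Hypothesis t00 : 0 <= t0.

Definition detune xi := t0 * (om delta xi - lin_om delta N xi).
(* At time [t0] the probe is the Gaussian packet obtained from the affine approximation [lin_om] of [om] near [N]: its phase is detuned by [t0 (om - lin_om)], which makes it an explicit Schwartz function. *)
Definition packet := symm (gs N) (fun=> 0 : R).
Definition probe := symm (fun xi => gs N xi * sin (detune xi)) (fun xi => - (gs N xi * cos (detune xi))).

Lemma meas_lin_om : meas (lin_om delta N).
Proof.
apply: measB; last by apply: measM; [exact: meas_lin|exact: meas_cst].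
apply: measM; first exact: meas_cst.
apply: measD; first exact: meas_cst.
by apply: measM; [exact: meas_cst|apply: measB; [exact: meas_id|exact: meas_cst]].
Qed.
Lemma meas_detune : meas detune.
Proof.
by apply: measM; [exact: meas_cst|apply: measB; [exact: meas_om|exact: meas_lin_om]].
Qed.

Lemma nice_packet : nice packet.
Proof. by apply: nice_symm; [exact: nice_gs|exact: nice0]. Qed.

Lemma nice_probe : nice probe.
Proof.
apply: nice_symm; first exact: nice_sin (nice_gs N) meas_detune.
have := niceZ (-1) (nice_cos (nice_gs N) meas_detune).
by under eq_fun do rewrite mulN1r.
Qed.

(** [wave] is the linear solution issued from [packet], [lwave] its model with phase [lin_om], and
    [slope] is minus the [x]-derivative of the linear solution issued from [probe]. *)
Definition wave t x := I (fun xi => gs N xi * cos (2 * pi * xi * x + t * om delta xi)).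
Definition lph t x xi : R := 2 * pi * xi * x + t * lin_om delta N xi.
Definition lwave t x := I (fun xi => gs N xi * cos (lph t x xi)).
Definition slope t x :=
  I (fun xi => 2 * pi * xi * gs N xi * cos (2 * pi * xi * x + t * om delta xi - detune xi)).

Lemma ht_packet t x : ht (flow delta packet t) x = wave t x.
Proof.
rewrite (ht_symm delta t x (Int_gs N) (@Int0 R)).
by apply: eq_I => xi; rewrite mul0r addr0.
Qed.

Lemma Int_xigs : Int (fun xi => 2 * pi * xi * gs N xi).
Proof.
have := IntZ (2 * pi) (X4_xi (nice_X4 (nice_gs N))).
by apply: eq_Int => xi; rewrite !mulrA.
Qed.

Lemma Psix_probe t x : Psix delta probe t x = - slope t x.
Proof.
have mp := meas_phase delta x t; have md := meas_detune.
have Ix := Int_xigs.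
have Ic : Int (fun xi => 2 * pi * xi * gs N xi * cos (2 * pi * xi * x + t * om delta xi - detune xi)).
  by apply: Int_cosb => //; exact: measB.
have Ic2 := Int_cosb Ix md; have Is2 := Int_sinb Ix md.
rewrite /Psix /probe hD_flow_symm ht_symm.
- rewrite /slope -(I_N Ic); apply: eq_I => xi; rewrite cosB; ring.
- by apply: eq_Int (IntN Ic2) => xi; ring.
- by apply: eq_Int (IntN Is2) => xi; ring.
Qed.

(** [wshift] is the translation at group velocity and [carrier] the phase at frequency [N]: an
    affine dispersion relation moves the envelope rigidly. *)
Definition wshift t : R := t * (8 * pi ^+ 2 * N - 2 * pi / delta) / (2 * pi).
Definition carrier t x : R := 2 * pi * N * (x + wshift t) - 4 * pi ^+ 2 * N ^+ 2 * t.

Lemma lph_affine t x xi : lph t x xi = 2 * pi * (x + wshift t) * (xi - N) + carrier t x.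
Proof.
have p0 := pi_gt0 R; rewrite /lph /lin_om /carrier /wshift.
move: p0 delta0; move: (pi : R) => q q0 d0; by field; rewrite !gt_eqF.
Qed.

Lemma gs_cos_lin x c : I (fun xi => gs N xi * cos (2 * pi * x * (xi - N) + c)) = cos c * gauss 1 x.
Proof.
rewrite (I_shiftB N (f := fun y => gauss 1 y * cos (2 * pi * x * y + c))); last exact: Int_gauss_cos.
rewrite gauss_cos_lin// sqrtr1 !invr1 mul1r; congr (_ * gauss 1 _).
have p0 := pi_gt0 R; move: p0; move: (pi : R) => q q0; by field; rewrite gt_eqF.
Qed.
Lemma gs_sin_lin x c : I (fun xi => gs N xi * sin (2 * pi * x * (xi - N) + c)) = sin c * gauss 1 x.
Proof.
rewrite (I_shiftB N (f := fun y => gauss 1 y * sin (2 * pi * x * y + c))); last exact: Int_gauss_sin.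
rewrite gauss_sin_lin// sqrtr1 !invr1 mul1r; congr (_ * gauss 1 _).
have p0 := pi_gt0 R; move: p0; move: (pi : R) => q q0; by field; rewrite gt_eqF.
Qed.

Lemma lwaveE t x : lwave t x = cos (carrier t x) * gauss 1 (x + wshift t).
Proof. by rewrite -gs_cos_lin; apply: eq_I => xi; rewrite lph_affine. Qed.

Lemma Psi_probe x : Psi delta probe t0 x = - (sin (carrier t0 x) * gauss 1 (x + wshift t0)).
Proof.
have mp := meas_phase delta x t0; have md := meas_detune.
have Ig := Int_gs N.
rewrite /Psi /probe ht_symm; last 2 first.
- exact: Int_sinb.
- by apply: IntN; exact: Int_cosb.
rewrite -gs_sin_lin -I_N; last first.
  apply: Int_sinb => //; apply: measD; last exact: meas_cst.
  by apply: measM; [exact: meas_cst|apply: measB; [exact: meas_id|exact: meas_cst]].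
apply: eq_I => xi; rewrite -lph_affine /lph.
have -> : 2 * pi * xi * x + t0 * lin_om delta N xi =
    (2 * pi * xi * x + t0 * om delta xi) - detune xi by rewrite /detune; ring.
rewrite sinB; ring.
Qed.

Definition mom n := I (fun y : R => `|y| ^+ n * gauss 1 y).
Lemma Int_mom n : Int (fun y : R => `|y| ^+ n * gauss 1 y).
Proof. exact: Int_pow_gauss. Qed.
Lemma mom_ge0 n : 0 <= mom n.
Proof. by apply: I_ge0 => y; rewrite mulr_ge0 ?exprn_ge0// gauss_ge0. Qed.

Definition disp : R -> R := fun y => 4 * pi ^+ 2 * y ^+ 2 + 2 / delta ^+ 2.
Lemma disp_ge0 y : 0 <= disp y.
Proof.
apply: addr_ge0; last by rewrite divr_ge0// sqr_ge0.
by pos.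
Qed.
(** Gaussian moments independent of [N]: [t0 * wA] bounds the error on the wave, [t0 * N * wB] the
    phase error on the slope, and [N * wC] the slope itself. *)
Definition wA := I (fun y => disp y * gauss 1 y).
Definition wB := 2 * pi * I (fun y => (1 + `|y|) * disp y * gauss 1 y).
Definition wC := 2 * pi * I (fun y => (1 + `|y|) * gauss 1 y).

Lemma Int_wA : Int (fun y => disp y * gauss 1 y).
Proof.
have := IntD (IntZ (4 * pi ^+ 2) (Int_mom 2)) (IntZ (2 / delta ^+ 2) (Int_mom 0)).
by apply: eq_Int => y; rewrite real_normK ?num_real// /disp; ring.
Qed.
Lemma Int_wC : Int (fun y => (1 + `|y|) * gauss 1 y).
Proof.
have := IntD (Int_mom 0) (Int_mom 1).
by apply: eq_Int => y; rewrite expr0 expr1; ring.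
Qed.
Lemma Int_wB : Int (fun y => (1 + `|y|) * disp y * gauss 1 y).
Proof.
have := IntD Int_wA (IntD (IntZ (4 * pi ^+ 2) (Int_mom 3)) (IntZ (2 / delta ^+ 2) (Int_mom 1))).
apply: eq_Int => y; have e : `|y| ^+ 3 = `|y| * y ^+ 2.
  by rewrite exprS real_normK ?num_real.
by rewrite e /disp; ring.
Qed.

Lemma xi_le xi : `|xi| <= N * (1 + `|xi - N|).
Proof.
move: N1 => N1'; rewrite -[X in `|X|](subrK N xi); apply: le_trans (ler_normD _ _) _.
rewrite (ger0_norm (_ : 0 <= N)); last by lra.
by have := normr_ge0 (xi - N); nra.
Qed.

Lemma meas_lph t x : meas (lph t x).
Proof.
apply: measD; first by apply: measM; [exact: meas_lin|exact: meas_cst].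
by apply: measM; [exact: meas_cst|exact: meas_lin_om].
Qed.

Lemma wave_lwave t x : 0 <= t <= t0 -> `|wave t x - lwave t x| <= t0 * wA.
Proof.
move=> /andP[t1 t2].
have mp := meas_phase delta x t; have ml := meas_lph t x.
have Ig := Int_gs N.
have I1 := Int_cosb Ig mp; have I2 := Int_cosb Ig ml.
rewrite /wave /lwave /wA -(IB I1 I2) -(I_shiftB N Int_wA) -(IZ t0 (Int_shiftB N Int_wA)).
apply: norm_I_le; [exact: Int_meas (IntB I1 I2)|exact: (IntZ _ (Int_shiftB N Int_wA))|move=> xi].
rewrite -mulrBr normrM (ger0_norm (gs_ge0 _ _)) mulrA mulrC; apply: ler_wpM2r; first exact: gs_ge0.
apply: le_trans (cos_lip _ _) _.
rewrite /lph (_ : _ - _ = t * (om delta xi - lin_om delta N xi)); last by ring.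
rewrite normrM (ger0_norm t1); apply: ler_pM => //.
exact: om_lin_bound.
Qed.

(** Two errors: the phase is wrong by [(t - t0) (om - lin_om)], small with [t0], and the factor [xi]
    is replaced by [N], at a cost that does not grow with [N]. *)
Lemma slope_lwave t x : 0 <= t <= t0 ->
  `|slope t x - 2 * pi * N * lwave t x| <= t0 * N * wB + 2 * pi * mom 1.
Proof.
move=> /andP[t1 t2]; have pi0 := pi_ge0 R; have N0 : 0 <= N by exact: le_trans ler01 N1.
have mp := measB (meas_phase delta x t) meas_detune; have ml := meas_lph t x.
have Ig := Int_gs N; have Ix := Int_xigs.
have I1 := Int_cosb Ix mp; have I2 := Int_cosb Ig ml.
have J1 := Int_shiftB N Int_wB; have J2 := Int_shiftB N (Int_mom 1).
rewrite /slope /lwave -(IZ (2 * pi * N) I2) -(IB I1 (IntZ _ I2)).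
rewrite /wB /mom -(I_shiftB N Int_wB) -(I_shiftB N (Int_mom 1)).
rewrite mulrA -(IZ _ J1) -(IZ _ J2) -(ID (IntZ _ J1) (IntZ _ J2)).
apply: norm_I_le; [exact: Int_meas (IntB I1 (IntZ _ I2))|exact: (IntD (IntZ _ J1) (IntZ _ J2))|move=> xi].
rewrite (_ : _ - _ = 2 * pi * xi * gs N xi * (cos (2 * pi * xi * x + t * om delta xi - detune xi) - cos (lph t x xi))
   + 2 * pi * (xi - N) * gs N xi * cos (lph t x xi)); last by ring.
apply: le_trans (ler_normD _ _) _; rewrite !normrM (ger0_norm (gs_ge0 _ _)) normr_nat (ger0_norm pi0).
rewrite -/(gs N xi); apply: lerD; last first.
  rewrite expr1 mulrA; apply: ler_piMr; last exact: norm_cos_le1.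
  by rewrite !mulr_ge0// gs_ge0.
have h : `|cos (2 * pi * xi * x + t * om delta xi - detune xi) - cos (lph t x xi)| <= t0 * disp (xi - N).
  apply: le_trans (cos_lip _ _) _.
  rewrite /lph /detune (_ : _ - _ = (t - t0) * (om delta xi - lin_om delta N xi)); last by ring.
  have tt : `|t - t0| <= t0 by rewrite distrC ger0_norm ?subr_ge0// gerBl.
  by rewrite normrM; apply: ler_pM => //; exact: om_lin_bound.
rewrite [leRHS](_ : _ = 2 * pi * (N * (1 + `|xi - N|)) * gs N xi * (t0 * disp (xi - N))); last by rewrite /gs; ring.
apply: ler_pM => //; first by rewrite !mulr_ge0// gs_ge0.
apply: ler_wpM2r; first exact: gs_ge0.
by apply: ler_wpM2l; [exact: mulr_ge0|exact: xi_le].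
Qed.

Lemma slope_bound t x : `|slope t x| <= N * wC.
Proof.
have pi0 := pi_ge0 R.
have J := Int_shiftB N Int_wC.
have mp := measB (meas_phase delta x t) meas_detune.
rewrite /wC mulrA -(I_shiftB N Int_wC) -(IZ _ J).
apply: norm_I_le; [exact: Int_meas (Int_cosb Int_xigs mp)|exact: IntZ|move=> xi].
rewrite !normrM (ger0_norm (gs_ge0 _ _)) normr_nat (ger0_norm pi0).
rewrite -/(gs N xi) [leRHS](_ : _ = 2 * pi * (N * (1 + `|xi - N|)) * gs N xi); last by ring.
apply: (@le_trans _ _ (2 * pi * `|xi| * gs N xi)).
  by apply: ler_piMr; [rewrite !mulr_ge0// gs_ge0|exact: norm_cos_le1].
apply: ler_wpM2r; first exact: gs_ge0.
by apply: ler_wpM2l; [exact: mulr_ge0|exact: xi_le].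
Qed.

Lemma packet_mass : pr (ht packet) (ht packet) <= 1.
Proof.
have [Ip Lp] := X4_Int (nice_X4 nice_packet).
have Ig := Int_gs N.
rewrite /pr (parseval Ip Lp Ip Lp).
have -> : (1 : R) = I (fun xi => 2^-1 * (gs N xi + gs N (- xi))).
  rewrite (IZ _ (IntD Ig (Int_opp Ig))) (ID Ig (Int_opp Ig)) (I_opp Ig) I_gs.
  by field.
apply: le_I; [exact: L2M|exact: (IntZ _ (IntD Ig (Int_opp Ig)))|move=> xi].
rewrite /packet /symm subr0 addr0.
have := gs_ge0 N xi; have := gs_ge0 N (- xi); have := gs_le1 N xi; have := gs_le1 N (- xi).
by move: (gs N xi) (gs N (- xi)) => a b *; nra.
Qed.

(** From [(cos^2 - 1/2)^2 >= 0]. The constant term survives integration, while the oscillating one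
    is damped by the Gaussian envelope. *)
Lemma cos4_lower (z : R) : 4^-1 + 2^-1 * cos (z + z) <= cos z ^+ 4.
Proof.
rewrite cosD -!expr2 sin2cos2; have := sqr_ge0 (cos z ^+ 2 - 2^-1).
by rewrite (_ : cos z ^+ 4 = cos z ^+ 2 * cos z ^+ 2); [move: (cos z ^+ 2) => y; nra|ring].
Qed.

Lemma L2_lwave t : L2 (lwave t).
Proof.
have Ic := Int_shift (wshift t) (Int_gauss (ltr01 : 0 < 1 :> R)).
have ml : meas (lwave t).
  have -> : lwave t = (fun x => cos (carrier t x) * gauss 1 (x + wshift t)).
    by apply/funext => x; exact: lwaveE.
  apply: measM; last exact: Int_meas Ic.
  apply: meas_cosf; apply: measB; last exact: meas_cst.
  by apply: measM; [exact: meas_cst|apply: measD; [exact: meas_id|exact: meas_cst]].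
apply: (L2_intro ml _ Ic) => x.
rewrite lwaveE exprMn; have g0 := gauss_ge0 1 (x + wshift t).
have g1 : gauss 1 (x + wshift t) <= 1 by exact: gauss_le1.
have c1 : cos (carrier t x) ^+ 2 <= 1.
  by rewrite -(real_normK (num_real (cos _))) expr2 mulr_ile1// norm_cos_le1.
apply: (@le_trans _ _ (gauss 1 (x + wshift t) ^+ 2)); first by rewrite ler_piMl// sqr_ge0.
by rewrite expr2 ler_piMl.
Qed.

Lemma lwave_le1 t x : `|lwave t x| <= 1.
Proof.
rewrite lwaveE normrM gauss_norm mulr_ile1// ?gauss_ge0 ?norm_cos_le1//.
exact: gauss_le1.
Qed.

Lemma lwave_mass t : pr (lwave t) (lwave t) <= 1.
Proof.
have g1 := ltr01 : 0 < 1 :> R.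
rewrite -(I_gauss1 R) -(I_shift (wshift t) (Int_gauss g1)).
apply: le_I; [exact: L2M (L2_lwave t) (L2_lwave t)|exact: Int_shift (Int_gauss g1)|move=> x].
rewrite -expr2 lwaveE exprMn; have g0 := gauss_ge0 1 (x + wshift t).
have g1' : gauss 1 (x + wshift t) <= 1 by exact: gauss_le1.
have c1 : cos (carrier t x) ^+ 2 <= 1.
  by rewrite -(real_normK (num_real (cos _))) expr2 mulr_ile1// norm_cos_le1.
apply: (@le_trans _ _ (gauss 1 (x + wshift t) ^+ 2)); first by rewrite ler_piMl// sqr_ge0.
by rewrite expr2 ler_piMl.
Qed.

(** The constant is [1/4 * 1/2 - 1/2 * 1/2 * 1/3]: the integral of [gauss 4] is 1/2, and the
    oscillating part carries [expR (- pi N^2) <= 1/3]. *)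
Lemma lwave_quart t : 24^-1 <= I (fun x => lwave t x ^+ 3 * lwave t x).
Proof.
have four0 : 0 < 4 :> R by [].
pose c1 := - (4 * pi ^+ 2 * N ^+ 2 * t).
pose f x := cos (2 * pi * N * x + c1) ^+ 4 * gauss 1 x ^+ 4.
have g4 x : gauss 1 x ^+ 4 = gauss 4 x :> R.
  by rewrite /gauss -expRM_natl; congr expR; ring.
have If : Int f.
  apply: le_Int (Int_gauss four0) => [|x].
    apply: measM; last by apply: measX; exact: meas_gauss.
    by apply: measX; exact: meas_cos_lin.
  rewrite /f g4 normrM gauss_norm ler_piMl ?gauss_ge0// normrX exprn_ile1//.
  exact: norm_cos_le1.
have -> : I (fun x => lwave t x ^+ 3 * lwave t x) = I f.
  rewrite -(I_shift (wshift t) If); apply: eq_I => x.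
  by rewrite -exprSr lwaveE exprMn.
have Ic := Int_gauss_cos (2 * (2 * pi * N)) (2 * c1) four0.
have Ig := Int_gauss four0.
apply: (@le_trans _ _ (I (fun x => 4^-1 * gauss 4 x + 2^-1 * (gauss 4 x * cos (2 * (2 * pi * N) * x + 2 * c1))))).
  rewrite (ID (IntZ _ Ig) (IntZ _ Ic)) (IZ _ Ig) (IZ _ Ic) I_gauss// gauss_cos_lin//.
  have s4 : Num.sqrt (4 : R) = 2 by rewrite (_ : 4 = 2 ^+ 2); [rewrite sqrtr_sqr normr_nat|ring].
  rewrite s4 (_ : 2 * (2 * pi * N) / (2 * pi) = 2 * N); last first.
    have p0 := pi_gt0 R; move: p0; move: (pi : R) => q q0; by field; rewrite gt_eqF.
  have g13 : gauss 4^-1 (2 * N) <= 3^-1.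
    rewrite /gauss (_ : pi * 4^-1 * _ = pi * N ^+ 2); last by field.
    have e1 : 3 <= expR (pi * N ^+ 2).
      apply: le_trans (expR_ge1Dx _).
      have := pi_ge2 R; move: N1 => N1'; nra.
    by rewrite expRN lef_pV2 ?posrE ?expR_gt0.
  have := norm_cos_le1 (2 * c1); rewrite ler_norml => /andP[h1 h2].
  have := gauss_ge0 4^-1 (2 * N); move: (gauss _ _) g13 (cos _) h1 h2 => g g13 c h1 h2 g0.
  nra.
apply: le_I => //; first exact: (IntD (IntZ _ Ig) (IntZ _ Ic)).
move=> x; rewrite /f g4.
have := cos4_lower (2 * pi * N * x + c1).
rewrite (_ : _ + c1 + _ = 2 * (2 * pi * N) * x + 2 * c1); last by ring.
by have := gauss_ge0 4 x; move: (cos _) (gauss _ _) (cos _ ^+ 4) => a b c *; nra.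
Qed.

Lemma quad_cross (p q : R) : `|p ^+ 2 + p * q + q ^+ 2| <= 3 / 2 * (p * p + q * q).
Proof.
rewrite ler_norml.
by apply/andP; split; have := sqr_ge0 (p - q); have := sqr_ge0 (p + q); nra.
Qed.

Lemma low_algebra (a b ww ll P Q r : R) : - (a * (ww + ll)) <= P -> - (b * ll) <= Q ->
  r - (a * ww + (a + b) * ll) <= P + Q + r.
Proof. nra. Qed.

Lemma main_algebra (n q : R) : 0 <= n -> 24^-1 <= q -> n / 6 <= 2 * pi * n * q.
Proof.
move=> n0 hq; have p2 := pi_ge2 R.
have e4 : 4 * n <= 2 * pi * n by apply: ler_wpM2r => //; lra.
apply: (@le_trans _ _ (4 * n * 24^-1)); first by lra.
by apply: ler_pM => //; rewrite ?mulr_ge0 ?invr_ge0.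
Qed.

Lemma error_algebra (n t u w v m : R) : 0 <= n -> t * (3 * (u * w) + v) <= 24^-1 ->
  2 * pi * m <= 24^-1 * n ->
  2 * (t * u * (n * w) * (3 / 2)) + (t * n * v + 2 * pi * m) <= n / 12.
Proof.
move=> n0 h1 h2; have := ler_wpM2l n0 h1.
rewrite (_ : n * (t * _) = 2 * (t * u * (n * w) * (3 / 2)) + t * n * v); last by field.
move: h2; move: (2 * (_ * _)) (t * n * v) (2 * pi * m) => x y z; lra.
Qed.

Lemma final_algebra (a b p q u S n : R) : u - (p + q) <= S -> p <= a -> q <= a + b ->
  n / 6 <= u -> 2 * a + b <= n / 12 -> n / 36 <= 3^-1 * S.
Proof. lra. Qed.

(** Replacing both factors by their models leaves [2 pi N] times the quartic integral of [lwave], at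
    least [N / 6]. The errors are at most [N / 12], half from each smallness condition, and the
    factor 1/3 gives [N / 36]. *)
Lemma packet_lower t : 0 <= t <= t0 ->
  t0 * (3 * (wA * wC) + wB) <= 24^-1 -> 2 * pi * mom 1 <= 24^-1 * N ->
  N / 36 <= - 3^-1 * pr (fun x => ht (flow delta packet t) x ^+ 3) (Psix delta probe t).
Proof.
move=> tt H1 H2; have t1 : 0 <= t by case/andP: tt.
have N0 : 0 <= N by exact: le_trans ler01 N1.
have pE : ht (flow delta packet t) = wave t by apply/funext => x; exact: ht_packet.
have PE : Psix delta probe t = (fun x => - slope t x) by apply/funext => x; exact: Psix_probe.
have Lw : L2 (wave t) by rewrite -pE; exact: v_L2 nice_packet.
have Lw2 : L2 (fun x => wave t x ^+ 2) by rewrite -pE; exact: v_L2sq nice_packet.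
have Ls : L2 (slope t).
  have := vx_L2 delta t nice_probe; rewrite -/(Psix delta probe t) PE => /L2N.
  by under eq_fun do rewrite opprK.
have Ll := L2_lwave t.
have bw x : `|wave t x| <= 1.
  rewrite -(I_gs N); apply: norm_I_le (Int_gs N) _.
    exact: Int_meas (Int_cosb (Int_gs N) (meas_phase delta x t)).
  by move=> xi; rewrite normrM (ger0_norm (gs_ge0 _ _)) ler_piMr ?gs_ge0 ?norm_cos_le1.
have Lw3 : L2 (fun x => wave t x ^+ 3).
  by have := L2Mb Lw.1 bw Lw2; congr L2; apply/funext => x; rewrite [RHS]exprS mulrC.
have Ll2 : L2 (fun x => lwave t x ^+ 2).
  by have := L2Mb Ll.1 (lwave_le1 t) Ll; congr L2; apply/funext => x; rewrite expr2.
have Ll3 : L2 (fun x => lwave t x ^+ 3).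
  by have := L2Mb Ll.1 (lwave_le1 t) Ll2; congr L2; apply/funext => x; rewrite [RHS]exprS mulrC.
have J := L2M Lw3 Ls; have Q1 := L2M Ll3 Ll.
have Q2 := L2M Lw Lw; have Q3 := L2M Ll Ll.
have m1 : pr (wave t) (wave t) <= 1.
  by rewrite -pE flow_pair// ?packet_mass//; exact: nice_packet.
have m2 := lwave_mass t.
have wA0 : 0 <= wA by apply: I_ge0 => y; rewrite mulr_ge0 ?disp_ge0 ?gauss_ge0.
have wC0 : 0 <= wC.
  rewrite mulr_ge0 ?mulr_ge0 ?pi_ge0//; apply: I_ge0 => y.
  by rewrite mulr_ge0 ?gauss_ge0// addr_ge0.
have wB0 : 0 <= wB.
  rewrite mulr_ge0 ?mulr_ge0 ?pi_ge0//; apply: I_ge0 => y.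
  by rewrite mulr_ge0 ?gauss_ge0// mulr_ge0 ?disp_ge0// addr_ge0.
(* [a] measures the replacement of [wave^3] by [lwave^3] against the slope, [b] that of the slope by
   [2 pi N lwave]; each is multiplied by squares of the waves, whose masses are at most 1. *)
pose a := t0 * wA * (N * wC) * (3 / 2).
pose b := t0 * N * wB + 2 * pi * mom 1.
have c32 : 0 <= 3 / 2 :> R by rewrite divr_ge0.
have a0 : 0 <= a by rewrite /a; pos.
have pi0 := pi_ge0 R; have mom0 := mom_ge0 1.
have b0 : 0 <= b by rewrite /b; pos.
pose low x := 2 * pi * N * (lwave t x ^+ 3 * lwave t x)
  - (a * (wave t x * wave t x) + (a + b) * (lwave t x * lwave t x)).
have Ilow : Int low.
  by apply: IntB; [exact: IntZ|apply: IntD; exact: IntZ].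
have E : I low <= I (fun x => wave t x ^+ 3 * slope t x).
  apply: le_I => // x; rewrite /low.
  have h1 := wave_lwave x tt; have h2 := slope_lwave x tt; have h3 := slope_bound t x.
  have h4 := lwave_le1 t x.
  rewrite -/b in h2; set c := 2 * pi * N in h2 *.
  have k1 : `|(wave t x ^+ 3 - lwave t x ^+ 3) * slope t x| <=
      a * (wave t x * wave t x + lwave t x * lwave t x).
    rewrite (_ : wave t x ^+ 3 - _ = (wave t x - lwave t x) *
      (wave t x ^+ 2 + wave t x * lwave t x + lwave t x ^+ 2)); last by ring.
    rewrite mulrAC 2!normrM /a -[leRHS]mulrA; apply: ler_pM => //.
      exact: ler_pM.
    exact: quad_cross.
  have k2 : `|lwave t x ^+ 3 * (slope t x - c * lwave t x)| <= b * (lwave t x * lwave t x).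
    rewrite normrM mulrC; apply: ler_pM => //.
    rewrite normrX exprS -[lwave t x * lwave t x]expr2 -(real_normK (num_real (lwave t x))).
    by rewrite ler_piMl ?sqr_ge0.
  move: k1 k2; rewrite !ler_norml => /andP[k1 _] /andP[k2 _].
  have -> : wave t x ^+ 3 * slope t x = (wave t x ^+ 3 - lwave t x ^+ 3) * slope t x +
     lwave t x ^+ 3 * (slope t x - c * lwave t x) + c * (lwave t x ^+ 3 * lwave t x) by ring.
  exact: low_algebra k1 k2.
rewrite pE PE /pr (eq_I (g := fun x => - (wave t x ^+ 3 * slope t x))); last first.
  by move=> x; rewrite mulrN.
rewrite (I_N J) mulrNN.
have K := lwave_quart t.
move: E; rewrite /low (IB (IntZ _ Q1) (IntD (IntZ _ Q2) (IntZ _ Q3))) (ID (IntZ _ Q2) (IntZ _ Q3)).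
rewrite (IZ _ Q1) (IZ _ Q2) (IZ _ Q3) -!/(pr _ _).
have E1 := ler_piMr a0 m1.
have E2 := ler_piMr (addr_ge0 a0 b0) m2.
have E3 := main_algebra N0 K.
have E4 := error_algebra N0 H1 H2.
by move=> E; exact: final_algebra E E1 E2 E3 E4.
Qed.

End packet_estimate.

(** * Weighted norms of the packets *)

Section sobolev_bounds.
Variable R : realType.
Notation mu := (@lebesgue_measure R).
Implicit Types (f g m k l A B : R -> R) (a b c d t s x y z xi e C M N : R).

Lemma wtM s x : wt s x * wt (- s) x = 1.
Proof. by rewrite /wt powRN divff// gt_eqF// powR_gt0// W_gt0. Qed.

Lemma wt_le_nat s : exists n, forall x, wt s x <= W x ^+ n.
Proof.
exists (Num.Def.archi_bound `|s|) => x; rewrite /wt -powR_mulrn; last by rewrite ltW// W_gt0.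
apply: ler_powR; first exact: W_ge1.
by apply: le_trans (ler_norm s) _; rewrite ltW// archi_boundP.
Qed.

Lemma wt_peetre_ge0 s x y : 0 <= s -> wt s x <= 2 `^ s * wt s y * wt s (x - y).
Proof.
move=> s0; have w0 z : 0 <= W z by rewrite ltW// W_gt0.
rewrite /wt -powRM// -powRM ?mulr_ge0//.
by apply: ge0_ler_powR; rewrite ?nnegrE ?mulr_ge0//; exact: peetre.
Qed.

(** For negative [s] the inequality for [- s] with the two points exchanged is multiplied by both
    weights. *)
Lemma wt_peetre s x y : wt s x <= 2 `^ `|s| * wt s y * wt `|s| (x - y).
Proof.
have [s0|s0] := leP 0 s; first by have := wt_peetre_ge0 x y s0; rewrite (ger0_norm s0).
have := @wt_peetre_ge0 (- s) y x; rewrite oppr_ge0 => /(_ (ltW s0)).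
rewrite (ltr0_norm s0) -(wtN _ (x - y)) opprB => H.
have e1 := wtM s x; have e2 := wtM s y.
have p1 := wt_gt0 s x; have p2 := wt_gt0 s y.
have := ler_wpM2l (ltW (mulr_gt0 p1 p2)) H.
rewrite -mulrA e2 mulr1.
rewrite (_ : wt s x * wt s y * _ = (wt s x * wt (- s) x) * (2 `^ (- s) * wt s y * wt (- s) (y - x))); last by ring.
by rewrite e1 mul1r.
Qed.

(** Peetre's inequality moves the weight to the centre [N], and what remains is a moment of the
    centred Gaussian; so [K] does not depend on [N]. *)
Lemma wt_gs s : exists2 K, 0 <= K & forall N,
  Int (fun x => wt s x * gs N x) /\ I (fun x => wt s x * gs N x) <= K * wt s N.
Proof.
have [n Hn] := wt_le_nat `|s|.
pose K := 2 `^ `|s| * I (fun x => W x ^+ n * gauss 1 x).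
have w0 z : 0 <= W z ^+ n by rewrite exprn_ge0// ltW// W_gt0.
exists K.
  rewrite mulr_ge0 ?powR_ge0//; apply: I_ge0 => x.
  by rewrite mulr_ge0// gauss_ge0.
move=> N; have J := Int_shiftB N (Int_W_gauss R n).
have J' := IntZ (2 `^ `|s| * wt s N) J.
have le x : wt s x * gs N x <= 2 `^ `|s| * wt s N * (W (x - N) ^+ n * gauss 1 (x - N)).
  rewrite mulrA; apply: ler_wpM2r; first exact: gauss_ge0.
  apply: le_trans (wt_peetre s x N) _; apply: ler_wpM2l; last exact: Hn.
  by rewrite mulr_ge0 ?powR_ge0.
have Iw : Int (fun x => wt s x * gs N x).
  apply: le_Int J' => [|x]; first by apply: measM; [exact: meas_wt|exact: meas_gs].
  by rewrite ger0_norm// mulr_ge0 ?wt_ge0 ?gs_ge0.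
split => //; apply: le_trans (le_I Iw J' le) _.
rewrite (IZ _ J) (I_shiftB N (Int_W_gauss R n)) /K.
by rewrite le_eqVlt; apply/orP; left; apply/eqP; ring.
Qed.

Lemma wt_gs2 s : exists2 K, 0 <= K & forall N,
  Int (fun x => wt s x * (gs N x + gs N (- x))) /\
  I (fun x => wt s x * (gs N x + gs N (- x))) <= K * wt s N.
Proof.
have [K K0 HK] := wt_gs s; exists (2 * K); first by rewrite mulr_ge0.
move=> N; have [J1 H1] := HK N.
have J2 : Int (fun x => wt s x * gs N (- x)).
  by apply: eq_Int (Int_opp J1) => x; rewrite wtN.
have E2 : I (fun x => wt s x * gs N (- x)) = I (fun x => wt s x * gs N x).
  by rewrite -(I_opp J1); apply: eq_I => x; rewrite wtN.
split; first by apply: eq_Int (IntD J1 J2) => x; rewrite mulrDr.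
rewrite (eq_I (g := fun x => wt s x * gs N x + wt s x * gs N (- x))); last first.
  by move=> x; rewrite mulrDr.
rewrite (ID J1 J2) E2 -mulrA [leRHS](_ : _ = K * wt s N + K * wt s N); last by ring.
exact: lerD.
Qed.

Lemma wt_dom s k N : meas k -> (forall x, k x <= gs N x + gs N (- x)) -> (forall x, 0 <= k x) ->
  Int (fun x => wt s x * k x) /\
  I (fun x => wt s x * k x) <= I (fun x => wt s x * (gs N x + gs N (- x))).
Proof.
move=> mk H k0; have [K _ HK] := wt_gs2 s; have [J _] := HK N.
have le x : wt s x * k x <= wt s x * (gs N x + gs N (- x)).
  by apply: ler_wpM2l; [exact: wt_ge0|exact: H].
have Ik : Int (fun x => wt s x * k x).
  apply: le_Int J => [|x]; first by apply: measM => //; exact: meas_wt.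
  by rewrite ger0_norm// mulr_ge0 ?wt_ge0.
by split => //; exact: le_I.
Qed.

Lemma fourier_weight s (u : rdistribution R) (g : R -> R[i]) :
  has_fourier s u g -> (Hs_norm s u <= weighted_norm s g)%E.
Proof. by move=> H; apply: ereal_inf_lbound; exists g. Qed.

(** For even [k] the sine part drops out and the Hartley function is itself the Fourier transform;
    the datum is a cosine packet so that this applies. *)
Lemma has_fourier_even s k : Int k -> L2 k -> (forall x, k (- x) = k x) ->
  Int (fun x => wt s x * k x ^+ 2) ->
  has_fourier s (dist_of (ht k)) (fun x => Complex (k x) 0) /\
  weighted_norm s (fun x => Complex (k x) 0) = (Num.sqrt (I (fun x => wt s x * k x ^+ 2)))%:E.
Proof.
move=> Ik Lk ke Iw.
have E x : wt s x * k x ^+ 2 = wt s x * (complex.Re (Complex (k x) 0) ^+ 2 + complex.Im (Complex (k x) 0) ^+ 2).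
  by rewrite /= [0 ^+ 2]expr0n addr0.
have Iw' := eq_Int E Iw.
have wE : weighted_norm s (fun x => Complex (k x) 0) = (Num.sqrt (I (fun x => wt s x * k x ^+ 2)))%:E.
  by rewrite (weighted_norm_eq Iw'); congr (Num.sqrt _)%:E; apply: eq_I => x; rewrite -E.
split => //; split => /=.
- exact: Int_meas.
- exact: meas_cst.
- by rewrite wE ltry.
- move=> psi; have Ip := schwartz_Int psi.
  have Lh := ht_schwartz_L2 psi; have Lh' := L2_opp Lh.
  have J1 := L2M Lk Lh; have J2 := L2M Lk Lh'.
  have Jc : Int (fun x => k x * fcos psi x).
    by apply: eq_Int (IntZ 2^-1 (IntD J1 J2)) => x; rewrite fcosE//; field.
  have Js : Int (fun x => k x * fsin psi x).
    by apply: eq_Int (IntZ 2^-1 (IntB J1 J2)) => x; rewrite fsinE//; field.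
  have S0 : I (fun x => k x * fsin psi x) = 0.
    by apply: I_odd => // x; rewrite ke fsinN// mulrN.
  have dE : dist_of (ht k) psi = I (fun x => k x * fcos psi x).
    rewrite /dist_of -/(I _) (eq_I (g := fun x => psi x * ht k x)); last by move=> x; rewrite mulrC.
    rewrite (ht_swap Ip Ik) -[RHS]addr0 -S0 -(ID Jc Js); apply: eq_I => x.
    by rewrite ht_fcos_fsin// mulrDr.
  have iE x : Complex (k x) 0 * inverse_fourier psi x = Complex (k x * fcos psi x) (k x * fsin psi x).
    rewrite inverse_fourierE; apply/eqP; rewrite eq_complex /= !mul0r subr0 addr0.
    by rewrite !eqxx.
  under [X in cintegral X]eq_fun do rewrite iE.
  by rewrite /cintegral /= -!/(I _) -dE S0.
Qed.

Lemma sqr_diff_le (a b r : R) : a ^+ 2 <= r -> b ^+ 2 <= r -> (b - a) ^+ 2 <= 2 * (2 * r).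
Proof. by move=> h1 h2; have := sqr_ge0 (a + b); nra. Qed.

Lemma meas_fcos (psi : schwartz R) : meas (fcos psi).
Proof.
have Lh := ht_schwartz_L2 psi.
have -> : fcos psi = (fun x => 2^-1 * (ht psi x + ht psi (- x))).
  by apply/funext => x; rewrite (fcosE x (schwartz_Int psi)) mulrC.
apply: measM; first exact: meas_cst.
by apply: measD; [exact: Lh.1|exact: (L2_opp Lh).1].
Qed.
Lemma meas_fsin (psi : schwartz R) : meas (fsin psi).
Proof.
have Lh := ht_schwartz_L2 psi.
have -> : fsin psi = (fun x => 2^-1 * (ht psi x - ht psi (- x))).
  by apply/funext => x; rewrite (fsinE x (schwartz_Int psi)) mulrC.
apply: measM; first exact: meas_cst.
by apply: measB; [exact: Lh.1|exact: (L2_opp Lh).1].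
Qed.

(** Duality between H^s and H^-s. As [s] may be negative, [g] need not be in L^2, so real and
    imaginary parts are weighted by [wt (s / 2)] and paired separately; combining the two pairings
    costs the factor 4. *)
Lemma pairing_bound s (u : rdistribution R) (psi : schwartz R) M P : 0 <= M ->
  Int (fun x => wt (- s) x * (fcos psi x ^+ 2 + fsin psi x ^+ 2)) ->
  I (fun x => wt (- s) x * (fcos psi x ^+ 2 + fsin psi x ^+ 2)) <= P ->
  (Hs_norm s u < M%:E)%E -> u psi ^+ 2 <= 2 * (2 * (M ^+ 2 * P)).
Proof.
move=> M0 Iw IP /ereal_inf_lt [_ [g [mp mq _ Hg] <-] gM].
have [J1 H1] := weighted_norm_lt mp mq gM.
have := Hg psi; rewrite /cintegral => /(congr1 (@complex.Re R)) /= ->.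
have mc := meas_fcos psi; have ms := meas_fsin psi.
pose p x := complex.Re (g x); pose q x := complex.Im (g x).
have wp r x : wt (r / 2) x ^+ 2 = wt r x by exact: wt_half.
have half r (a b : R -> R) : meas a -> meas b -> Int (fun x => wt r x * (a x ^+ 2 + b x ^+ 2)) ->
    L2 (fun x => wt (r / 2) x * a x) /\
    I (fun x => (wt (r / 2) x * a x) ^+ 2) <= I (fun x => wt r x * (a x ^+ 2 + b x ^+ 2)).
  move=> ma mb J.
  have ml : meas (fun x => wt (r / 2) x * a x) by apply: measM => //; exact: meas_wt.
  have le x : (wt (r / 2) x * a x) ^+ 2 <= wt r x * (a x ^+ 2 + b x ^+ 2).
    rewrite exprMn wp; apply: ler_wpM2l; first exact: wt_ge0.
    by rewrite lerDl sqr_ge0.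
  by have L := L2_intro ml le J; split => //; apply: le_I => //; exact: L.2.
have [Lp Bp] := half s p q mp mq J1.
have [Lq Bq] : L2 (fun x => wt (s / 2) x * q x) /\
    I (fun x => (wt (s / 2) x * q x) ^+ 2) <= I (fun x => wt s x * (p x ^+ 2 + q x ^+ 2)).
  have E x : wt s x * (p x ^+ 2 + q x ^+ 2) = wt s x * (q x ^+ 2 + p x ^+ 2) by rewrite addrC.
  by rewrite (eq_I E); apply: half => //; exact: eq_Int E J1.
have [Lc Bc] := half (- s) _ _ mc ms Iw.
have [Ls Bs] : L2 (fun x => wt (- s / 2) x * fsin psi x) /\
    I (fun x => (wt (- s / 2) x * fsin psi x) ^+ 2) <=
    I (fun x => wt (- s) x * (fcos psi x ^+ 2 + fsin psi x ^+ 2)).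
  have E x : wt (- s) x * (fcos psi x ^+ 2 + fsin psi x ^+ 2) =
    wt (- s) x * (fsin psi x ^+ 2 + fcos psi x ^+ 2) by rewrite addrC.
  by rewrite (eq_I E); apply: half => //; exact: eq_Int E Iw.
have wI x : wt (s / 2) x * wt (- s / 2) x = 1 by rewrite mulNr wtM.
rewrite -/(I _) (eq_I (g := fun x => (wt (s / 2) x * p x) * (wt (- s / 2) x * fcos psi x) -
   (wt (s / 2) x * q x) * (wt (- s / 2) x * fsin psi x))); last first.
  move=> x; rewrite inverse_fourierE/=.
  rewrite (_ : _ - _ = (wt (s / 2) x * wt (- s / 2) x) * (p x * fcos psi x - q x * fsin psi x)); last by ring.
  by rewrite wI mul1r /p /q; case: (g x).
rewrite (IB (L2M Lp Lc) (L2M Lq Ls)).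
have C1 := CS Lp Lc; have C2 := CS Lq Ls.
have P0 : 0 <= P.
  apply: le_trans IP; apply: I_ge0 => x; apply: mulr_ge0; first exact: wt_ge0.
  by apply: addr_ge0; exact: sqr_ge0.
have sq (f : R -> R) : 0 <= I (fun x => f x ^+ 2) by apply: I_ge0 => x; exact: sqr_ge0.
have B1 : I (fun x => wt (s / 2) x * p x * (wt (- s / 2) x * fcos psi x)) ^+ 2 <= M ^+ 2 * P.
  apply: le_trans C1 _; apply: ler_pM; rewrite ?sq//.
    exact: le_trans Bp H1.
  exact: le_trans Bc IP.
have B2 : I (fun x => wt (s / 2) x * q x * (wt (- s / 2) x * fsin psi x)) ^+ 2 <= M ^+ 2 * P.
  apply: le_trans C2 _; apply: ler_pM; rewrite ?sq//.
    exact: le_trans Bq H1.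
  exact: le_trans Bs IP.
move: B1 B2; move: (I _) (I _) (M ^+ 2 * P) => a b r.
by move=> h1 h2; exact: sqr_diff_le h2 h1.
Qed.

End sobolev_bounds.

(** * Evaluation of Frechet derivatives *)

Section evaluation.
Variable R : realType.
Implicit Types (X Y : lmodType R) (c p e d M s : R).

(** A bounded linear functional. It vanishes on vectors of norm 0, so applying it removes the
    ambiguity left by [linear_on], and derivatives become ordinary real numbers. *)
Definition bounded_ev Y (NY : Y -> \bar R) (ev : Y -> R) (c : R) :=
  [/\ forall a b, ev (a - b) = ev a - ev b, forall (a : R) y, ev (a *: y) = a * ev y &
      forall y M, 0 <= M -> (NY y <= M%:E)%E -> `|ev y| <= c * M].

Variables (X : lmodType R) (NX : X -> \bar R) (phi : X) (p : R).
Hypothesis p0 : 0 <= p.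
Hypothesis Hphi : forall s : R, (NX (s *: phi) <= (`|s| * p)%:E)%E.

Section one_space.
Variables (Y : lmodType R) (NY : Y -> \bar R) (ev : Y -> R) (c : R).
Hypothesis c0 : 0 <= c.
Hypothesis Hev : bounded_ev NY ev c.

Lemma evB a b : ev (a - b) = ev a - ev b. Proof. by have [] := Hev. Qed.
Lemma evZ (a : R) y : ev (a *: y) = a * ev y. Proof. by have [] := Hev. Qed.
Lemma evD a b : ev (a + b) = ev a + ev b.
Proof.
have E := evZ (-1) b; rewrite scaleN1r mulN1r in E.
by have := evB a (- b); rewrite E !opprK.
Qed.
Lemma ev_bd y M : 0 <= M -> (NY y <= M%:E)%E -> `|ev y| <= c * M.
Proof. by have [_ _] := Hev; apply. Qed.
Lemma ev_null y : NY y = 0%E -> ev y = 0.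
Proof.
move=> H; have := @ev_bd y 0 (lexx 0); rewrite H lexx mulr0 normr_le0 => /(_ isT).
by move/eqP.
Qed.

Lemma phi_fin (s : R) : (NX (s *: phi) < +oo)%E.
Proof. by apply: le_lt_trans (Hphi s) _; exact: ltry. Qed.

Lemma ev_linear L (s : R) : (opnorm NX NY L < +oo)%E -> ev (L (s *: phi)) = s * ev (L phi).
Proof.
move=> /ereal_inf_lt [_ [M [_ lin _] _] _].
have f0 : (NX 0 < +oo)%E by have := phi_fin 0; rewrite scale0r.
have f1 : (NX phi < +oo)%E by have := phi_fin 1; rewrite scale1r.
(* Additivity at [0 + 0], which holds up to a vector of norm 0. *)
have z : ev (L 0) = 0.
  have := ev_null (lin 1 0 0 f0 f0); rewrite evB evD evZ scaler0 addr0.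
  by move: (ev _) => w; lra.
have := ev_null (lin s phi 0 f1 f0); rewrite evB evD evZ addr0 z addr0 => /eqP.
by rewrite subr_eq0 => /eqP.
Qed.

(** The inductive step for higher derivatives: evaluation at [phi] followed by [ev] is a functional
    of the same kind on the operator space, so [frechet_isD] can be iterated. *)
Lemma ev_op : bounded_ev (opnorm NX NY) (fun L => ev (L phi)) (c * p).
Proof.
split => [a b|a y|L M M0 LM]; first exact: evB.
- exact: evZ.
apply/ler_addgt0Pr => e e0.
pose e1 := e / (c * p + 1).
have cp0 : 0 <= c * p by exact: mulr_ge0.
have e10 : 0 < e1 by rewrite divr_gt0// ltr_wpDl.
have /ereal_inf_lt [_ [M' [M'0 _ H] <-] M'M] : (opnorm NX NY L < (M + e1)%:E)%E.
  by apply: le_lt_trans LM _; rewrite lte_fin ltrDl.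
have f1 : (NX phi < +oo)%E by have := phi_fin 1; rewrite scale1r.
have h1 : (NX phi <= p%:E)%E by have := Hphi 1; rewrite scale1r normr1 mul1r.
have h2 : (NY (L phi) <= (M' * p)%:E)%E.
  by apply: le_trans (H _ f1) _; rewrite EFinM; apply: lee_wpmul2l.
apply: le_trans (ev_bd (mulr_ge0 M'0 p0) h2) _.
rewrite lte_fin in M'M.
apply: (@le_trans _ _ (c * p * (M + e1))).
  by rewrite -mulrA (mulrC p); apply: ler_wpM2l => //; apply: ler_wpM2r => //; exact: ltW.
have cp1 : 0 < c * p + 1 by rewrite ltr_wpDl.
rewrite mulrDr lerD2l /e1 mulrA ler_pdivrMr// mulrC; apply: ler_wpM2l; first exact: ltW.
by rewrite lerDl.
Qed.

Lemma frechet_isD (F : X -> Y) L (s : R) : frechet_derivative NX NY F (s *: phi) L ->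
  is_derive s 1 (fun s => ev (F (s *: phi))) (ev (L phi)).
Proof.
move=> [Lfin HL]; apply: isD_lim => e e0.
pose e1 := e / (c * p + 1).
have cp0 : 0 <= c * p by exact: mulr_ge0.
have cp1 : 0 < c * p + 1 by rewrite ltr_wpDl.
have e10 : 0 < e1 by rewrite divr_gt0.
have p1 : 0 < p + 1 by rewrite ltr_wpDl.
have [d d0 Hd] := HL e1 e10; exists (d / (p + 1)); first by rewrite divr_gt0.
move=> r; rewrite ltr_pdivlMr// => rd.
have r0 := normr_ge0 r.
have h : (NX (r *: phi) < d%:E)%E.
  apply: le_lt_trans (Hphi r) _; rewrite lte_fin; apply: le_lt_trans rd.
  by apply: ler_wpM2l => //; rewrite lerDl.
have h2 : (NY (F (s *: phi + r *: phi) - F (s *: phi) - L (r *: phi))%R <= (e1 * (`|r| * p))%:E)%E.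
  apply: le_trans (Hd _ h) _; rewrite (EFinM e1); apply: lee_wpmul2l => //.
  by rewrite lee_fin ltW.
have := ev_bd (mulr_ge0 (ltW e10) (mulr_ge0 r0 p0)) h2.
rewrite scalerDl !evB (ev_linear _ Lfin) => /le_trans; apply.
rewrite (_ : c * _ = c * p / (c * p + 1) * (e * `|r|)); last by rewrite /e1; field; rewrite gt_eqF.
have er0 : 0 <= e * `|r| by rewrite mulr_ge0// ltW.
by apply: ler_piMl => //; rewrite ler_pdivrMr// mul1r lerDl.
Qed.

End one_space.
End evaluation.

(** * Third derivative of a scalar function from a cubic expansion *)

Section third_order.
Variable R : realType.
Implicit Types (F Q : R -> R) (a b c d e r s t B C : R).

Lemma MVTn Q (Q' : R -> R) t : 0 < t ->
  (forall s, 0 <= s -> s <= t -> is_derive s 1 Q (Q' s)) ->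
  exists c, [/\ 0 < c, c < t & Q t - Q 0 = Q' c * t].
Proof.
move=> t0 dQ; have cf : {within `[0, t], continuous Q}.
  apply: derivable_within_continuous => c; rewrite in_itv/= => /andP[c0 ct].
  by have ? := dQ c c0 ct; exact: ex_derive.
have [|c] := @MVT R Q Q' 0 t t0 _ cf.
  by move=> x; rewrite in_itv/= => /andP[? ?]; apply: dQ; exact: ltW.
by rewrite in_itv/= => /andP[c0 ct] ->; exists c; split => //; rewrite subr0.
Qed.

Lemma isD_lim_inv Q t (l : R) : is_derive t 1 Q l ->
  forall e, 0 < e -> exists2 d : R, 0 < d & forall s, `|s| < d ->
     `|Q (t + s) - Q t - s * l| <= e * `|s|.
Proof.
move=> /is_derive1_caratheodory [g [Hg cg gl]] e e0.
have /cvgrPdist_le /(_ e e0) [d /= d0 Hd] := cg.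
exists d => // s sd; rewrite Hg (_ : t + s - t = s); last by ring.
rewrite mulrC -mulrBr normrM mulrC ler_wpM2r// distrC -gl; apply: Hd => /=.
by rewrite (_ : t - (t + s) = - s); [rewrite normrN|ring].
Qed.

Lemma third_algebra (F F' a s b k1 k2 w F3 eta C : R) :
  F - F' - 2 * a * s - F3 / 3 * w <= 2 * eta * w ->
  - (C * (s * w)) <= F - a * s - k1 * w ->
  F' - a * - s - k2 * - w <= C * (s * w) ->
  2 * C * s * w <= eta * w -> b * w <= k1 * w -> b * w <= k2 * w ->
  6 * b * w <= (F3 + 9 * eta) * w.
Proof.
rewrite (_ : 2 * a * s = 2 * (a * s)); last by ring.
rewrite (_ : F3 / 3 * w = (F3 * w) / 3); last by ring.
rewrite (_ : 2 * eta * w = 2 * (eta * w)); last by ring.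
rewrite (_ : a * - s = - (a * s)); last by ring.
rewrite (_ : k2 * - w = - (k2 * w)); last by ring.
rewrite (_ : 2 * C * s * w = 2 * (C * (s * w))); last by ring.
rewrite (_ : 6 * b * w = 6 * (b * w)); last by ring.
rewrite (_ : (F3 + _) * w = F3 * w + 9 * (eta * w)); last by ring.
move: (C * (s * w)) (a * s) (F3 * w) (eta * w) (b * w) (k1 * w) (k2 * w) => *; lra.
Qed.

(** [F2] is differentiable at 0 only, so Taylor's formula is rebuilt by two mean value steps, from
    [F2 s - F2 (- s)] to [F1 s + F1 (- s)] to [F s - F (- s)]. The odd difference removes even
    terms, and the coefficient [k] may vary with [s] since only its lower bound enters. *)
Lemma third_order F (F1 F2 : R -> R) (F3 r a b B C : R) : 0 < r -> 0 <= B -> 0 <= C ->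
  (forall s, `|s| < r -> is_derive s 1 F (F1 s)) ->
  (forall s, `|s| < r -> is_derive s 1 F1 (F2 s)) ->
  is_derive (0 : R) 1 F2 F3 ->
  (forall s, `|s| < r -> exists k, [/\ b <= k, `|k| <= B &
     `|F s - a * s - k * s ^+ 3| <= C * s ^+ 4]) ->
  6 * b <= F3.
Proof.
move=> r0 B0 C0 d1 d2 d3 H.
have FF0 : F 0 = 0.
  have z0 : `|0 : R| < r by rewrite normr0.
  have [k [_ _]] := H 0 z0.
  by rewrite !expr0n/= !mulr0 !subr0 normr_le0 => /eqP.
have F10 : F1 0 = a.
  have r00 : `|0 : R| < r by rewrite normr0.
  have D1 := d1 0 r00.
  (* The bound [B] serves here: it makes [k * s^3] negligible against [s], whatever the dependence
     of [k] on [s]. *)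
  have D2 : is_derive (0 : R) 1 F a.
    apply: isD_lim => e e0; pose K := B + C + 1.
    have K0 : 0 < K by rewrite /K; lra.
    exists (Num.min r (Num.min 1 (e / K))); first by rewrite !lt_min r0 ltr01 divr_gt0.
    move=> s; rewrite !lt_min => /and3P[sr s1 se].
    have [k [_ kB]] := H s sr; rewrite add0r FF0 subr0 (mulrC s).
    rewrite -(subrK (k * s ^+ 3) (F s - a * s)) => Hk.
    apply: le_trans (ler_normD _ _) _.
    move: se; rewrite ltr_pdivlMr// => se; have s0 := normr_ge0 s.
    have q1 : `|k * s ^+ 3| <= B * `|s| ^+ 3 by rewrite normrM normrX ler_wpM2r// exprn_ge0.
    have q2 : C * s ^+ 4 = C * `|s| ^+ 4.
      by rewrite -[in RHS]normrX ger0_norm// (_ : s ^+ 4 = (s ^+ 2) ^+ 2); [exact: sqr_ge0|ring].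
    rewrite addrK in Hk; rewrite q2 in Hk.
    apply: le_trans (lerD Hk q1) _.
    move: (`|s|) s0 s1 se => z z0 z1 ze.
    have zz : z * z <= z by rewrite ler_piMl// ltW.
    have zzz : z * z * z <= z * z by rewrite ler_piMr ?mulr_ge0// ltW.
    have : C * z ^+ 4 + B * z ^+ 3 <= (C + B) * (z * z).
      rewrite mulrDl; apply: lerD; apply: ler_wpM2l => //.
        rewrite (_ : z ^+ 4 = (z * z * z) * z); last by ring.
        by apply: le_trans zzz; rewrite ler_piMr ?mulr_ge0// ltW.
      by rewrite (_ : z ^+ 3 = z * z * z); last by ring.
    move/le_trans; apply; rewrite mulrA; apply: ler_wpM2r => //.
    by apply: le_trans (ltW ze); rewrite mulrC; apply: ler_wpM2l => //; rewrite /K; lra.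
  by rewrite -(@derive_val _ _ _ _ _ _ _ D1) -(@derive_val _ _ _ _ _ _ _ D2).
apply/ler_addgt0Pr => e e0.
(* Comparing the two expansions gives [2 b <= F3 / 3 + 3 eta]: [2 eta] comes from the mean value
   steps and [eta] from the quartic remainders. *)
pose eta : R := e / 9; have eta0 : 0 < eta by rewrite divr_gt0.
have [d d0 Hd] := isD_lim_inv d3 eta0.
pose s : R := Num.min (Num.min d r) (eta / (2 * (C + 1))) / 2.
have C1 : 0 < 2 * (C + 1) by lra.
have s0 : 0 < s by rewrite divr_gt0// !lt_min d0 r0 divr_gt0.
have sC : 2 * C * s <= eta.
  have : s <= eta / (2 * (C + 1)).
    rewrite /s; apply: (@le_trans _ _ (Num.min (Num.min d r) (eta / (2 * (C + 1))))).
      by rewrite ler_pdivrMr// ler_peMr ?ler1n// !le_min !ltW// divr_gt0.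
    by rewrite ge_min lexx orbT.
  rewrite ler_pdivlMr// => h; nra.
have mdr : s * 2 <= Num.min d r by rewrite /s divfK// ge_min lexx.
have [sd sr] : s < d /\ s < r by move: mdr; rewrite le_min => /andP[h1 h2]; split; lra.
have nn (x : R) : 0 <= x -> x <= s -> `|x| < r /\ `|- x| < r.
  by move=> x0 xs; rewrite normrN ger0_norm//; split; exact: le_lt_trans sr.
have opp (x : R) : is_derive x 1 (fun y : R => - y) (- 1 : R) by isD_tac.
have dN (G G' : R -> R) (x : R) : is_derive (- x) 1 G (G' (- x)) -> is_derive x 1 (fun y => G (- y)) (- G' (- x)).
  by move=> h; apply: isD_eq (@isD_comp R G (fun y => - y) x _ _ h (opp x)) _; ring.
have b2 (x : R) : 0 < x -> x < s -> F2 x - F2 (- x) - 2 * F3 * x <= 2 * eta * x.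
  move=> x0 xs; have := Hd x; have := Hd (- x); rewrite !add0r normrN (gtr0_norm x0).
  have xd : x < d by exact: lt_trans sd.
  move=> /(_ xd) + /(_ xd); rewrite !ler_norml => /andP[h1 _] /andP[_ h2]; lra.
have b1 (x : R) : 0 < x -> x <= s -> F1 x + F1 (- x) - 2 * F1 0 - F3 * x ^+ 2 <= 2 * eta * x ^+ 2.
  move=> x0 xs.
  have [|c [c0 cx E]] := @MVTn (fun x => F1 x + F1 (- x) - 2 * F1 0 - F3 * x ^+ 2)
     (fun x => F2 x - F2 (- x) - 2 * F3 * x) x x0.
    move=> y y0 yx; have [n1 n2] := nn y y0 (le_trans yx xs).
    have e1 := d2 y n1; have e2 := dN F1 F2 y (d2 (- y) n2).
    by isD_tac; rewrite /=; ring.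
  move: E; rewrite /= oppr0 expr0n/= mulr0 subr0 (_ : F1 0 + F1 0 - 2 * F1 0 = 0); last by ring.
  rewrite subr0 => ->.
  have := b2 c c0 (lt_le_trans cx xs) => h.
  apply: (@le_trans _ _ (2 * eta * c * x)); first by rewrite ler_wpM2r// ltW.
  rewrite -mulrA expr2; apply: ler_wpM2l; first by rewrite mulr_ge0// ltW.
  by apply: ler_wpM2r; exact: ltW.
have b0 : F s - F (- s) - 2 * F1 0 * s - F3 / 3 * s ^+ 3 <= 2 * eta * s ^+ 3.
  have [|c [c0 cx E]] := @MVTn (fun x => F x - F (- x) - 2 * F1 0 * x - F3 / 3 * x ^+ 3)
     (fun x => F1 x + F1 (- x) - 2 * F1 0 - F3 * x ^+ 2) s s0.
    move=> y y0 yx; have [n1 n2] := nn y y0 yx.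
    have e1 := d1 y n1; have e2 := dN F F1 y (d1 (- y) n2).
    by isD_tac; rewrite /=; field.
  move: E; rewrite /= oppr0 expr0n/= !mulr0 !subr0 subrr subr0 => ->.
  have := b1 c c0 (ltW cx) => h.
  apply: (@le_trans _ _ (2 * eta * c ^+ 2 * s)); first by rewrite ler_wpM2r// ltW.
  rewrite -mulrA (_ : s ^+ 3 = s ^+ 2 * s); last by ring.
  apply: ler_wpM2l; first by rewrite mulr_ge0// ltW.
  have c0' := ltW c0; have s0' := ltW s0; have cx' := ltW cx.
  by apply: ler_wpM2r => //; rewrite lerXn2r ?nnegrE.
have [n1 n2] := nn s (ltW s0) (lexx s).
have [k1 [bk1 _ H1]] := H s n1; have [k2 [bk2 _ H2]] := H (- s) n2.
have s3 : 0 < s ^+ 3 by exact: exprn_gt0.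
have fin : (6 * b) * s ^+ 3 <= (F3 + e) * s ^+ 3.
  move: H1 H2; rewrite !ler_norml => /andP[H1 _] /andP[_ H2].
  rewrite F10 in b0.
  have k1s := ler_wpM2r (ltW s3) bk1; have k2s := ler_wpM2r (ltW s3) bk2.
  have C4 := ler_wpM2r (ltW s3) sC.
  have eE : e = 9 * eta by rewrite /eta; field.
  rewrite eE.
  move: b0 H1 H2 C4 k1s k2s.
  rewrite (_ : (- s) ^+ 3 = - s ^+ 3); last by ring.
  rewrite (_ : (- s) ^+ 4 = s * s ^+ 3); last by ring.
  rewrite (_ : s ^+ 4 = s * s ^+ 3); last by ring.
  exact: third_algebra.
by rewrite ler_pM2r in fin.
Qed.

End third_order.

(** * Scalar derivatives of a C^3 map along a line *)

Section C3_maps.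
Variable R : realType.
Implicit Types (c p M K s r : R).

(** [K] bounds the third derivative at 0 and is fixed before [phi] and [ev], both of which will
    depend on [N]. *)
Lemma C3_expansion (X Y : lmodType R) (NX : X -> \bar R) (NY : Y -> \bar R) (Phi : X -> Y) :
  (NX 0%R <= 0%:E)%E -> Cn_at_origin 3 NX NY Phi ->
  exists K, 0 <= K /\ forall phi p ev c, 0 <= p -> 0 <= c ->
    (forall s, (NX (s *: phi) <= (`|s| * p)%:E)%E) -> bounded_ev NY ev c ->
    exists r (F1 F2 : R -> R) F3, [/\ 0 < r,
      forall s, `|s| < r -> is_derive s 1 (fun s => ev (Phi (s *: phi))) (F1 s),
      forall s, `|s| < r -> is_derive s 1 F1 (F2 s),
      is_derive (0 : R) 1 F2 F3 & F3 <= c * p * p * p * K].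
Proof.
move=> NX0 [D1 [[r1 r10 H1] [D2 [[r2 r20 H2] [D3 [[r3 r30 H3] _]]]]]].
have NX0r r : 0 < r -> (NX 0%R < r%:E)%E.
  by move=> r0; apply: le_lt_trans NX0 _; rewrite lte_fin.
have [/ereal_inf_lt [_ [K [K0 _ HK] <-] _] _] := H3 0 (NX0r _ r30).
exists K; split => // phi p ev c p0 c0 Hphi Hev.
have ev1 := ev_op p0 Hphi c0 Hev; have c1 := mulr_ge0 c0 p0.
have ev2 := ev_op p0 Hphi c1 ev1; have c2 := mulr_ge0 c1 p0.
have ev3 := ev_op p0 Hphi c2 ev2; have c3 := mulr_ge0 c2 p0.
have small r s : 0 < r -> `|s| < r / (p + 1) -> (NX (s *: phi) < r%:E)%E.
  move=> r0; rewrite ltr_pdivlMr ?ltr_wpDl// => h.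
  apply: le_lt_trans (Hphi s) _; rewrite lte_fin; apply: le_lt_trans h.
  by apply: ler_wpM2l => //; rewrite lerDl.
exists (Num.min r1 r2 / (p + 1)), (fun s => ev (D1 (s *: phi) phi)),
  (fun s => ev (D2 (s *: phi) phi phi)), (ev (D3 (0 *: phi) phi phi phi)); split.
- by rewrite divr_gt0 ?ltr_wpDl// lt_min r10.
- move=> s sr; apply: (frechet_isD p0 Hphi c0 Hev); apply: H1; apply: small => //.
  by apply: lt_le_trans sr _; rewrite ler_pM2r ?invr_gt0 ?ltr_wpDl// ge_min lexx.
- move=> s sr; apply: (frechet_isD p0 Hphi c1 ev1); apply: H2; apply: small => //.
  by apply: lt_le_trans sr _; rewrite ler_pM2r ?invr_gt0 ?ltr_wpDl// ge_min lexx orbT.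
- apply: (frechet_isD p0 Hphi c2 ev2); apply: H3.
  by rewrite scale0r; exact: NX0r.
- apply: le_trans (ler_norm _) _; rewrite scale0r.
  have f1 : (NX phi < +oo)%E by have := phi_fin Hphi 1; rewrite scale1r.
  have h1 : (NX phi <= p%:E)%E by have := Hphi 1; rewrite scale1r normr1 mul1r.
  have h2 : (opnorm NX (opnorm NX NY) (D3 0%R phi) <= (K * p)%:E)%E.
    by apply: le_trans (HK _ f1) _; rewrite (EFinM K); apply: lee_wpmul2l.
  apply: le_trans (ev_bd ev2 (mulr_ge0 K0 p0) h2) _.
  by rewrite le_eqVlt; apply/orP; left; apply/eqP; ring.
Qed.

End C3_maps.

(** * The datum and the test function in Sobolev norms *)

Section expansion.
Variable R : realType.
Notation mu := (@lebesgue_measure R).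
Implicit Types (f g m k l A B : R -> R) (a b c d t s x y z xi e C M : R).
Variables delta T s t0 N : R.
Hypothesis delta0 : 0 < delta.
Hypothesis t00 : 0 < t0.
Hypothesis t0T : t0 <= T.
Hypothesis N1 : 1 <= N.

Lemma ht_packetE x : ht (packet N) x = gauss 1 x * cos (2 * pi * N * x).
Proof.
have f0 : flow delta (packet N) 0 = packet N by apply/funext => xi; exact: flow0.
rewrite -[in LHS]f0 ht_packet.
have -> : wave delta N 0 x = lwave delta N 0 x.
  by rewrite /wave /lwave; apply: eq_I => xi; rewrite /lph !mul0r.
by rewrite lwaveE// /carrier /wshift !mul0r mulr0 addr0 subr0 mulrC.
Qed.

Lemma packet_even xi : packet N (- xi) = packet N xi.
Proof. by rewrite /packet /symm opprK (addrC (gs N (- xi))). Qed.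

Lemma wt_packet r : Int (fun x => wt r x * packet N x ^+ 2) /\
  I (fun x => wt r x * packet N x ^+ 2) <= I (fun x => wt r x * (gs N x + gs N (- x))).
Proof.
apply: wt_dom => [|x|x]; last exact: sqr_ge0.
  by apply: measX; exact: (X4_Int (nice_X4 (nice_packet N))).2.1.
rewrite /packet /symm subr0 addr0.
have := gs_ge0 N x; have := gs_ge0 N (- x); have := gs_le1 N x; have := gs_le1 N (- x).
by move: (gs N x) (gs N (- x)) => a b *; nra.
Qed.

Definition hs_packet := Num.sqrt (I (fun x => wt s x * packet N x ^+ 2)).

Lemma scaled_fourier r e : has_fourier r (dist_of (fun x => e * ht (packet N) x)) (fun x => Complex (e * packet N x) 0) /\
  weighted_norm r (fun x => Complex (e * packet N x) 0) =
    (`|e| * Num.sqrt (I (fun x => wt r x * packet N x ^+ 2)))%:E.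
Proof.
have [Ip Lp] := X4_Int (nice_X4 (nice_packet N)).
have [Iw _] := wt_packet r.
have E x : e ^+ 2 * (wt r x * packet N x ^+ 2) = wt r x * (e * packet N x) ^+ 2 by ring.
have Iw' := eq_Int E (IntZ (e ^+ 2) Iw).
have [|H1 H2] := has_fourier_even (IntZ e Ip) (L2Z e Lp) _ Iw'.
  by move=> x; rewrite packet_even.
split; first by move: H1; congr has_fourier; congr dist_of; apply/funext => x; rewrite htZ.
rewrite H2 -(eq_I E) (IZ _ Iw); congr EFin.
by rewrite sqrtrM ?sqr_ge0// sqrtr_sqr.
Qed.

Lemma dist_scale e : e *: dist_of (ht (packet N)) = dist_of (fun x => e * ht (packet N) x) :> rdistribution R.
Proof.
apply/funext => psi; have [Ip Lp] := X4_Int (nice_X4 (nice_packet N)).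
have J := L2M (L2_ht Ip Lp) (schwartz_L2 psi).
rewrite /dist_of -!/(I _) -[LHS]/(e * I _) -(IZ e J).
by apply: eq_I => x; rewrite mulrA.
Qed.

Lemma Hs_packet e : (Hs_norm s (e *: dist_of (ht (packet N)) : rdistribution R) <= (`|e| * hs_packet)%:E)%E.
Proof.
by rewrite dist_scale; have [H1 <-] := scaled_fourier s e; exact: fourier_weight.
Qed.

Lemma Hinfty_packet e : Hinfty (fun x => e * ht (packet N) x).
Proof.
split; last first.
  move=> r; have [H1 H2] := scaled_fourier r e.
  by apply: le_lt_trans (fourier_weight H1) _; rewrite H2 ltry.
have C := gclass_scale e (gclass_cos (2 * pi * N) 0 0 0).
have := @schwartz_smooth R (gclass_schwartz C); congr smooth; apply/funext => x /=.
by rewrite ht_packetE expr0 mul1r !addr0.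
Qed.

Lemma wave_sqr (u v p q : R) : 0 <= p -> p <= 1 -> 0 <= q -> q <= 1 -> `|u| <= 1 -> `|v| <= 1 ->
  (- 2^-1 * (u * q + v * p)) ^+ 2 <= (p + q) / 2.
Proof.
move=> p0 p1 q0 q1 hu hv.
have h : `|u * q + v * p| <= q + p.
  apply: le_trans (ler_normD _ _) _; rewrite !normrM (ger0_norm p0) (ger0_norm q0).
  by apply: lerD; rewrite ler_piMl.
have {h} : (u * q + v * p) ^+ 2 <= (q + p) ^+ 2.
  by rewrite -(real_normK (num_real (_ + _))) lerXn2r ?nnegrE// addr_ge0.
by move: (u * q + v * p) => w; nra.
Qed.

(** A Gaussian times a sine has for transform two Gaussians centred at [N] and [- N] with
    coefficients of modulus at most 1/2. The shift [wshift], which grows with [N], affects only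
    their phases. *)
Lemma probe_schwartz : exists psi : schwartz R, [/\ forall x, psi x = Psi delta (probe delta N t0) t0 x,
   forall x, fcos psi x ^+ 2 <= (gs N x + gs N (- x)) / 2 &
   forall x, fsin psi x ^+ 2 <= (gs N x + gs N (- x)) / 2].
Proof.
pose c := wshift delta N t0; pose b := 2 * pi * N; pose d := b * c - 4 * pi ^+ 2 * N ^+ 2 * t0.
have C := gclass_scale (-1) (gclass_sin b c d 0).
pose psi := gclass_schwartz C.
have psiE x : psi x = - (gauss 1 (x + c) * sin (b * x + d)).
  by rewrite /psi /= expr0 mul1r mulN1r.
have pi0 := pi_gt0 R.
have Js p q : Int (fun x => gauss 1 (x + c) * sin (p * x + q)).
  have := Int_shift c (Int_gauss_sin p (q - p * c) (ltr01 : 0 < 1 :> R)).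
  by apply: eq_Int => x; congr (_ * sin _); ring.
have Jc p q : Int (fun x => gauss 1 (x + c) * cos (p * x + q)).
  have := Int_shift c (Int_gauss_cos p (q - p * c) (ltr01 : 0 < 1 :> R)).
  by apply: eq_Int => x; congr (_ * cos _); ring.
have gp x : gauss 1 ((b + 2 * pi * x) / (2 * pi)) = gs N (- x).
  rewrite /gs -gaussN; congr gauss; rewrite /b; move: pi0; move: (pi : R) => q q0.
  by field; rewrite gt_eqF.
have gm x : gauss 1 ((b - 2 * pi * x) / (2 * pi)) = gs N x.
  rewrite /gs -gaussN; congr gauss; rewrite /b; move: pi0; move: (pi : R) => q q0.
  by field; rewrite gt_eqF.
have bnd (u v x : R) : `|u| <= 1 -> `|v| <= 1 ->
    (- 2^-1 * (u * gs N (- x) + v * gs N x)) ^+ 2 <= (gs N x + gs N (- x)) / 2.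
  have := gs_ge0 N x; have := gs_ge0 N (- x); have := gs_le1 N x; have := gs_le1 N (- x).
  move: (gs N x) (gs N (- x)) => p q *; exact: wave_sqr.
exists psi; split => x.
- rewrite psiE Psi_probe //.
  by rewrite mulrC /carrier /d /b /c; congr (- (sin _ * _)); ring.
- rewrite (_ : fcos psi x = - 2^-1 * (sin (d - (b + 2 * pi * x) * c) * gs N (- x) +
     sin (d - (b - 2 * pi * x) * c) * gs N x)); first by apply: bnd; exact: norm_sin_le1.
  rewrite -gp -gm -!gauss_shift_sin -(ID (Js _ _) (Js _ _)) -(IZ _ (IntD (Js _ _) (Js _ _))).
  apply: eq_I => y; rewrite psiE.
  have -> : (b + 2 * pi * x) * y + d = (b * y + d) + 2 * pi * y * x by ring.
  have -> : (b - 2 * pi * x) * y + d = (b * y + d) - 2 * pi * y * x by ring.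
  move: (b * y + d) (2 * pi * y * x) (gauss _ _) => A Z w; rewrite sinD sinB; by field.
- rewrite (_ : fsin psi x = - 2^-1 * ((- cos (d - (b + 2 * pi * x) * c)) * gs N (- x) +
     cos (d - (b - 2 * pi * x) * c) * gs N x)); first by apply: bnd; rewrite ?normrN; exact: norm_cos_le1.
  rewrite -gp -gm (mulNr (cos _)) -!gauss_shift_cos (addrC (- I _)) -(IB (Jc _ _) (Jc _ _)) -(IZ _ (IntB (Jc _ _) (Jc _ _))).
  apply: eq_I => y; rewrite psiE.
  have -> : (b + 2 * pi * x) * y + d = (b * y + d) + 2 * pi * y * x by ring.
  have -> : (b - 2 * pi * x) * y + d = (b * y + d) - 2 * pi * y * x by ring.
  move: (b * y + d) (2 * pi * y * x) (gauss _ _) => A Z w; rewrite cosB cosD; by field.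
Qed.

End expansion.

(** * Ill-posedness *)

Section illposedness.
Variable R : realType.
Notation mu := (@lebesgue_measure R).
Implicit Types (f g : R -> R) (a b c d t s x y z xi e C M N P : R).

(** The functional through which the flow map is observed: value at time [t0], tested against [psi].
    The norm [2 sqrt P] is the square root of the bound in [pairing_bound]. *)
Lemma CHs_eval T s t0 (psi : schwartz R) P : 0 <= t0 <= T -> 0 <= P ->
  Int (fun x => wt (- s) x * (fcos psi x ^+ 2 + fsin psi x ^+ 2)) ->
  I (fun x => wt (- s) x * (fcos psi x ^+ 2 + fsin psi x ^+ 2)) <= P ->
  bounded_ev (@CHs_norm R T s) (fun v : R -> rdistribution R => v t0 psi) (2 * Num.sqrt P).
Proof.
move=> tT P0 Iw IP; split => // v M M0 yM.
have c0 : 0 <= 2 * Num.sqrt P by rewrite mulr_ge0// sqrtr_ge0.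
apply/ler_addgt0Pr => e e0.
pose c1 := 2 * Num.sqrt P + 1; have c10 : 0 < c1 by rewrite ltr_wpDl.
pose M1 := M + e / c1.
have ec : 0 < e / c1 by rewrite divr_gt0.
have M1M : M < M1 by rewrite ltrDl.
have M10 : 0 <= M1 by rewrite ltW// (le_lt_trans M0).
have /ereal_inf_lt [_ [M' [M'0 _ H] <-] M'M] : (CHs_norm T s v < M1%:E)%E.
  by apply: le_lt_trans yM _; rewrite lte_fin.
have h : (Hs_norm s (v t0) < M1%:E)%E.
  by apply: le_lt_trans M'M; apply: H; rewrite in_itv.
have := pairing_bound M10 Iw IP h => h2.
apply: (@le_trans _ _ (2 * Num.sqrt P * M1)).
  have r0 : 0 <= 2 * Num.sqrt P * M1 by exact: mulr_ge0.
  rewrite -(ler_pXn2r (n := 2))// ?nnegrE// real_normK ?num_real//.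
  apply: le_trans h2 _; rewrite exprMn exprMn sqr_sqrtr//.
  by rewrite le_eqVlt; apply/orP; left; apply/eqP; ring.
rewrite /M1 mulrDr lerD2l mulrA ler_pdivrMr// mulrC; apply: ler_wpM2l; first exact: ltW.
by rewrite /c1 lerDl.
Qed.

Section solution_map.
Variables delta T s t0 N : R.
Hypothesis delta0 : 0 < delta.
Hypothesis t00 : 0 < t0.
Hypothesis t0T : t0 <= T.
Hypothesis N1 : 1 <= N.
Variables (U : set (rdistribution R)) (Phi : rdistribution R -> (R -> rdistribution R)).
Hypothesis HU : Hs_neighborhood_of_0 s U.
Hypothesis HPhi : solution_map delta T s U Phi.

Notation probe := (probe delta N t0).
Notation phi := (dist_of (ht (packet N)) : rdistribution R).

(** The radius only ensures that the datum lies in [U]. The coefficient is taken at the intermediate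
    time of [Q_MVT], which depends on [e]; [packet_lower] bounds it below on all of [[0, t0]]. *)
Lemma solution_expansion (psi : schwartz R) :
  (forall x, psi x = Psi delta probe t0 x) ->
  t0 * (3 * (wA delta * wC R) + wB delta) <= 24^-1 -> 2 * pi * mom R 1 <= 24^-1 * N ->
  exists r a B C : R, [/\ 0 < r, 0 <= B, 0 <= C & forall e, `|e| < r -> exists k : R,
    [/\ t0 * (N / 36) <= k, `|k| <= B &
     `|Phi (e *: phi) t0 psi - a * e - k * e ^+ 3| <= C * e ^+ 4]].
Proof.
move=> psiE h1 h2.
have [_ [r r0 Hr]] := HU; have [_ Hsol] := HPhi.
have T0 : 0 < T by exact: lt_le_trans t0T.
have nP := nice_packet N; have nB := nice_probe delta N t0.
have [C C0 HC] := cubic_asymptotics delta0 T0 nP nB.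
have [B1 B10 HB1] := flow_sup delta nP; have [B2 B20 HB2] := flow_sup delta nB.
pose m := pr (ht (packet N)) (ht (packet N)).
have m0 : 0 <= m by exact: pr_ge0.
have cub c : 0 <= c -> `|pr (fun x => ht (flow delta (packet N) c) x ^+ 3) (Psix delta probe c)| <= B1 * B2 * m.
  move=> c0; have Lv := v_L2 delta c nP; have Lx := vx_L2 delta c nB.
  have Lv2 := v_L2sq delta c nP.
  have J := L2M Lv Lv.
  rewrite /m -(flow_pair delta0 nP nP c0) /pr -(IZ _ J).
  apply: norm_I_le; [|exact: IntZ|move=> x].
    by apply: measM; [apply: measX; exact: Lv.1|exact: Lx.1].
  have [b1 _] := HB1 c x; have [_ b2] := HB2 c x.
  rewrite normrM normrX exprS -expr2 -(real_normK (num_real (ht (flow delta (packet N) c) x))).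
  rewrite [leRHS](_ : _ = (B1 * `|ht (flow delta (packet N) c) x| ^+ 2) * B2); last by ring.
  by apply: ler_pM => //; apply: ler_wpM2r => //; exact: exprn_ge0.
have hs0 : 0 <= hs_packet s N by exact: sqrtr_ge0.
have hs1 : 0 < hs_packet s N + 1 by rewrite ltr_wpDl.
exists (r / (hs_packet s N + 1)), (pr (ht (packet N)) (Psi delta probe 0)),
  (t0 * (3^-1 * (B1 * B2 * m))), (t0 * (3^-1 * C)); split.
- by rewrite divr_gt0.
- by rewrite !mulr_ge0// ltW.
- by rewrite !mulr_ge0// ltW.
move=> e; rewrite ltr_pdivlMr// => er.
have Ue : U (e *: phi).
  apply: Hr; apply: le_lt_trans (Hs_packet s N e) _; rewrite lte_fin.
  by apply: le_lt_trans er; apply: ler_wpM2l => //; rewrite lerDl.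
have [|u Hu Pu] := Hsol _ (Hinfty_packet N delta0 e).
  by rewrite -dist_scale.
have [h Sd hE] := classical_solution_data delta0 T0 Hu.
have I0 : (0 : R) <= 0 <= T by apply/andP; split; [exact: lexx|exact: ltW].
have H0 x : ht (h 0) x = e * ht (packet N) x.
  by rewrite -hE//; have [-> _ _ _] := Hu.
have [c [c0 ct E]] := Q_MVT delta0 Sd nB t00 t0T.
have cT : 0 <= c <= T by rewrite ltW//= (le_trans (ltW ct)).
have ct0 : 0 <= c <= t0 by rewrite !ltW.
have t0I : 0 <= t0 <= T by rewrite ltW.
have V : Phi (e *: phi) t0 psi = pr (ht (h t0)) (Psi delta probe t0).
  rewrite dist_scale Pu; last by rewrite in_itv.
  by rewrite /dist_of; apply: eq_I => x; rewrite hE// psiE.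
have i0 : pr (ht (h 0)) (Psi delta probe 0) = pr (ht (packet N)) (Psi delta probe 0) * e.
  rewrite /pr -IZr; last by exact: L2M (L2_ht (X4_Int (nice_X4 nP)).1 (X4_Int (nice_X4 nP)).2) (v_L2 delta 0 nB).
  by apply: eq_I => x; rewrite H0; ring.
have low := packet_lower delta0 N1 (ltW t00) ct0 h1 h2.
have up := cub c (ltW c0); have asy := HC e h Sd H0 c cT.
exists (t0 * (- 3^-1 * pr (fun x => ht (flow delta (packet N) c) x ^+ 3) (Psix delta probe c))); split.
- by apply: ler_wpM2l; [exact: ltW|exact: low].
- rewrite mulNr mulrN normrN !normrM (gtr0_norm t00) ger0_norm//.
  by rewrite !ler_wpM2l// ltW.
- move: E asy; rewrite V i0.
  move: (pr (ht (h t0)) _) (pr (ht (packet N)) _ * e) (pr _ (Psix delta probe c)) (pr _ (Psix delta probe c)).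
  move=> v z q p E asy.
  rewrite (_ : _ - _ = t0 * (- 3^-1 * (p - e ^+ 3 * q))); last first.
    by rewrite E; ring.
  rewrite normrM (gtr0_norm t00) -mulrA; apply: ler_wpM2l; first exact: ltW.
  have i3 : `|- 3^-1 : R| = 3^-1 by rewrite normrN ger0_norm// invr_ge0.
  by rewrite normrM i3 -(mulrA 3^-1 C); apply: ler_wpM2l => //; rewrite invr_ge0.
Qed.

(** The third derivative is six times the cubic coefficient, whence [6 * t0 * N / 36] on the
    left. *)
Lemma third_bound K : 0 <= K ->
  (forall (phi : rdistribution R) p ev c, 0 <= p -> 0 <= c ->
    (forall s', (Hs_norm s (s' *: phi) <= (`|s'| * p)%:E)%E) -> bounded_ev (@CHs_norm R T s) ev c ->
    exists r (F1 F2 : R -> R) F3, [/\ 0 < r,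
      forall s, `|s| < r -> is_derive s 1 (fun s => ev (Phi (s *: phi))) (F1 s),
      forall s, `|s| < r -> is_derive s 1 F1 (F2 s),
      is_derive (0 : R) 1 F2 F3 & F3 <= c * p * p * p * K]) ->
  t0 * (3 * (wA delta * wC R) + wB delta) <= 24^-1 -> 2 * pi * mom R 1 <= 24^-1 * N ->
  t0 * N / 6 <= 2 * Num.sqrt (I (fun x => wt (- s) x * (gs N x + gs N (- x)))) *
    hs_packet s N * hs_packet s N * hs_packet s N * K.
Proof.
move=> K0 HK h1 h2.
have [psi [psiE pc ps]] := probe_schwartz t0 N delta0.
have mc := meas_fcos psi; have ms := meas_fsin psi.
have [Iw IP] : Int (fun x => wt (- s) x * (fcos psi x ^+ 2 + fsin psi x ^+ 2)) /\
    I (fun x => wt (- s) x * (fcos psi x ^+ 2 + fsin psi x ^+ 2)) <=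
    I (fun x => wt (- s) x * (gs N x + gs N (- x))).
  apply: wt_dom => [|x|x].
  - by apply: measD; apply: measX.
  - by have := lerD (pc x) (ps x); rewrite -splitr.
  - by apply: addr_ge0; exact: sqr_ge0.
set P := I (fun x => wt (- s) x * (gs N x + gs N (- x))) in IP *.
have P0 : 0 <= P.
  apply: I_ge0 => x; apply: mulr_ge0; first exact: wt_ge0.
  by apply: addr_ge0; exact: gs_ge0.
have t0I : 0 <= t0 <= T by rewrite ltW.
have Hev := CHs_eval t0I P0 Iw IP.
have c0 : 0 <= 2 * Num.sqrt P by rewrite mulr_ge0// sqrtr_ge0.
have [r [F1 [F2 [F3 [r0 d1 d2 d3 d4]]]]] := HK phi (hs_packet s N) _ _ (sqrtr_ge0 _) c0 (Hs_packet s N) Hev.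
have [r' [a [B [C [r0' B0 C0 H]]]]] := solution_expansion psiE h1 h2.
apply: le_trans d4; rewrite (_ : t0 * N / 6 = 6 * (t0 * (N / 36))); last by field.
apply: (@third_order R (fun e => Phi (e *: phi) t0 psi) F1 F2 F3 (Num.min r r') a _ B C) => //.
- by rewrite lt_min r0.
- by move=> e; rewrite lt_min => /andP[er _]; exact: d1.
- by move=> e; rewrite lt_min => /andP[er _]; exact: d2.
- by move=> e; rewrite lt_min => /andP[_ er]; exact: H.
Qed.

End solution_map.

(** With [al = 1 - 2 s > 0], [W N] is [W N ^ al] times [wt s N ^ 2], and the first factor exceeds
    any constant; moreover [W N <= 2 N^2]. This is where [s < 1/2] enters. *)
Lemma growth s A B N0 : s < 1 / 2 -> 0 < A -> 0 <= B -> 1 <= N0 ->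
  exists2 N, N0 <= N & B * wt s N ^+ 2 < A * N ^+ 2.
Proof.
move=> s12 A0 B0 N01; pose al := 1 - s * 2; have al0 : 0 < al by rewrite /al; lra.
pose K := 2 * B / A + 1; have K0 : 1 <= K by rewrite lerDr divr_ge0 ?mulr_ge0// ltW.
pose N := Num.max N0 (K `^ al^-1).
have NN0 : N0 <= N by rewrite le_max lexx.
have N1 : 1 <= N by exact: le_trans N01 NN0.
have NK : K `^ al^-1 <= N by rewrite le_max lexx orbT.
exists N => //.
have w0 := W_gt0 N.
have wK : K <= W N `^ al.
  have -> : K = (K `^ al^-1) `^ al.
    by rewrite -powRrM mulVf ?gt_eqF// powRr1// (le_trans ler01).
  apply: ge0_ler_powR; rewrite ?nnegrE ?powR_ge0 ?ltW//.
  by apply: lt_le_trans (_ : _ < 1 + K `^ al^-1) _; [rewrite ltrDr|rewrite /W lerD2l; nra].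
have E : W N = W N `^ al * wt s N ^+ 2.
  rewrite /wt -powR_mulrn ?powR_ge0// -powRrM -powRD; last by rewrite (gt_eqF w0) implybT.
  by rewrite /al subrK powRr1// ltW.
have t2 : 0 < wt s N ^+ 2 by rewrite exprn_gt0// wt_gt0.
have WN : W N <= 2 * N ^+ 2 by rewrite /W; nra.
have : K * wt s N ^+ 2 <= 2 * N ^+ 2.
  by apply: le_trans WN; rewrite [leRHS]E; apply: ler_wpM2r => //; exact: ltW.
have AK : A * K = 2 * B + A by rewrite /K; field; rewrite gt_eqF.
move=> h; have := ler_wpM2l (ltW A0) h; rewrite mulrA AK.
have := mulr_gt0 A0 t2.
by move: t2; move: (wt s N ^+ 2) (N ^+ 2) => p q *; nra.
Qed.

End illposedness.

Theorem theorem1p4 (R : realType) (c0 delta s : R)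
    (hc0 : 0 < c0) (hdelta : c0 <= delta) (hs : s < 1 / 2) :
  forall T : R, 0 < T ->
  ~ exists (U : set (rdistribution R))
           (Phi : rdistribution R -> (R -> rdistribution R)),
      [/\ Hs_neighborhood_of_0 s U,
          solution_map delta T s U Phi &
          Cn_at_origin 3 (@Hs_norm R s) (@CHs_norm R T s) Phi].
Proof.
move=> T T0 [U [Phi [HU HPhi HC]]].
have delta0 : 0 < delta by exact: lt_le_trans hc0 hdelta.
have NX0 : (Hs_norm s (0%R : rdistribution R) <= 0%:E)%E.
  by have := Hs_packet s 1 0; rewrite scale0r normr0 mul0r.
have [K [K0 HK]] := C3_expansion NX0 HC.
have [K1 K10 HK1] := wt_gs2 s; have [K2 K20 HK2] := wt_gs2 (- s).
pose Z := 3 * (wA delta * wC R) + wB delta.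
(* Depends on [T] and [delta] only, and makes the phase errors of [packet_lower] admissible. *)
pose t0 := Num.min T (24^-1 / (`|Z| + 1)).
have Z1 : 0 < `|Z| + 1 by rewrite ltr_wpDl.
have t00 : 0 < t0 by rewrite lt_min T0 divr_gt0// invr_gt0.
have t0T : t0 <= T by rewrite ge_min lexx.
have t0Z : t0 * Z <= 24^-1.
  have : t0 <= 24^-1 / (`|Z| + 1) by rewrite ge_min lexx orbT.
  rewrite ler_pdivlMr// => h; apply: le_trans h; apply: ler_wpM2l; first exact: ltW.
  by apply: le_trans (ler_norm Z) _; rewrite lerDl.
(* Beyond [N0], replacing [xi] by [N] in the slope is an admissible error. *)
pose N0 := Num.max 1 (24 * (2 * pi * mom R 1)).
have N01 : 1 <= N0 by rewrite le_max lexx.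
pose A := (t0 / 6) ^+ 2; have A0 : 0 < A by rewrite exprn_gt0// divr_gt0.
(* The inequality of [third_bound] is squared to remove the roots. The weights then combine as
   [wt (- s) N * wt s N ^ 3 = wt s N ^ 2], and the constants as [B]. *)
pose B := 4 * (K2 * K1 ^+ 3 * K ^+ 2).
have B0 : 0 <= B.
  by rewrite mulr_ge0// mulr_ge0 ?sqr_ge0// mulr_ge0// exprn_ge0.
have [N NN0 big] := growth hs A0 B0 N01.
have N1 : 1 <= N by exact: le_trans N01 NN0.
have mN : 2 * pi * mom R 1 <= 24^-1 * N.
  rewrite [24^-1 * N]mulrC ler_pdivlMr// [leLHS]mulrC; apply: le_trans NN0.
  by rewrite le_max lexx orbT.
have := third_bound delta0 t00 t0T N1 HU HPhi K0 HK t0Z mN.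
have [_ P2] := HK2 N; have [Iw Pw] := wt_packet N s; have [_ P1] := HK1 N.
set P := I (fun x => wt (- s) x * (gs N x + gs N (- x))) in P2 *; set p := hs_packet s N.
have P0 : 0 <= P.
  apply: I_ge0 => x; apply: mulr_ge0; first exact: wt_ge0.
  by apply: addr_ge0; exact: gs_ge0.
have p0 : 0 <= p by exact: sqrtr_ge0.
have p2 : p ^+ 2 <= K1 * wt s N.
  rewrite sqr_sqrtr; first exact: le_trans Pw P1.
  by apply: I_ge0 => x; apply: mulr_ge0; [exact: wt_ge0|exact: sqr_ge0].
have N0' : 0 <= N by exact: le_trans ler01 N1.
have tN : 0 <= t0 * N / 6 by rewrite divr_ge0// mulr_ge0// ltW.
move=> H.
have : (t0 * N / 6) ^+ 2 <= (2 * Num.sqrt P * p * p * p * K) ^+ 2.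
  by rewrite lerXn2r// nnegrE// (le_trans tN).
rewrite (_ : (t0 * N / 6) ^+ 2 = A * N ^+ 2); last by rewrite /A; field.
rewrite (_ : (2 * Num.sqrt P * p * p * p * K) ^+ 2 =
  4 * (Num.sqrt P ^+ 2 * (p ^+ 2) ^+ 3 * K ^+ 2)); last by ring.
rewrite sqr_sqrtr// leNgt => /negP; apply; apply: le_lt_trans big.
rewrite /B -[leRHS]mulrA; apply: ler_wpM2l => //.
have e1 := wtM s N; have w0 := wt_gt0 s N; have w0' := wt_gt0 (- s) N.
rewrite [leRHS](_ : _ = (K2 * wt (- s) N) * (K1 * wt s N) ^+ 3 * K ^+ 2); last first.
  rewrite (_ : K2 * wt (- s) N * _ * _ = (wt s N * wt (- s) N) * (K2 * K1 ^+ 3 * K ^+ 2 * wt s N ^+ 2)); last by ring.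
  by rewrite e1 mul1r.
apply: ler_wpM2r; first exact: sqr_ge0.
apply: ler_pM => //; first by rewrite exprn_ge0// sqr_ge0.
by rewrite lerXn2r// nnegrE ?sqr_ge0// mulr_ge0// ltW.
Qed.
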